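(* Let $1\leqslant s\leqslant\infty$, $s'=s/(s-1)$ and $k\in(0,1)$. Then for every $f\in L^2_{\infty,s}(\mathbb{R})$, there holds the sharp inequality $$\left\|D^k_-f\right\|_{L_\infty(\mathbb{R})}\leqslant\frac{\left\|D^k_-\Phi_{k,s}\right\|_{L_\infty(\mathbb{R})}}{\left\|\Phi_{k,s}\right\|_{L_\infty(\mathbb{R})}^{1-\lambda}}\,\|f\|_{L_\infty(\mathbb{R})}^{1-\lambda}\,\|f''\|_{L_s(\mathbb{R})}^{\lambda},\qquad\lambda=\frac{k}{2-1/s},$$ where $\Phi_{k,s}:=\left\|\varphi_{k,s}''\right\|_{L_s(\mathbb{R})}^{-1}\cdot\varphi_{k,s}$ for $s>1$ and $\Phi_{k,1}:=\varphi_{k,1}$, with $\varphi_{k,s}$ the functions defined in the context.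
   Context: $L^2_{\infty,s}(\mathbb{R})$ is the space of $f\in L_\infty(\mathbb{R})$ such that $f'$ is locally absolutely continuous and $f''\in L_s(\mathbb{R})$. For $s=\infty$, $s'=1$ and $1/s=0$. For $p\in[0,k/(1-k)]$ let $\omega(p;x)=0$ for $x\leqslant-p$; $\omega(p;x)=(1+p)^{-1}$ for $x\in(-p,1)$; $\omega(p;x)=(1-k)x^{-k}$ for $x\geqslant1$. Let $\tau(p;x)=\rho(x)-\int_{-\infty}^x\omega(p;t)\,dt$, where $\rho(x)=x^{1-k}$ for $x>0$ and $\rho(x)=0$ for $x\leqslant0$. Write $g_{(s')}:=|g|^{s'-1}\mathrm{sign}\,g$. For $s>1$, $$\varphi_s(p;x)=\frac12\int_{-p}^1t\,\tau_{(s')}(p;t)\,dt+\int_{-p}^x(x-t)\,\tau_{(s')}(p;t)\,dt,$$ where, since $\tau(p;t)=0$ for $t\leqslant-p$, the integrand is taken as $0$ for $t<-p$ (so the last integral is $0$ for $x\leqslant-p$). For $s=1$: $\varphi_1(p;x)=(1+p)/4$ for $x\leqslant-p$, $\varphi_1(p;x)=(1+p-2x)/4-\frac{p}{2}+\frac{p}{2}\cdot\frac{}{}$ — to be read as the continuous function that equals $(1+p)/4$ for $x\leqslant-p$, is affine on $[-p,1]$, and equals $-(1+p)/4$ for $x\geqslant1$, i.e. $\varphi_1(p;x)=(1-p-2x)/4$ for $x\in(-p,1)$. For $s>1$, $p_{k,s}$ is the unique solution on $[0,k/(1-k)]$ of $\int_{-p}^1\tau_{(s')}(p;t)\,dt=0$;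 $p_{k,1}$ is the unique solution on $[0,k/(1-k)]$ of $k^k(1-k)^{1-k}(1+p)-(2p)^k=0$. Set $\varphi_{k,s}:=\varphi_s(p_{k,s};\cdot)$. Marchaud derivative: for $k>0$, $k\notin\mathbb{N}$, $f:\mathbb{R}\to\mathbb{R}$, $x\in\mathbb{R}$, $D^k_-f(x)=\frac{1}{\varkappa(k,n)}\int_0^{+\infty}\frac{(\Delta^n_{-t}f)(x)}{t^{1+k}}\,dt$, where $n\in\mathbb{N}$, $n>k$ (the definition does not depend on $n$), $(\Delta^n_{-t}f)(x)=\sum_{m=0}^n(-1)^m\binom{n}{m}f(x+mt)$ and $\varkappa(k,n)=\Gamma(-k)\sum_{m=0}^n(-1)^m\binom{n}{m}m^k$. ''Sharp'' means that the constant on the right-hand side cannot be replaced by a smaller one. *)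

(* Defs.v *)
From HB Require Import structures.
From mathcomp Require Import all_boot all_order all_algebra.
From mathcomp Require Import all_classical all_reals all_analysis.

Set Implicit Arguments.
Unset Strict Implicit.
Unset Printing Implicit Defensive.

Import Order.TTheory GRing.Theory Num.Theory.
Import numFieldNormedType.Exports.

Local Open Scope classical_set_scope.
Local Open Scope ring_scope.

Definition Ls_norm (R : realType) (s : \bar R) (f : R -> R) : \bar R :=
  Lnorm (@lebesgue_measure R) s (EFin \o f).

Definition abs_continuous_on (R : realType) (a b : R) (f : R -> R) : Prop :=
  forall e : R, 0 < e -> exists2 d : R, 0 < d &
    forall (N : nat) (u v : 'I_N -> R),
      (forall i, a <= u i /\ u i <= v i /\ v i <= b) ->
      trivIset setT (fun i => `]u i, v i[%classic) ->
      \sum_(i < N) (v i - u i) < d ->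
      \sum_(i < N) `|f (v i) - f (u i)| < e.

Definition locally_abs_continuous (R : realType) (f : R -> R) : Prop :=
  forall a b : R, a <= b -> abs_continuous_on a b f.

(* [f^`(2)] is total: it takes a default value at the points, negligible when
   f' is locally absolutely continuous, where f' is not derivable. *)
Definition L2infty (R : realType) (s : \bar R) (f : R -> R) : Prop :=
  [/\ f \in Lfun (@lebesgue_measure R) +oo%E,
      forall x : R, derivable f x 1,
      locally_abs_continuous f^`()%classic
    & f^`(2)%classic \in Lfun (@lebesgue_measure R) s].

(* Euler's integral for x > 0, extended to x <= 0 by
   Gamma x = Gamma (x + m) / (x (x + 1) ... (x + m - 1)), m least such that
   x + m > 0; meaningless at the poles 0, -1, -2, ... *)
Definition Gamma_integral (R : realType) (x : R) : R :=
  \int[lebesgue_measure]_(t in `]0, +oo[) (t `^ (x - 1) * expR (- t)).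

Definition Gamma (R : realType) (x : R) : R :=
  let m := if 0 < x then 0%N else (Num.truncn (- x)).+1 in
  Gamma_integral (x + m%:R) / \prod_(i < m) (x + i%:R).

Definition Delta_minus (R : realType) (n : nat) (t : R) (f : R -> R) (x : R) : R :=
  \sum_(m < n.+1) (-1) ^+ m * 'C(n, m)%:R * f (x + m%:R * t).

Definition varkappa (R : realType) (k : R) (n : nat) : R :=
  Gamma (- k) * \sum_(m < n.+1) (-1) ^+ m * 'C(n, m)%:R * m%:R `^ k.

(* The integral is the Lebesgue one; for n > k > 0, k not an integer, and
   integrable integrand, the value does not depend on n. *)
Definition marchaud (R : realType) (k : R) (n : nat) (f : R -> R) (x : R) : R :=
  (varkappa k n)^-1 *
  \int[lebesgue_measure]_(t in `]0, +oo[) (Delta_minus n t f x / t `^ (1 + k)).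

Definition rho (R : realType) (k x : R) : R :=
  if 0 < x then x `^ (1 - k) else 0.

Definition omega (R : realType) (k p x : R) : R :=
  if x <= - p then 0
  else if x < 1 then (1 + p)^-1
  else (1 - k) * x `^ (- k).

Definition tau (R : realType) (k p x : R) : R :=
  rho k x - \int[lebesgue_measure]_(t in `]-oo, x]) omega k p t.

(* tau_(s') with g_(s') = |g|^(s' - 1) sign g; only used for 1 < s, so that s'
   is finite. At a zero of g this is 0, also when s' = 1. *)
Definition tau_pow (R : realType) (k : R) (s : \bar R) (p x : R) : R :=
  `|tau k p x| `^ (fine (hoelder_conjugate s) - 1) * Num.sg (tau k p x).

(* For x < - p the interval [- p, x] is empty and the second integral is 0. *)
Definition phi_gt1 (R : realType) (k : R) (s : \bar R) (p x : R) : R :=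
  2^-1 * (\int[lebesgue_measure]_(t in `[- p, 1]) (t * tau_pow k s p t)) +
  \int[lebesgue_measure]_(t in `[- p, x]) ((x - t) * tau_pow k s p t).

Definition phi_eq1 (R : realType) (p x : R) : R :=
  if x <= - p then (1 + p) / 4
  else if x < 1 then (1 - p - 2 * x) / 4
  else - (1 + p) / 4.

Definition phi (R : realType) (k : R) (s : \bar R) (p : R) : R -> R :=
  if s == 1%E then phi_eq1 p else phi_gt1 k s p.

Definition p_equation (R : realType) (k : R) (s : \bar R) (p : R) : Prop :=
  if s == 1%E
  then k `^ k * (1 - k) `^ (1 - k) * (1 + p) - (2 * p) `^ k = 0
  else \int[lebesgue_measure]_(t in `[- p, 1]) tau_pow k s p t = 0.

(* The equation has exactly one solution in [0, k / (1 - k)] when 0 < k < 1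
   and 1 <= s; [xget] selects it. *)
Definition p_opt (R : realType) (k : R) (s : \bar R) : R :=
  xget 0 [set p : R | 0 <= p <= k / (1 - k) /\ p_equation k s p].

Definition phi_opt (R : realType) (k : R) (s : \bar R) : R -> R :=
  phi k s (p_opt k s).

Definition Phi (R : realType) (k : R) (s : \bar R) : R -> R :=
  if s == 1%E then phi_opt k s
  else fun x => (fine (Ls_norm s (phi_opt k s)^`(2)%classic))^-1 * phi_opt k s x.

Definition lambda (R : realType) (k : R) (s : \bar R) : R :=
  k / (2 - fine (s^-1)%E).

(* [fine] sends an infinite norm to 0: an infinite norm of [Phi] or of its
   derivative would make this constant 0. *)
Definition sharp_constant (R : realType) (k : R) (n : nat) (s : \bar R) : R :=
  fine (Ls_norm +oo%E (marchaud k n (Phi k s))) /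
  fine (Ls_norm +oo%E (Phi k s)) `^ (1 - lambda k s).

(* The right-hand side is built from norms that are finite for f in the class;
   the left-hand norm stays extended-real, so its finiteness is asserted. *)
Definition kolmogorov_inequality (R : realType) (k : R) (n : nat) (s : \bar R)
    (C : R) (f : R -> R) : Prop :=
  (Ls_norm +oo (marchaud k n f) <=
   (C * fine (Ls_norm +oo%E f) `^ (1 - lambda k s)
      * fine (Ls_norm s f^`(2)%classic) `^ lambda k s)%R%:E)%E.

(* Main.v *)
(* Write [I f x] for the integral of [(f x - f (x + t)) / t^(1 + k)] over [t > 0].
   For every admissible [n] the Marchaud derivative of [f] is the same constant
   multiple of [I f], so only [I] matters, and by translation only the point [0].
   Exchanging integrals expresses [k (1 - k) I f 0] through values of [f] and the
   integral of [f''] against [tau p] over [-p, 1]; the values of [f] contribute at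
   most [2 M / (1 + p)] when [|f| <= M].  Hoelder's inequality gives an additive
   estimate, and the dilation [f (h .)] with a suitable [h] turns it into the
   multiplicative one, without any optimisation.
   For [s > 1] the equation defining [p_opt] makes [phi] decrease from its maximum
   at [-p] to the opposite value at [1], and [phi''] is the dual function of [tau]:
   both steps are equalities for [phi].
   For [s = 1], [phi] is a ramp, whose second derivative is a measure; it is a
   limit of functions of the class.  The value of the constant does not depend on
   the length of the ramp, which is why the ramp on [-p, 1] is as good as the one
   determined by [tau].
   The fundamental theorem of calculus for [f'] is obtained by showing that the
   Stieltjes measure of the total variation is absolutely continuous. *)
Require Import Defs.
From HB Require Import structures.
From mathcomp Require Import all_boot all_order all_algebra.
From mathcomp Require Import all_classical all_reals all_analysis.
From mathcomp Require Import measurable_realfun ess_sup_inf.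
From mathcomp Require Import lra ring.
Import Order.TTheory GRing.Theory Num.Theory.
Import numFieldNormedType.Exports.
Local Open Scope classical_set_scope.
Local Open Scope ring_scope.
Set Implicit Arguments.
Unset Strict Implicit.
Unset Printing Implicit Defensive.

(** For every [p] in [0, k / (1 - k)] the additive estimate holds; [p] is fixed by asking that one
    function attain both parts of it. To attain [2 M / (1 + p)] it should equal M at [- p] and -M
    from 1 on. For s > 1 its second derivative should be a multiple of the dual function of [tau],
    which leaves it constant beyond 1 only if that dual function has integral 0. For s = 1 the
    second derivative should be two opposite masses at the minimum and the maximum of [tau], whose
    values must then be opposite: this is the equation with powers of [k] and [1 - k]. The exponent
    [lambda] comes from dilations, which multiply the singular integral by [h^k] and the norm of the
    second derivative by [h^(2 - 1/s)]. Two obstacles shape the details. The second derivative is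
    merely in L_s, so each integration by parts is an application of Fubini's theorem on a triangle.
    The norms are essential suprema, so a value at one point counts only for a continuous function;
    hence the singular integral of a bounded Lipschitz function is shown to be Hoelder
    continuous. *)

Local Notation lebesgue := lebesgue_measure.

(** * Locally absolutely continuous functions *)

(** Families indexed by pairs of an interval and a piece of its subdivision are needed next, not
    only families indexed by ['I_N]. *)
Lemma ac_fintype (R : realType) (a b : R) (g : R -> R) :
  abs_continuous_on a b g -> forall e : R, 0 < e -> exists2 d : R, 0 < d &
    forall (I : finType) (u v : I -> R),
      (forall i, a <= u i /\ u i <= v i /\ v i <= b) ->
      trivIset setT (fun i => `]u i, v i[%classic) ->
      \sum_i (v i - u i) < d -> \sum_i `|g (v i) - g (u i)| < e.
Proof.
move=> acg e /acg[d d0 dP]; exists d => // I u v uv tI ltd.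
have := dP #|I| (u \o enum_val) (v \o enum_val) (fun i => uv _).
rewrite -(@big_enum_val _ _ _ I predT (fun i => v i - u i)).
rewrite -(@big_enum_val _ _ _ I predT (fun i => `|g (v i) - g (u i)|)).
apply => //; move=> i j _ _ /= ne.
by apply/enum_val_inj/tI.
Qed.

(** The pieces of subdivisions of disjoint intervals form one disjoint family of the same total
    length, so a single [d] controls all the variations at once. *)
Lemma ac_variation (R : realType) (a b : R) (g : R -> R) :
  abs_continuous_on a b g -> forall e : R, 0 < e -> exists2 d : R, 0 < d &
    forall N (u v : 'I_N -> R) (s : 'I_N -> seq R),
      (forall i, a <= u i /\ u i <= v i /\ v i <= b) ->
      trivIset setT (fun i => `]u i, v i[%classic) ->
      (forall i, itv_partition (u i) (v i) (s i)) ->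
      \sum_i (v i - u i) < d -> \sum_i variation (u i) (v i) g (s i) < e.
Proof.
move=> /ac_fintype acg e /acg[d d0 dP]; exists d => // N u v s uv tI ps ltd.
pose x i k := nth (v i) (u i :: s i) k.
have xlt i k l : (k < l)%N -> (l <= size (s i))%N -> x i k < x i l.
  move=> kl ls; have [sp _] := ps i.
  have := @sorted_ltn_nth _ <%R lt_trans (v i) (u i :: s i) sp k l.
  by rewrite !inE /=; apply => //; rewrite ltnS // (leq_trans (ltnW kl)).
have xle i k l : (k <= l)%N -> (l <= size (s i))%N -> x i k <= x i l.
  by rewrite leq_eqVlt => /predU1P[->//|kl] ls; exact/ltW/xlt.
have xge i k : (k <= size (s i))%N -> u i <= x i k.
  by move=> ks; apply: itv_partition_nth_ge; rewrite ?ltnS.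
have xlev i k : (k <= size (s i))%N -> x i k <= v i.
  by move=> ks; apply: itv_partition_nth_le; rewrite ?ltnS.
have := dP {i : 'I_N & 'I_(size (s i))} (fun p => x (tag p) (tagged p))
  (fun p => x (tag p) (tagged p).+1).
rewrite -(@sig_big_dep _ _ _ _ (fun i => 'I_(size (s i)) : finType) predT (fun _ => predT)
  (fun i j => x i j.+1 - x i j)).
rewrite -(@sig_big_dep _ _ _ _ (fun i => 'I_(size (s i)) : finType) predT (fun _ => predT)
  (fun i j => `|g (x i j.+1) - g (x i j)|)) /=.
have -> : \sum_(i < N) \sum_(j < size (s i)) `|g (x i j.+1) - g (x i j)| =
    \sum_i variation (u i) (v i) g (s i).
  by apply: eq_bigr => i _; rewrite /variation big_mkord.
apply.
- move=> [i j] /=; have [uvi [uvi' uvi'']] := uv i; split; [|split].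
  + by rewrite (le_trans uvi)// xge// ltnW.
  + exact: xle.
  + by rewrite (le_trans _ uvi'')// xlev.
(* Overlapping pieces lie in overlapping intervals, hence in the same one; there the order of the
   nodes decides. *)
- move=> [i j] [i' j'] _ _ /= [z [/=]]; rewrite !in_itv/= => /andP[z1 z2] /andP[z3 z4].
  have ii' : i = i'.
    apply: tI => //; exists z; split; rewrite /= in_itv/=; apply/andP; split.
    + by rewrite (le_lt_trans _ z1)// xge// ltnW.
    + by rewrite (lt_le_trans z2)// xlev.
    + by rewrite (le_lt_trans _ z3)// xge// ltnW.
    + by rewrite (lt_le_trans z4)// xlev.
  move: j' z3 z4; rewrite -ii' => j' z3 z4.
  congr existT; apply: val_inj => /=; case: (ltngtP j j') => // jj'.
  + have := lt_trans z3 z2; rewrite ltNge => /negP[].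
    by apply: xle => //; exact/ltnW.
  + have := lt_trans z1 z4; rewrite ltNge => /negP[].
    by apply: xle => //; exact/ltnW.
- apply: le_lt_trans ltd; apply: ler_sum => i _.
  rewrite -(big_mkord xpredT (fun j => x i j.+1 - x i j)) telescope_sumr//.
  by rewrite /x /= (itv_partition_nth_size _ (ps i)).
Qed.

(** With [d] taken for the tolerance 1, an interval shorter than [d] has variation at most 1, and
    finitely many steps of length [d / 2] cover [a, b]. *)
Lemma ac_bounded_variation (R : realType) (a b : R) (g : R -> R) : a <= b ->
  abs_continuous_on a b g -> bounded_variation a b g.
Proof.
move=> ab acg; have [d d0 dP] := ac_variation acg (@ltr01 R).
have TV1 x y : a <= x -> x <= y -> y <= b -> y - x < d ->
    (total_variation x y g <= 1)%E.
  move=> ax xy yb yxd; apply: ge_ereal_sup => _ /= [_ [s xys <-] <-].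
  rewrite lee_fin ltW//.
  have := dP 1%N (fun=> x) (fun=> y) (fun=> s); rewrite !big_ord1; apply => //.
  by move=> i j _ _ _; rewrite !ord1.
have TVn n x : a <= x -> x <= b -> x - a < (d / 2) * n%:R ->
    (total_variation a x g <= n%:R%:E)%E.
  elim: n x => [|n ih] x ax xb; first by rewrite mulr0 subr_lt0 ltNge ax.
  move=> xn.
  pose y := Num.max a (x - d / 2).
  have ay : a <= y by rewrite le_max lexx.
  have yx : y <= x by rewrite ge_max ax/= gerBl divr_ge0// ltW.
  rewrite (total_variationD _ ay yx) -natr1 EFinD leeD//.
    have [y1|y1] := leP (x - d / 2) a.
      by rewrite /y max_l// total_variationxx lee_fin ler0n.
    apply: ih => //; first exact: le_trans xb.
    by rewrite /y max_r ?(ltW y1)//; move: xn; rewrite -natr1; lra.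
  apply: TV1 => //.
  have : x - d / 2 <= y by rewrite le_max lexx orbT.
  by lra.
apply/bounded_variationP => //.
rewrite ge0_fin_numE ?total_variation_ge0//.
apply: le_lt_trans (TVn (Num.bound ((b - a) / (d / 2))) b ab (lexx _) _) (ltry _).
rewrite mulrC -ltr_pdivrMr ?divr_gt0//.
by rewrite archi_boundP// !divr_ge0 ?subr_ge0// ltW.
Qed.

Lemma ac_continuous (R : realType) (g : R -> R) :
  locally_abs_continuous g -> continuous g.
Proof.
move=> acg x; apply/cvgrPdist_lt => e e0.
have x1 : x - 1 <= x + 1 by lra.
have [d d0 dP] := acg _ _ x1 _ e0.
have key u v : x - 1 <= u -> u <= v -> v <= x + 1 -> v - u < d ->
    `|g v - g u| < e.
  move=> h1 h2 h3 h4.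
  have := dP 1%N (fun=> u) (fun=> v); rewrite !big_ord1; apply => //.
  by move=> i j _ _ _; rewrite !ord1.
near=> y.
have yx1 : `|x - y| < 1 by near: y; apply: cvgr_dist_lt => //; exact: cvg_id.
have yxd : `|x - y| < d by near: y; apply: cvgr_dist_lt => //; exact: cvg_id.
move: yx1 yxd; rewrite !ltr_norml => /andP[h1 h2] /andP[h3 h4].
have [xy|yx] := leP x y.
  have := key x y; rewrite ltr_norml; lra.
by have := key y x; rewrite ltr_norml; lra.
Unshelve. all: by end_near. Qed.

(** The variation function inherits absolute continuity: on each interval some subdivision nearly
    attains the total variation, and the losses together stay within [e / 2]. *)
Lemma ac_total_variation (R : realType) (a b : R) (g : R -> R) : a <= b ->
  abs_continuous_on a b g -> forall e : R, 0 < e -> exists2 d : R, 0 < d &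
    forall N (u v : 'I_N -> R),
      (forall i, a <= u i /\ u i <= v i /\ v i <= b) ->
      trivIset setT (fun i => `]u i, v i[%classic) ->
      \sum_i (v i - u i) < d ->
      \sum_i (fine (total_variation a (v i) g) -
              fine (total_variation a (u i) g)) < e.
Proof.
move=> ab acg e e0; have bvg := ac_bounded_variation ab acg.
have e20 : 0 < e / 2 by rewrite divr_gt0.
have [d d0 dP] := ac_variation acg e20.
exists d => // N u v uv tI ltd.
have TVfin x y : a <= x -> x <= y -> y <= b ->
    total_variation x y g \is a fin_num.
  move=> ax xy yb; apply/bounded_variationP => //.
  apply: (bounded_variationl xy yb); exact: bounded_variationr (le_trans xy yb) bvg.
(* The divisor is [N.+1] so that an empty family is allowed. *)
have /choice[s sP] : forall i, exists s, itv_partition (u i) (v i) s /\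
    fine (total_variation (u i) (v i) g) <=
      variation (u i) (v i) g s + e / 2 / N.+1%:R.
  move=> i; have [aui [uvi vib]] := uv i.
  have eN : 0 < e / 2 / N.+1%:R by rewrite divr_gt0.
  have [_ /= [_ [s ps <-] <-]] := ub_ereal_sup_adherent eN (TVfin _ _ aui uvi vib).
  move=> /ltW h; exists s; split => //.
  by move: h; rewrite -/(total_variation _ _ _) -(fineK (TVfin _ _ aui uvi vib)) -EFinB lee_fin lerBlDr.
apply: (@le_lt_trans _ _ (\sum_i (variation (u i) (v i) g (s i) + e / 2 / N.+1%:R))).
  apply: ler_sum => i _; have [aui [uvi vib]] := uv i.
  rewrite (total_variationD g aui uvi) fineD ?TVfin ?(le_trans uvi)//.
  by rewrite addrAC subrr add0r; exact: (sP i).2.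
rewrite big_split/= sumr_const card_ord.
have -> : (e / 2 / N.+1%:R) *+ N = e / 2 * (N%:R / N.+1%:R).
  by rewrite -[LHS]mulr_natr mulrAC mulrA.
have h1 : (N%:R / N.+1%:R : R) <= 1 by rewrite ler_pdivrMr// mul1r ler_nat.
have h2 := dP N u v s uv tI (fun i => (sP i).1) ltd.
have h3 : e / 2 * (N%:R / N.+1%:R) <= e / 2 by rewrite ger_pMr.
by rewrite [ltRHS]splitr; exact: ltr_leD h2 h3.
Qed.

Lemma lebesgue_stieltjes_oc (R : realType) (F : cumulative R R) (x y : R) :
  x <= y -> lebesgue_stieltjes_measure F `]x, y]%classic = (F y - F x)%:E.
Proof.
move=> xy; rewrite /lebesgue_stieltjes_measure /measure_extension.
rewrite measurable_mu_extE/=; last exact: is_ocitv.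
by rewrite wlength_itv_bnd.
Qed.

Lemma open_itv_bounded (R : realType) (a b : R) (I : set R) : a <= b ->
  open I -> is_interval I -> I `<=` `]a, b[%classic ->
  exists u v, [/\ a <= u, u <= v, v <= b & I = `]u, v[%classic].
Proof.
move=> ab oI iI Iab.
have [->|/set0P I0] := eqVneq I set0.
  by exists a, a; rewrite lexx set_itvoo0.
have lbI : lbound I a by move=> z /Iab /=; rewrite in_itv/= => /andP[/ltW].
have ubI : ubound I b by move=> z /Iab /=; rewrite in_itv/= => /andP[_ /ltW].
exists (inf I), (sup I); split.
- exact: lb_le_inf.
- have [z Iz] := I0.
  rewrite (@le_trans _ _ z)//; first by apply: ge_inf => //; exists a.
  by apply: ub_le_sup => //; exists b.
- exact: ge_sup.
- rewrite -[LHS](iffLR (interior_id _) oI) interval_bounded_interior//; first last.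
    by exists b.
    by exists a.
Qed.

(** Radon-Nikodym for the Stieltjes measure of [F], cut down to ]a, b[ to be finite; this cut is why
    the conclusion asks for [y < b]. Domination holds because a null set lies in an open set of
    small length, whose components are disjoint intervals. *)
Lemma monotone_ac_density (R : realType) (a b : R) (F : R -> R) : a < b ->
  nondecreasing_fun F -> continuous F ->
  (forall e : R, 0 < e -> exists2 d : R, 0 < d &
    forall N (u v : 'I_N -> R),
      (forall i, a <= u i /\ u i <= v i /\ v i <= b) ->
      trivIset setT (fun i => `]u i, v i[%classic) ->
      \sum_i (v i - u i) < d -> \sum_i (F (v i) - F (u i)) < e) ->
  exists psi : R -> R, (@lebesgue R).-integrable setT (EFin \o psi) /\
    forall x y, a <= x -> x <= y -> y < b ->
      F y - F x = \int[lebesgue]_(t in `]x, y]) psi t.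
Proof.
move=> ab ndF cF acF.
have rcF : right_continuous F.
  move=> x; apply: cvg_at_right_filter; exact: cF.
pose c : cumulative R R := HB.pack F (isCumulative.Build R _ R F ndF rcF).
pose m : {measure set (measurableTypeR R) -> \bar R} := lebesgue_stieltjes_measure c.
have mE x y : x <= y -> m `]x, y]%classic = (F y - F x)%:E.
  exact: (lebesgue_stieltjes_oc c).
have mab : measurable (`]a, b[%classic : set (measurableTypeR R)).
  exact: measurable_itv.
have mfin : (m `]a, b[%classic < +oo)%E.
  apply: (@le_lt_trans _ _ (m `]a, b]%classic)).
    by apply: le_measure; rewrite ?inE//=; exact: subset_itv_oo_oc.
  by rewrite mE ?ltry// ltW.
pose nu := mfrestr mab mfin.
have dom : nu `<< (@lebesgue R).
  apply/null_content_dominatesP => A mA A0.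
  rewrite /nu /mfrestr /mrestr.
  apply/eqP; rewrite eq_le measure_ge0 andbT; apply/lee_addgt0Pr => e e0.
  rewrite add0e.
  have [d d0 dP] := acF _ e0.
  have Afin : (lebesgue A < +oo)%E by rewrite A0.
  have [U [oU AU Ud]] := lebesgue_regularity_outer mA Afin d0.
  pose V := U `&` `]a, b[%classic.
  have oV : open V by apply: openI => //; exact: interval_open.
  have AV : A `&` `]a, b[%classic `<=` V by move=> z [/AU Uz abz]; split.
  have mV : measurable V by exact: measurable_realfun.open_measurable.
  have Vd : (lebesgue V < d%:E)%E.
    apply: le_lt_trans Ud; rewrite -[leRHS]adde0 -A0.
    have mU : measurable U by exact: measurable_realfun.open_measurable.
    apply: le_trans (measureU2 _ _ mA); last exact: measurableD.
    apply: le_measure; rewrite ?inE//; first by apply: measurableU => //; exact: measurableD.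
    by move=> z [Uz _]; have [Az|Az] := pselect (A z); [right|left].
  pose I := open_disjoint_itv oV.
  have /choice[uv uvP] : forall n, exists uv : R * R,
      [/\ a <= uv.1, uv.1 <= uv.2, uv.2 <= b & I n = `]uv.1, uv.2[%classic].
    move=> n.
    have [||||u [v h]] := @open_itv_bounded R a b (I n); last by exists (u, v).
    - exact: ltW.
    - exact: open_disjoint_itv_open.
    - exact: open_disjoint_itv_is_interval.
    - move=> z Iz; have : V z by rewrite (open_disjoint_itv_bigcup oV); exists n.
      by case.
  have mI n : measurable (I n).
    by have [_ _ _ ->] := uvP n; exact: measurable_itv.
  apply: (@le_trans _ _ (m V)).
    by apply: le_measure; rewrite ?inE//; apply: measurableI.
  have VE : V = \bigcup_n I n by exact: open_disjoint_itv_bigcup.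
  rewrite VE measure_semi_bigcup//; last 2 first.
  - exact: open_disjoint_itv_trivIset.
  - by rewrite -VE.
  (* Absolute continuity speaks of finite families, so the mass of the countable union is bounded
     along its partial sums. *)
  apply: lime_le; first exact: is_cvg_nneseries.
  apply: nearW => n.
  apply: (@le_trans _ _ (\sum_(0 <= i < n) (F (uv i).2 - F (uv i).1)%:E)%E).
    apply: lee_sum => i _; have [_ uvi _ ->] := uvP i.
    rewrite -(mE _ _ uvi).
    by apply: le_measure; rewrite ?inE//=; exact: subset_itv_oo_oc.
  rewrite sumEFin lee_fin big_mkord; apply/ltW.
  apply: (dP n (fun i => (uv i).1) (fun i => (uv i).2)).
  - by move=> i; have [] := uvP i.
  - move=> i j _ _ /=.
    have [_ _ _ <-] := uvP i; have [_ _ _ <-] := uvP j.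
    move=> ij; apply/val_inj.
    exact: (@open_disjoint_itv_trivIset R V oV i j Logic.I Logic.I ij).
  - rewrite -lte_fin; apply: le_lt_trans Vd.
    rewrite -sumEFin VE measure_semi_bigcup//; last 2 first.
    - exact: open_disjoint_itv_trivIset.
    - by rewrite -VE.
    apply: le_trans (nneseries_lim_ge n _) => //.
    rewrite big_mkord; apply: lee_sum => i _.
    have [_ uvi _ ->] := uvP i.
    apply: (@le_trans _ _ (lebesgue `](uv i).1, (uv i).2[%classic)); last exact: lexx.
    by rewrite lebesgue_measure_itv/= lte_fin; case: ltgtP uvi => // ->; rewrite subrr.
pose f := Radon_Nikodym (charge_of_finite_measure nu) (@lebesgue R).
have ffin x : f x \is a fin_num by exact: Radon_Nikodym_fin_num.
have fE : EFin \o (fine \o f) = f by apply/funext => x /=; rewrite fineK.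
exists (fine \o f); split.
  rewrite fE; exact: Radon_Nikodym_integrable.
move=> x y ax xy yb.
have nuE : nu `]x, y]%classic = (\int[lebesgue]_(t in `]x, y]) f t)%E.
  exact: (Radon_Nikodym_integral (nu := charge_of_finite_measure nu)).
have nuF : nu `]x, y]%classic = (F y - F x)%:E.
  rewrite -(mE _ _ xy); congr (m _).
  apply/seteqP; split => [z []//|z/=]; rewrite !in_itv/= => /andP[xz zy]; split.
    by rewrite xz.
  by rewrite (le_lt_trans ax xz) (le_lt_trans zy yb).
rewrite /Rintegral (_ : (fun t => (fine (f t))%:E) = f); last by rewrite -fE.
by rewrite -nuE nuF.
Qed.

(** Composition with the projection [clip] onto [a, b], monotone and 1-Lipschitz, makes [F] monotone
    and continuous on the whole line. *)
Lemma monotone_ac_density_itv (R : realType) (a b : R) (F : R -> R) : a < b ->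
  (forall x y, a <= x -> x <= y -> y <= b -> F x <= F y) ->
  (forall e : R, 0 < e -> exists2 d : R, 0 < d &
    forall N (u v : 'I_N -> R),
      (forall i, a <= u i /\ u i <= v i /\ v i <= b) ->
      trivIset setT (fun i => `]u i, v i[%classic) ->
      \sum_i (v i - u i) < d -> \sum_i (F (v i) - F (u i)) < e) ->
  exists psi : R -> R, (@lebesgue R).-integrable setT (EFin \o psi) /\
    forall x y, a <= x -> x <= y -> y < b ->
      F y - F x = \int[lebesgue]_(t in `]x, y]) psi t.
Proof.
move=> ab ndF acF; pose clip z := Num.max a (Num.min z b).
have cab z : a <= clip z /\ clip z <= b.
  by rewrite le_max lexx ge_max (ltW ab) ge_min lexx orbT.
have clip_id z : a <= z -> z <= b -> clip z = z.
  by move=> az zb; rewrite /clip min_l// max_r.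
have clip_le y z : y <= z -> clip y <= clip z.
  by move=> yz; rewrite /clip ge_max !le_max lexx/= le_min !ge_min yz lexx/= !orbT.
have clip_lip y z : y <= z -> clip z - clip y <= z - y.
  by move=> yz; rewrite /clip; case: (leP z b) => ?; case: (leP y b) => ?; case: (leP a z) => ?; case: (leP a y) => ?; case: (leP a b) => ?; lra.
have [psi [ipsi psiE]] : exists psi : R -> R,
    (@lebesgue R).-integrable setT (EFin \o psi) /\
    forall x y, a <= x -> x <= y -> y < b ->
      (F \o clip) y - (F \o clip) x = \int[lebesgue]_(t in `]x, y]) psi t.
  apply: monotone_ac_density => //.
  - move=> y z yz /=; have [? ?] := cab y; have [? ?] := cab z.
    by apply: ndF => //; exact: clip_le.
  - move=> x; apply/cvgrPdist_lt => e e0.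
    have [d d0 dP] := acF _ e0.
    have key u v : u <= v -> v - u < d -> `|F (clip v) - F (clip u)| < e.
      move=> uv uvd; have [? ?] := cab u; have [? ?] := cab v.
      have uv' := clip_le _ _ uv.
      rewrite ger0_norm ?subr_ge0 ?ndF//.
      have := dP 1%N (fun=> clip u) (fun=> clip v); rewrite !big_ord1; apply => //.
        by move=> i j _ _ _; rewrite !ord1.
      exact: le_lt_trans (clip_lip _ _ uv) uvd.
    near=> y.
    have : `|x - y| < d by near: y; apply: cvgr_dist_lt => //; exact: cvg_id.
    rewrite ltr_norml => /andP[h1 h2].
    have [xy|yx] := leP x y.
      by rewrite /= distrC; apply: key => //; rewrite -opprB ltrNl.
    by apply: key => //; exact: ltW.
  - move=> e /acF[d d0 dP]; exists d => // N u v uv tI ltd.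
    have -> : \sum_i ((F \o clip) (v i) - (F \o clip) (u i)) =
        \sum_i (F (v i) - F (u i)).
      apply: eq_bigr => i _ /=; have [? [? ?]] := uv i.
      rewrite !clip_id//; first exact: (@le_trans _ _ (v i)).
      exact: (@le_trans _ _ (u i)).
    exact: dP.
exists psi; split => // x y ax xy yb; rewrite -psiE//= !clip_id//.
- by rewrite (le_trans xy)// ltW.
- exact: le_trans xy.
- exact: ltW.
Unshelve. all: by end_near. Qed.

(** Jordan decomposition: [g] is the difference of its variation function [T] and of [T - g]. Both
    are nondecreasing and absolutely continuous, the increments of the second being at most twice
    those of [T]. *)
Lemma ac_density (R : realType) (a b : R) (g : R -> R) : a < b ->
  abs_continuous_on a b g ->
  exists psi : R -> R, (@lebesgue R).-integrable setT (EFin \o psi) /\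
    forall x y, a <= x -> x <= y -> y < b ->
      g y - g x = \int[lebesgue]_(t in `]x, y]) psi t.
Proof.
move=> ab acg; have bvg := ac_bounded_variation (ltW ab) acg.
have acT := ac_total_variation (ltW ab) acg.
pose T x := fine (total_variation a x g).
have TVfin x y : a <= x -> x <= y -> y <= b ->
    total_variation x y g \is a fin_num.
  move=> ax xy yb; apply/bounded_variationP => //.
  apply: (bounded_variationl xy yb); exact: bounded_variationr (le_trans xy yb) bvg.
have Tg x y : a <= x -> x <= y -> y <= b -> `|g y - g x| <= T y - T x.
  move=> ax xy yb.
  rewrite /T (total_variationD g ax xy) fineD ?TVfin ?(le_trans xy)//.
  rewrite addrAC subrr add0r -lee_fin fineK ?TVfin//.
  exact: total_variation_ge.
have ndT x y : a <= x -> x <= y -> y <= b -> T x <= T y.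
  by move=> ax xy yb; rewrite -subr_ge0; apply: le_trans (Tg _ _ ax xy yb).
have [p1 [ip1 p1E]] := monotone_ac_density_itv ab ndT acT.
have [p2 [ip2 p2E]] : exists psi : R -> R,
    (@lebesgue R).-integrable setT (EFin \o psi) /\
    forall x y, a <= x -> x <= y -> y < b ->
      (T \- g) y - (T \- g) x = \int[lebesgue]_(t in `]x, y]) psi t.
  apply: monotone_ac_density_itv => //.
    move=> x y ax xy yb /=; have := Tg _ _ ax xy yb.
    by rewrite ler_norml; lra.
  move=> e e0; have e20 : 0 < e / 2 by lra.
  have [d d0 dP] := acT _ e20.
  exists d => // N u v uv tI ltd.
  apply: (@le_lt_trans _ _ (\sum_i 2 * (T (v i) - T (u i)))).
    apply: ler_sum => i _ /=; have [au [uvi vb]] := uv i.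
    by have := Tg _ _ au uvi vb; rewrite ler_norml; lra.
  rewrite -mulr_sumr.
  by have := dP N u v uv tI ltd; rewrite -/(T _) ltr_pdivlMr// mulrC.
exists (p1 \- p2); split.
  rewrite (_ : EFin \o _ = (EFin \o p1) \- (EFin \o p2))%E//.
  exact: integrableB.
move=> x y ax xy yb.
have i1 : (@lebesgue R).-integrable `]x, y]%classic (EFin \o p1).
  exact: integrableS ip1.
have i2 : (@lebesgue R).-integrable `]x, y]%classic (EFin \o p2).
  exact: integrableS ip2.
rewrite RintegralB// -p1E// -p2E//=.
by rewrite -!/(T _); lra.
Qed.

(** Lebesgue differentiation identifies the density with the derivative almost everywhere.
    Measurability does not pass through an almost everywhere equality, hence the hypothesis on the
    derivative. *)
Lemma ac_FTC (R : realType) (g : R -> R) : locally_abs_continuous g ->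
  measurable_fun setT g^`()%classic -> forall x y, x <= y ->
  (@lebesgue R).-integrable `]x, y]%classic (EFin \o g^`()%classic) /\
  g y - g x = \int[lebesgue]_(t in `]x, y]) g^`()%classic t.
Proof.
move=> acg mg x y xy.
(* The margin is needed because the density represents [g] only strictly below the right end. *)
have ab : x - 1 < y + 1 by lra.
have [psi [ipsi psiE]] := ac_density ab (acg _ _ (ltW ab)).
have ipsiS A : measurable A -> (@lebesgue R).-integrable A (EFin \o psi).
  by move=> mA; exact: integrableS ipsi.
pose G t := \int[lebesgue]_(z in `]x, t]) psi z.
have locpsi : locally_integrable setT psi.
  by apply: open_integrable_locally => //; exact: openT.
have ftc := @FTC1 R psi (BRight x) (fun y => ipsiS _ (measurable_itv _)) locpsi.
have Fae : Filter (almost_everywhere (@lebesgue R)).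
  exact: ae_filter_ringOfSetsType.
have axy : x - 1 <= x by lra.
have aeE : ae_eq lebesgue `]x, y]%classic (EFin \o psi) (EFin \o g^`()%classic).
  apply: filterS ftc => t /= + /andP[]; rewrite !bnd_simp => + xt ty.
  move=> /(_ xt)[dG <-]; congr EFin.
  rewrite !derive1E -[RHS](@near_eq_derive R R R (fun z => g x + G z))//.
    by rewrite deriveD ?derive_cst ?add0r//; exact: derivable_cst.
  near=> z.
  have xz : x <= z by apply/ltW; near: z; exact: lt_nbhsr.
  rewrite /G -psiE//; [by rewrite addrC subrK|].
  by near: z; apply: lt_nbhsl; lra.
have mpsi : measurable_fun `]x, y]%classic (EFin \o psi).
  by apply: measurable_int (ipsiS _ (measurable_itv _)).
have mg' : measurable_fun `]x, y]%classic (EFin \o g^`()%classic).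
  by apply/measurable_EFinP; exact: measurable_funTS.
have ig' : (@lebesgue R).-integrable `]x, y]%classic (EFin \o g^`()%classic).
  apply/integrableP; split => //.
  have /integrableP[_] := ipsiS `]x, y]%classic (measurable_itv _).
  apply: le_lt_trans; rewrite le_eqVlt; apply/orP; left; apply/eqP.
  apply: ge0_ae_eq_integral => //.
  - exact: measurableT_comp.
  - exact: measurableT_comp.
  - by apply: filterS aeE => t /= h xt; have [->] := h xt.
split => //; rewrite psiE//; last lra.
by congr fine; exact: ae_eq_integral.
Unshelve. all: by end_near. Qed.

(** * Affine substitutions and norms *)

(** The pushforward multiplied by [h] agrees with Lebesgue measure on half-open intervals, which
    determine it. *)
Lemma lebesgue_measure_affine (R : realType) (h c : R) (A : set R) : 0 < h ->
  measurable A ->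
  lebesgue A =
  (h%:E * lebesgue ((fun t => (h * t + c)%R) @^-1` A))%E.
Proof.
move=> h0 mA.
have mphi : measurable_fun setT (fun t : R => h * t + c).
  by apply: measurable_funD => //; exact: measurable_funM.
pose m := mscale (NngNum (ltW h0))
  (pushforward (@lebesgue R) (fun t : measurableTypeR R => h * t + c : measurableTypeR R)).
rewrite (@lebesgue_measure_unique R (m mphi))//.
move=> _ [[a b] _ <-]/=.
rewrite /m /mscale /= /pushforward.
rewrite (_ : _ @^-1` _ = `](a - c) / h, (b - c) / h]%classic); last first.
  apply/seteqP; split => t /=; rewrite !in_itv/= ltr_pdivrMr// ler_pdivlMr//.
    by move=> /andP[? ?]; apply/andP; split; lra.
  by move=> /andP[? ?]; apply/andP; split; lra.
rewrite !lebesgue_measure_itv/= !lte_fin ltr_pM2r ?invr_gt0// ltrD2r.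
case: ifPn => ab; last by rewrite mule0.
by rewrite -EFinB -EFinM; congr EFin; field; rewrite gt_eqF.
Qed.

Lemma ge0_integral_affine (R : realType) (h c : R) (D : set R) (f : R -> \bar R) :
  0 < h -> measurable D -> measurable_fun D f -> (forall x, D x -> 0 <= f x)%E ->
  (\int[lebesgue]_(x in D) f x =
   h%:E * \int[lebesgue]_(t in (fun t => h * t + c)%R @^-1` D) f (h * t + c)%R)%E.
Proof.
move=> h0 mD mf f0.
have mphi : measurable_fun setT (fun t : R => h * t + c).
  by apply: measurable_funD => //; exact: measurable_funM.
have h00 := ltW h0.
pose m := mscale (NngNum h00) (pushforward (@lebesgue R)
  (fun t : measurableTypeR R => h * t + c : measurableTypeR R)).
transitivity (\int[m mphi]_(x in D) f x)%E.
  apply: eq_measure_integral => A mA _; rewrite /mscale /=.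
  exact: lebesgue_measure_affine.
rewrite ge0_integral_mscale//; congr (_ * _)%E.
rewrite ge0_integral_pushforward//.
by move=> x; rewrite inE; exact: f0.
Qed.

Lemma integral_affine (R : realType) (h c : R) (D : set R) (f : R -> \bar R) :
  0 < h -> measurable D -> measurable_fun D f ->
  (\int[lebesgue]_(x in D) f x =
   h%:E * \int[lebesgue]_(t in (fun t => h * t + c)%R @^-1` D) f (h * t + c)%R)%E.
Proof.
move=> h0 mD mf; rewrite integralE [in RHS]integralE.
rewrite (@ge0_integral_affine _ h c _ f^\+%E)//; last exact: measurable_funepos.
rewrite (@ge0_integral_affine _ h c _ f^\-%E)//; last exact: measurable_funeneg.
rewrite funepos.unlock funeneg.unlock.
set p := (\int[_]_(t in _) _)%E; set n := (\int[_]_(t in _ @^-1` _) maxe (- f _) 0)%E.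
change (h%:E * p - h%:E * n = h%:E * (p - n))%E.
have p0 : (0 <= p)%E by apply: integral_ge0 => x _; rewrite le_max lexx orbT.
have n0 : (0 <= n)%E by apply: integral_ge0 => x _; rewrite le_max lexx orbT.
(* Integrability is not assumed, so either part may be infinite; a positive factor respects even the
   difference of two infinities. *)
have hy : (h%:E * +oo = +oo)%E by rewrite gt0_muley// lte_fin.
have hNy : (h%:E * -oo = -oo)%E by rewrite gt0_muleNy// lte_fin.
move: p n p0 n0 => [p||] [n||]// _ _; rewrite /= ?hy ?hNy//=.
by change ((h * p - h * n)%:E = (h * (p - n))%:E); rewrite mulrBr.
Qed.

Lemma integrable_affine (R : realType) (h c : R) (D : set R) (f : R -> R) :
  0 < h -> measurable D -> (@lebesgue R).-integrable D (EFin \o f) ->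
  (@lebesgue R).-integrable ((fun t => h * t + c) @^-1` D)
    (EFin \o (fun t => f (h * t + c))).
Proof.
move=> h0 mD /integrableP[mf ioo].
have mphi : measurable_fun setT (fun t : R => h * t + c).
  by apply: measurable_funD => //; exact: measurable_funM.
have mD' : measurable ((fun t : R => h * t + c) @^-1` D).
  by rewrite -[_ @^-1` _]setTI; exact: mphi.
apply/integrableP; split.
  apply: (measurable_comp mD _ mf); first by move=> _ [t Dt <-].
  exact: measurable_funTS.
move: ioo; rewrite (@ge0_integral_affine _ h c)//; last exact: measurableT_comp.
set i := (\int[_]_(t in _) _)%E => ioo.
have i0 : (0 <= i)%E by exact: integral_ge0.
change (i < +oo)%E; rewrite ltey; apply/negP => /eqP iy.
by move: ioo; rewrite iy gt0_muley ?lte_fin// ltxx.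
Qed.

Lemma Rintegral_affine (R : realType) (h c : R) (D : set R) (f : R -> R) :
  0 < h -> measurable D -> measurable_fun D f ->
  \int[lebesgue]_(x in D) f x =
   h * \int[lebesgue]_(t in (fun t => h * t + c) @^-1` D) f (h * t + c).
Proof.
move=> h0 mD mf; rewrite /Rintegral (@integral_affine _ h c)//; last exact/measurable_EFinP.
set i := (\int[_]_(t in _) _)%E; case: i => [r//||].
  by rewrite gt0_muley ?lte_fin//= mulr0.
by rewrite gt0_muleNy ?lte_fin//= mulr0.
Qed.

Lemma ae_affine (R : realType) (h c : R) (P : set R) : 0 < h ->
  {ae (@lebesgue R), forall x, P x} ->
  {ae (@lebesgue R), forall x, P (h * x + c)}.
Proof.
move=> h0 [N [mN N0 PN]].
have mphi : measurable_fun setT (fun t : R => h * t + c).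
  by apply: measurable_funD => //; exact: measurable_funM.
exists ((fun t => h * t + c) @^-1` N); split.
- by rewrite -[_ @^-1` _]setTI; exact: mphi.
- have := lebesgue_measure_affine c h0 mN; rewrite [LHS]N0 => /esym/eqP.
  by rewrite mule_eq0 eqe gt_eqF//= => /eqP.
- by move=> x /= Px; exact: PN.
Qed.

Lemma measurable_normr_powR (R : realType) (f : R -> R) (r : R) :
  measurable_fun setT f -> measurable_fun setT (fun x => (`|f x| `^ r)%:E).
Proof.
move=> mf; apply: measurableT_comp => //.
apply: (@measurableT_comp _ _ _ _ _ _ (@powR R ^~ r)) => //.
exact: measurableT_comp.
Qed.

Lemma lebesgue_setT_gt0 (R : realType) : (0 < @lebesgue R setT)%E.
Proof.
rewrite -set_itvNyy.
have -> : lebesgue `]-oo, +oo[%classic = +oo%E :> \bar R.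
  by rewrite lebesgue_measure_itv.
by rewrite ltry.
Qed.

Lemma Ls_norm_EFin (R : realType) (r : R) (f : R -> R) :
  Ls_norm r%:E f = ((\int[lebesgue]_x (`|f x| `^ r)%:E) `^ r^-1)%E.
Proof.
by rewrite /Ls_norm unlock; congr (_ `^ _)%E; apply: eq_integral => x _ /=.
Qed.

Lemma Ls_norm_pinfty (R : realType) (f : R -> R) :
  Ls_norm +oo%E f = ess_sup lebesgue (fun x => `|f x|%:E).
Proof. by rewrite /Ls_norm unlock lebesgue_setT_gt0. Qed.

Lemma Ls_norm_ge0 (R : realType) (s : \bar R) (f : R -> R) : (0 <= Ls_norm s f)%E.
Proof. exact: Lnorm_ge0. Qed.

Lemma Ls_norm_pinfty_le (R : realType) (f : R -> R) (y : \bar R) :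
  {ae @lebesgue R, forall x, `|f x|%:E <= y}%E <->
  (Ls_norm +oo%E f <= y)%E.
Proof. by rewrite Ls_norm_pinfty; split => [?|] ; [apply/ess_supP|move=> /ess_supP]. Qed.

Lemma Ls_normZ (R : realType) (s : \bar R) (a : R) (f : R -> R) :
  (1 <= s)%E -> measurable_fun setT f ->
  Ls_norm s (fun x => a * f x) = (`|a|%:E * Ls_norm s f)%E.
Proof.
move=> s1 mf; case: s s1 => [r|_|//].
- rewrite lee_fin => r1; have r0 : 0 < r by exact: lt_le_trans r1.
  rewrite !Ls_norm_EFin.
  under eq_integral do rewrite normrM powRM// EFinM.
  rewrite (_ : (\int[_]_x _)%E = (`|a| `^ r)%:E * \int[lebesgue]_x (`|f x| `^ r)%:E)%E; last first.
    by apply: ge0_integralZl; do ?[by []|exact: measurable_normr_powR|by move=> *; rewrite lee_fin powR_ge0].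
  have i0 : (0 <= \int[lebesgue]_x (`|f x| `^ r)%:E)%E.
    by apply: integral_ge0 => x _; rewrite lee_fin powR_ge0.
  rewrite poweRM// ?lee_fin ?powR_ge0//.
  by rewrite poweR_EFin -powRrM mulfV ?gt_eqF// powRr1.
- rewrite !Ls_norm_pinfty -ess_supZl//; last exact: lebesgue_setT_gt0.
  by apply/eq_ess_sup/nearW => t /=; rewrite normrM EFinM.
Qed.

Lemma Ls_norm_affine (R : realType) (s : \bar R) (h c : R) (f : R -> R) :
  (1 <= s)%E -> 0 < h -> measurable_fun setT f ->
  Ls_norm s (fun t => f (h * t + c)) = ((h `^ (- fine s^-1))%:E * Ls_norm s f)%E.
Proof.
move=> s1 h0 mf; case: s s1 => [r|_|//].
- rewrite lee_fin => r1; have r0 : 0 < r by exact: lt_le_trans r1.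
  rewrite !Ls_norm_EFin inver gt_eqF//= [in RHS](@ge0_integral_affine _ h c)//;
    do ?[exact: measurable_normr_powR|by move=> *; rewrite lee_fin powR_ge0].
  have i0 : (0 <= \int[lebesgue]_x (`|f (h * x + c)| `^ r)%:E)%E.
    by apply: integral_ge0 => x _; rewrite lee_fin powR_ge0.
  rewrite preimage_setT poweRM// ?lee_fin ?(ltW h0)//.
  rewrite poweR_EFin muleA -EFinM -powRD; last by rewrite (gt_eqF h0) implybT.
  by rewrite addNr powRr0 mul1e.
(* For the essential supremum one inequality is enough, applied to the substitution and to its
   inverse. *)
- have hle (h' c' : R) (g : R -> R) : 0 < h' ->
      (Ls_norm +oo (fun t => g (h' * t + c')%R) <= Ls_norm +oo g)%E.
    move=> h'0; apply/Ls_norm_pinfty_le.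
    apply: (@ae_affine _ h' c' [set x | (`|g x|%:E <= Ls_norm +oo g)%E]) => //.
    exact/Ls_norm_pinfty_le.
  rewrite invey /= oppr0 powRr0 mul1e.
  apply/eqP; rewrite eq_le hle//=.
  have := @hle h^-1 (- (c / h)) (fun t => f (h * t + c)).
  rewrite invr_gt0 => /(_ h0); rewrite (_ : (fun t => _) = f)//.
  by apply/funext => t; congr f; field; rewrite gt_eqF.
Qed.

(** * The singular integral *)

Lemma is_derive_continuous (R : realType) (f : R -> R) (x df : R) :
  is_derive x 1 f df -> {for x, continuous f}.
Proof.
by case=> fx _; apply/differentiable_continuous/derivable1_diffP.
Qed.

Lemma powR_continuous (R : realType) (r x : R) : 0 < x ->
  {for x, continuous (fun t : R => t `^ r)}.
Proof. by move=> x0; exact: is_derive_continuous (is_derive1_powR r x0). Qed.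

Lemma powR1B (R : realType) (k x : R) : 0 < x -> x `^ (1 - k) = x / x `^ k.
Proof. by move=> x0; rewrite powRB ?(gt_eqF x0) ?implybT// powRr1// ltW. Qed.

Lemma powRN_1B (R : realType) (k x : R) : 0 < x -> x `^ (- k) = x `^ (1 - k) / x.
Proof.
by move=> x0; rewrite powRN powR1B//; field; rewrite !gt_eqF ?powR_gt0.
Qed.

Lemma measurable_powRr (R : realType) (r : R) (D : set R) :
  measurable_fun D (fun t : R => t `^ r).
Proof. by apply: measurable_funTS; exact: measurable_powR. Qed.

Lemma FTC_segment (R : realType) (F f : R -> R) (a b : R) : a <= b ->
  (forall x, a <= x -> x <= b -> is_derive x 1 F (f x)) ->
  (forall x, a <= x -> x <= b -> {for x, continuous f}) ->
  (@lebesgue R).-integrable `[a, b] (EFin \o f) /\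
  \int[lebesgue]_(t in `[a, b]) f t = F b - F a.
Proof.
move=> ab dF cf.
have wcf : {within `[a, b], continuous f}.
  apply: continuous_in_subspaceT => x; rewrite inE/= in_itv/= => /andP[ax xb].
  exact: cf.
have cF x : a <= x -> x <= b -> {for x, continuous F}.
  by move=> ax xb; exact: is_derive_continuous (dF x ax xb).
split; first by apply: continuous_compact_integrable => //; exact: segment_compact.
move: ab; rewrite le_eqVlt => /predU1P[<-|ab].
  by rewrite set_itv1 Rintegral_set1 subrr.
rewrite /Rintegral (@continuous_FTC2 _ f F)//.
- split.
  + move=> x; rewrite in_itv/= => /andP[/ltW ax /ltW xb].
    by have [] := dF x ax xb.
  + by apply: cvg_at_right_filter; apply: cF => //; exact: ltW.
  + by apply: cvg_at_left_filter; apply: cF => //; exact: ltW.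
- move=> x; rewrite in_itv/= => /andP[/ltW ax /ltW xb].
  by rewrite derive1E; have [_ ->] := dF x ax xb.
Qed.

Lemma is_derive_powR_div (R : realType) (r x : R) : r != 0 -> 0 < x ->
  is_derive x 1 (fun t : R => t `^ r / r) (x `^ (r - 1)).
Proof.
move=> r0 x0.
rewrite (_ : (fun t : R => _) = r^-1 \*: (fun t : R => t `^ r)); last first.
  by apply/funext => t /=; rewrite mulrC.
apply: is_derive_eq.
  by apply: is_deriveZ; exact: is_derive1_powR.
by rewrite /GRing.scale /= mulrA mulVf// mul1r.
Qed.

Lemma powRN_cvgy (R : realType) (k : R) : 0 < k ->
  t `^ (- k) @[t --> +oo] --> (0 : R).
Proof.
move=> k0; apply/cvgrPdist_lt => e e0; near=> t.
have t0 : 0 < t by near: t; exact: nbhs_pinfty_gt.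
rewrite sub0r normrN ger0_norm ?powR_ge0// powRN.
rewrite -[ltRHS]invrK ltf_pV2 ?posrE ?powR_gt0 ?invr_gt0//.
rewrite -[ltLHS]powRr1 ?invr_ge0 ?(ltW e0)// -(mulVf (lt0r_neq0 k0)) powRrM.
rewrite gt0_ltr_powR// ?nnegrE ?powR_ge0 ?(ltW t0)//.
Unshelve. all: by end_near. Qed.

Lemma powR_head_integral (R : realType) (k a : R) : k < 1 -> 0 < a ->
  (@lebesgue R).-integrable `]0, a] (EFin \o (fun t => t `^ (- k))) /\
  \int[lebesgue]_(t in `]0, a]) (t `^ (- k)) = a `^ (1 - k) / (1 - k).
Proof.
move=> k1 a0.
have seg e : 0 < e -> e <= a ->
    (\int[lebesgue]_(t in `[e, a]) (t `^ (- k))%:E =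
    ((a `^ (1 - k) - e `^ (1 - k)) / (1 - k))%:E)%E.
  move=> e0 ea.
  have [|x ex _|i1 i2] := @FTC_segment _ (fun t => t `^ (1 - k) / (1 - k))
    (fun t => t `^ (- k)) _ _ ea.
  - move=> x ex _; have -> : x `^ (- k) = x `^ (1 - k - 1) by congr (_ `^ _); ring.
    apply: is_derive_powR_div; last exact: lt_le_trans ex.
    by rewrite gt_eqF// subr_gt0.
  - by apply: powR_continuous; exact: lt_le_trans ex.
  by rewrite -[LHS]fineK ?integrable_fin_num// -/(Rintegral _ _ _) i2 -mulrBl.
have E : (\int[lebesgue]_(t in `]0%R, a]) (t `^ (- k))%:E = (a `^ (1 - k) / (1 - k))%:E)%E.
  (* Monotone convergence along segments that stay away from the singularity. *)
  pose F n : set R := `[a / n.+1%:R, a]%classic.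
  have an n : 0 < a / n.+1%:R /\ a / n.+1%:R <= a.
    by rewrite divr_gt0// ler_pdivrMr// ler_peMr ?(ltW a0)// ler1n.
  have FE : \bigcup_n F n = `]0, a]%classic.
    apply/seteqP; split => [x [n _]|x]; rewrite /F /= !in_itv/=.
      by move=> /andP[ax ->]; rewrite (lt_le_trans _ ax)// (an n).1.
    move=> /andP[x0 xa]; exists (Num.bound (a / x)) => //=; rewrite in_itv/= xa andbT.
    rewrite ler_pdivrMr// mulrC -ler_pdivrMr//.
    have : a / x < (Num.bound (a / x))%:R by apply: archi_boundP; rewrite divr_ge0// ltW.
    by move=> /ltW/le_trans; apply; rewrite ler_nat.
  have cv1 : (\int[lebesgue]_(t in F n) (t `^ (- k))%:E)%E @[n --> \oo] -->
      (\int[lebesgue]_(t in `]0%R, a]) (t `^ (- k))%:E)%E.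
    rewrite -FE; apply: ge0_nondecreasing_set_cvg_integral.
    - move=> m n mn; apply/subsetPset => x; rewrite /F /= !in_itv/= => /andP[h ->].
      rewrite andbT (le_trans _ h)// ler_pM2l// lef_pV2 ?posrE// ler_nat.
      by rewrite ltnS.
    - by move=> n; exact: measurable_itv.
    - by move=> n; apply/measurable_EFinP; exact: measurable_powRr.
    - by move=> n x _; rewrite lee_fin powR_ge0.
  have cvR : ((a `^ (1 - k) - (a / n.+1%:R) `^ (1 - k)) / (1 - k)) @[n --> \oo] -->
      a `^ (1 - k) / (1 - k).
    have -> : a `^ (1 - k) / (1 - k) = (a `^ (1 - k) - 0) / (1 - k) by rewrite subr0.
    apply: cvgMr_tmp; apply: cvgB; first exact: cvg_cst.
    have k10 : 0 < 1 - k by rewrite subr_gt0.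
    have /cvg_at_rightP := powR_cvg0 k10; apply; split; first by move=> n; exact: (an n).1.
    by rewrite -[X in _ --> X](mulr0 a); apply: cvgMl_tmp; exact: cvg_harmonic.
  have cv2 : (\int[lebesgue]_(t in F n) (t `^ (- k))%:E)%E @[n --> \oo] -->
      (a `^ (1 - k) / (1 - k))%:E.
    under eq_cvg do rewrite seg ?(an _).1 ?(an _).2//.
    apply: cvg_EFin; first exact: nearW.
    exact: cvR.
  exact: (cvg_unique _ cv1 cv2).
split; last by rewrite /Rintegral E.
apply/integrableP; split.
  by apply/measurable_EFinP; exact: measurable_powRr.
under eq_integral do rewrite /= ger0_norm ?powR_ge0//.
by rewrite E ltry.
Qed.

Lemma powR_tail_integral (R : realType) (k a : R) : 0 < k -> 0 < a ->
  (@lebesgue R).-integrable `]a, +oo[ (EFin \o (fun t => t `^ (- (1 + k)))) /\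
  \int[lebesgue]_(t in `]a, +oo[) (t `^ (- (1 + k))) = a `^ (- k) / k.
Proof.
move=> k0 a0.
have E : (\int[lebesgue]_(t in `]a, +oo[) (t `^ (- (1 + k)))%:E = (a `^ (- k) / k)%:E)%E.
  rewrite integral_itv_obnd_cbnd; last first.
    by apply/measurable_EFinP; exact: measurable_powRr.
  have dF x : a <= x -> is_derive x 1 (fun t : R => t `^ (- k) / (- k)) (x `^ (- (1 + k))).
    move=> ax; have -> : - (1 + k) = - k - 1 by ring.
    by apply: is_derive_powR_div; [rewrite oppr_eq0 gt_eqF|exact: lt_le_trans ax].
  rewrite (@ge0_continuous_FTC2y _ _ (fun t : R => t `^ (- k) / (- k)) _ 0).
  - by rewrite -EFinB sub0r -mulrN -invrN opprK.
  - by move=> x _; exact: powR_ge0.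
  - apply: continuous_in_subspaceT => x; rewrite inE/= in_itv/= andbT => ax.
    by apply: powR_continuous; exact: lt_le_trans ax.
  - by rewrite -[X in _ --> X](mul0r (- k)^-1); apply: cvgMr_tmp; exact: powRN_cvgy.
  - by move=> x /ltW ax; have [] := dF x ax.
  - apply: cvg_at_right_filter; exact: is_derive_continuous (dF a (lexx a)).
  - move=> x; rewrite in_itv/= andbT => /ltW ax.
    by rewrite derive1E; have [_ ->] := dF x ax.
split; last by rewrite /Rintegral E.
apply/integrableP; split.
  by apply/measurable_EFinP; exact: measurable_powRr.
under eq_integral do rewrite /= ger0_norm ?powR_ge0//.
by rewrite E ltry.
Qed.

Lemma integrableMl_EFin (R : realType) (D : set R) (c : R) (f : R -> R) :
  measurable D -> (@lebesgue R).-integrable D (EFin \o f) ->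
  (@lebesgue R).-integrable D (EFin \o (fun t => c * f t)).
Proof.
move=> mD if_; rewrite (_ : EFin \o _ = (fun t => c%:E * (EFin \o f) t)%E)//.
exact: integrableZl.
Qed.

Lemma Rintegral_itv_split (R : realType) (a x y : itv_bound R) (f : R -> R) :
  (a <= x)%O -> (x <= y)%O ->
  (@lebesgue R).-integrable [set` Interval a x] (EFin \o f) ->
  (@lebesgue R).-integrable [set` Interval x y] (EFin \o f) ->
  (@lebesgue R).-integrable [set` Interval a y] (EFin \o f) /\
  \int[lebesgue]_(t in [set` Interval a y]) f t =
  \int[lebesgue]_(t in [set` Interval a x]) f t +
  \int[lebesgue]_(t in [set` Interval x y]) f t.
Proof.
move=> ax xy if1 if2.
have dis : [disjoint [set` Interval a x] & [set` Interval x y]].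
  apply/disj_setPS => t [] /=; rewrite !itv_boundlr => /andP[_ tx] /andP[xt _].
  have := le_trans tx xt; by rewrite bnd_simp ltxx.
have i12 : (@lebesgue R).-integrable [set` Interval a y] (EFin \o f).
  have /integrableP[m1 l1] := if1; have /integrableP[m2 l2] := if2.
  rewrite (itv_bndbnd_setU ax xy).
  have m12 : measurable_fun ([set` Interval a x] `|` [set` Interval x y]) (EFin \o f).
    by apply/measurable_funU.
  apply/integrableP; split => //.
  rewrite ge0_integral_setU//; last exact: measurableT_comp.
  exact: lte_add_pinfty.
split => //; rewrite (itv_bndbnd_setU ax xy) Rintegral_setU//.
by rewrite -(itv_bndbnd_setU ax xy).
Qed.

Lemma normr_Rintegral_le (R : realType) (D : set R) (f : R -> R) (B : R) :
  measurable D -> measurable_fun setT f ->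
  (\int[lebesgue]_(t in D) `|f t|%:E <= B%:E)%E ->
  `|\int[lebesgue]_(t in D) f t| <= B.
Proof.
move=> mD mf fB.
have : (`|\int[lebesgue]_(t in D) (f t)%:E| <= B%:E)%E.
  apply: le_trans fB; apply: le_abse_integral => //.
  by apply/measurable_EFinP; exact: measurable_funTS.
by rewrite /Rintegral; case: integral => [z||]; rewrite ?lee_fin.
Qed.

Lemma Rintegral_le_dominated (R : realType) (D : set R) (f g : R -> R) :
  measurable D -> measurable_fun D f ->
  (@lebesgue R).-integrable D (EFin \o g) ->
  (forall x, D x -> `|f x| <= g x) ->
  (@lebesgue R).-integrable D (EFin \o f) /\
  `|\int[lebesgue]_(t in D) f t| <= \int[lebesgue]_(t in D) g t.
Proof.
move=> mD mf ig fg.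
have if_ : (@lebesgue R).-integrable D (EFin \o f).
  apply: le_integrable ig => //; first exact/measurable_EFinP.
  by move=> x Dx; rewrite /= lee_fin (le_trans (fg x Dx))// ler_norm.
split => //.
have h := @le_normr_Rintegral _ _ _ (@lebesgue R) D f mD if_.
apply: (le_trans h).
have := @le_Rintegral _ _ _ lebesgue D (fun t => `|f t|) g mD.
by apply => //; exact: integrable_norm.
Qed.

(** The integral is split at [a]: against the kernel the linear bound is integrable at 0 because
    [k < 1], the constant bound at infinity because [0 < k]. The cut [a] is left free and chosen at
    each use. *)
Lemma singular_integral_bound (R : realType) (k L M a : R) (D : R -> R) :
  0 < k -> k < 1 -> 0 < a -> measurable_fun (`]0%R, +oo[%classic : set R) D ->
  (forall t, 0 < t -> `|D t| <= L * t) -> (forall t, 0 < t -> `|D t| <= M) ->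
  (@lebesgue R).-integrable `]0, +oo[ (EFin \o (fun t => D t / t `^ (1 + k))) /\
  `|\int[lebesgue]_(t in `]0, +oo[) (D t / t `^ (1 + k))| <=
     L * (a `^ (1 - k) / (1 - k)) + M * (a `^ (- k) / k).
Proof.
move=> k0 k1 a0 mD DL DM.
have [ih hE] := powR_head_integral k1 a0.
have [it tE] := powR_tail_integral k0 a0.
have mf (S : set R) : measurable S -> S `<=` `]0, +oo[ ->
    measurable_fun S (fun t => D t / t `^ (1 + k)).
  move=> mS S0; apply: measurable_funM; first exact: measurable_funS mD.
  under eq_fun do rewrite -powRN; exact: measurable_powRr.
have [||x|i1 l1] := @Rintegral_le_dominated _ `]0, a]%classic
  (fun t => D t / t `^ (1 + k)) (fun t => L * t `^ (- k)) (measurable_itv _).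
- by apply: mf => // t /=; rewrite !in_itv/= => /andP[-> _].
- exact: integrableMl_EFin.
- rewrite /= in_itv/= => /andP[x0 xa].
  rewrite normrM [X in _ * X]ger0_norm ?invr_ge0 ?powR_ge0// ler_pdivrMr ?powR_gt0//.
  rewrite -mulrA -powRD ?(gt_eqF x0) ?implybT//.
  by rewrite (_ : - k + (1 + k) = 1) ?powRr1 ?(ltW x0)//; [exact: DL|ring].
have [||x|i2 l2] := @Rintegral_le_dominated _ `]a, +oo[%classic
  (fun t => D t / t `^ (1 + k)) (fun t => M * t `^ (- (1 + k))) (measurable_itv _).
- by apply: mf => // t /=; rewrite !in_itv/= !andbT; exact: lt_trans.
- exact: integrableMl_EFin.
- rewrite /= in_itv/= andbT => ax; have x0 := lt_trans a0 ax.
  rewrite normrM [X in _ * X]ger0_norm ?invr_ge0 ?powR_ge0// powRN ler_wpM2r ?invr_ge0 ?powR_ge0//.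
  exact: DM.
have [||i12 E] := Rintegral_itv_split _ _ i1 i2.
- by rewrite bnd_simp ltW.
- by [].
split => //; rewrite E; apply: le_trans (ler_normD _ _) _.
rewrite -hE -tE -RintegralZl// -[X in _ <= _ + X]RintegralZl//.
exact: lerD.
Qed.

(* [N] makes Fubini's theorem applicable although [A] may be singular at [a]. *)
Lemma fubini_triangle (R : realType) (a b : R) (A B N : R -> R) :
  measurable_fun `]a, b] A ->
  (@lebesgue R).-integrable `]a, b] (EFin \o B) ->
  (forall u, a < u -> u <= b ->
     (@lebesgue R).-integrable `[u, b] (EFin \o A)) ->
  (forall t, a < t -> t <= b ->
     (\int[lebesgue]_(u in `]a, t]) `|B u|%:E <= (N t)%:E)%E) ->
  (@lebesgue R).-integrable `]a, b] (EFin \o (fun t => A t * N t)) ->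
  \int[lebesgue]_(t in `]a, b])
     (A t * \int[lebesgue]_(u in `]a, t]) B u) =
  \int[lebesgue]_(u in `]a, b])
     (B u * \int[lebesgue]_(t in `[u, b]) A t).
Proof.
move=> mA iB iA BN /integrableP[mAN AN]; pose D : set R := `]a, b]%classic.
have mD : measurable D by exact: measurable_itv.
have mB : measurable_fun D B.
  by apply/measurable_EFinP; exact: measurable_int iB.
pose A' := A \_ D; pose B' := B \_ D.
have mA' : measurable_fun setT A' by exact/(measurable_restrictT _ mD).
have mB' : measurable_fun setT B' by exact/(measurable_restrictT _ mD).
(* The triangle is put into the integrand, extended by 0 to the plane, where Fubini's theorem
   applies. *)
pose f (z : measurableTypeR R * measurableTypeR R) : R :=
  if z.2 <= z.1 then A' z.1 * B' z.2 else 0.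
have mf : measurable_fun setT f.
  apply: measurable_fun_ifT => //.
    exact: measurable_fun_ler.
  apply: measurable_funM.
    exact: (measurableT_comp mA').
  exact: (measurableT_comp mB').
have mEf : measurable_fun setT (EFin \o f) by exact/measurable_EFinP.
have subat t : D t -> `]a, t] `<=` D.
  rewrite /D /= in_itv/= => /andP[at' tb] u /=; rewrite !in_itv/= => /andP[-> ut].
  exact: le_trans tb.
have subub u : D u -> `[u, b] `<=` D.
  rewrite /D /= in_itv/= => /andP[au ub] t /=; rewrite !in_itv/= => /andP[ut ->].
  by rewrite (lt_le_trans au).
have ft t u : D t -> f (t, u) = ((fun u => A t * B u) \_ `]a, t]) u.
  move=> Dt; rewrite /f /A' /B' !patchE /= (mem_set Dt).
  have [aut|naut] := pselect (`]a, t]%classic u).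
    rewrite (mem_set aut) (mem_set (subat _ Dt _ aut)).
    by move: aut => /=; rewrite in_itv/= => /andP[_ ->].
  rewrite (memNset naut); case: ifPn => // ut; case: ifPn => [|_]; last by rewrite mulr0.
  rewrite inE /D/= in_itv/= => /andP[au ub].
  by exfalso; apply: naut; rewrite /= in_itv/= au.
have ft0 t u : ~ D t -> f (t, u) = 0.
  move=> Dt; rewrite /f /A' patchE/= (memNset Dt) mul0r.
  by rewrite if_same.
have fu u t : D u -> f (t, u) = ((fun t => B u * A t) \_ `[u, b]) t.
  move=> Du; rewrite /f /A' /B' !patchE /= (mem_set Du).
  have [aut|naut] := pselect (`[u, b]%classic t).
    rewrite (mem_set aut) (mem_set (subub _ Du _ aut)) mulrC.
    by move: aut => /=; rewrite in_itv/= => /andP[->].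
  rewrite (memNset naut); case: ifPn => // ut; case: ifPn => [|_]; last by rewrite mul0r.
  rewrite inE /D/= in_itv/= => /andP[au ub].
  by exfalso; apply: naut; rewrite /= in_itv/= ut.
have fu0 u t : ~ D u -> f (t, u) = 0.
  move=> Du; rewrite /f /B' !patchE/= (memNset Du) mulr0.
  by rewrite if_same.
have iBt t : D t -> (@lebesgue R).-integrable `]a, t] (EFin \o B).
  by move=> Dt; apply: integrableS iB => //; exact: subat.
have iAu u : D u -> (@lebesgue R).-integrable `[u, b] (EFin \o A).
  by rewrite /D/= in_itv/= => /andP[]; exact: iA.
have ff : (lebesgue \x lebesgue)%E.-integrable setT (EFin \o f).
  apply/integrable12ltyP => //; apply: le_lt_trans AN.
  rewrite [leRHS]integral_mkcond; apply: ge0_le_integral => //.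
  - by move=> t _; exact: integral_ge0.
  - apply: (@measurable_fun_fubini_tonelli_F _ _ _ _ _ lebesgue (abse \o (EFin \o f))) => //.
    exact: measurableT_comp.
  - by move=> z; exact: abse_ge0.
  - by apply: (iffLR (measurable_restrictT _ mD)); exact: measurableT_comp.
  move=> t _; rewrite patchE.
  have [Dt|Dt] := pselect (D t); last first.
    rewrite memNset// (_ : (fun u => _) = cst 0%E) ?integral0_eq//.
    by apply/funext => u /=; rewrite ft0//= normr0.
  rewrite mem_set//.
  apply: (@le_trans _ _ (`|A t|%:E * \int[lebesgue]_(u in `]a, t]) `|B u|%:E)%E).
    rewrite -ge0_integralZl//; last first.
      apply: measurableT_comp => //; apply: measurableT_comp => //.
      by apply: measurable_funS mB => //; exact: subat.
    rewrite [leRHS]integral_mkcond le_eqVlt; apply/orP; left; apply/eqP.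
    apply: eq_integral => u _.
    rewrite /= ft// !patchE; case: ifPn => _; last by rewrite normr0.
    by rewrite normrM EFinM.
  have [at' tb] : a < t /\ t <= b by move: Dt; rewrite /D/= in_itv/= => /andP[].
  apply: (@le_trans _ _ (`|A t|%:E * (N t)%:E)%E).
    by apply: lee_wpmul2l => //; exact: BN.
  by rewrite -EFinM lee_fin/= normrM ler_wpM2l// ler_norm.
have := Fubini ff.
rewrite /Rintegral => E; congr fine.
rewrite [LHS]integral_mkcond [RHS]integral_mkcond.
have slice (c : R) (S : set R) (v h : R -> R) : measurable S ->
    (@lebesgue R).-integrable S (EFin \o v) ->
    (forall u, h u = ((fun u => c * v u) \_ S) u) ->
    (\int[lebesgue]_u (h u)%:E =
     (c * \int[lebesgue]_(u in S) v u)%:E)%E.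
  move=> mS iv hE; rewrite -RintegralZl// /Rintegral fineK; last first.
    by apply: integrable_fin_num => //; exact: integrableMl_EFin.
  rewrite [RHS]integral_mkcond; apply: eq_integral => u _.
  by rewrite hE !patchE; case: ifP.
have slice0 (h : R -> R) : (forall u, h u = 0) ->
    (\int[lebesgue]_u (h u)%:E = 0)%E.
  by move=> h0; apply: integral0_eq => u _; rewrite h0.
transitivity (\int[lebesgue]_x \int[lebesgue]_y (EFin \o f) (x, y))%E.
  apply: eq_integral => t _; rewrite patchE; case: ifPn.
    rewrite inE => Dt; apply/esym/slice => [//||u]; [exact: iBt|exact: ft].
  by rewrite notin_setE => Dt; apply/esym/slice0 => u; exact: ft0.
rewrite E; apply: eq_integral => u _; rewrite patchE; case: ifPn.
  by rewrite inE => Du; apply: slice => [//||t]; [exact: iAu|exact: fu].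
by rewrite notin_setE => Du; apply: slice0 => t; exact: fu0.
Qed.

Definition weyl (R : realType) (k : R) (f : R -> R) (x : R) : R :=
  \int[lebesgue]_(t in `]0, +oo[) ((f x - f (x + t)) / t `^ (1 + k)).

(** The conditions at one point that make the singular integral converge: the linear bound serves
    small [t], the constant bound large [t]. [L] may depend on [x], since the derivative of a
    function of the class is only known to be bounded on bounded intervals. *)
Definition lip_bounded (R : realType) (L M : R) (f : R -> R) (x : R) : Prop :=
  forall t, 0 < t -> `|f x - f (x + t)| <= L * t /\ `|f x - f (x + t)| <= M.

Lemma measurable_increment (R : realType) (f : R -> R) (x : R) (D : set R) :
  measurable_fun setT f -> measurable_fun D (fun t => f x - f (x + t)).
Proof.
move=> mf; apply: measurable_funTS; apply: measurable_funB => //.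
by apply: (measurableT_comp mf); exact: measurable_funD.
Qed.

Lemma weyl_integrable (R : realType) (k L M : R) (f : R -> R) (x : R) :
  0 < k -> k < 1 -> measurable_fun setT f -> lip_bounded L M f x ->
  (@lebesgue R).-integrable `]0, +oo[
    (EFin \o (fun t => (f x - f (x + t)) / t `^ (1 + k))).
Proof.
move=> k0 k1 mf fx.
have [] // := @singular_integral_bound R k L M 1 (fun t => f x - f (x + t)) k0 k1 ltr01.
- exact: measurable_increment.
- by move=> t /fx[].
- by move=> t /fx[].
Qed.

Lemma weyl_bound (R : realType) (k L M a : R) (f : R -> R) (x : R) :
  0 < k -> k < 1 -> 0 < a -> measurable_fun setT f -> lip_bounded L M f x ->
  `|weyl k f x| <= L * (a `^ (1 - k) / (1 - k)) + M * (a `^ (- k) / k).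
Proof.
move=> k0 k1 a0 mf fx.
have [] // := @singular_integral_bound R k L M a (fun t => f x - f (x + t)) k0 k1 a0.
- exact: measurable_increment.
- by move=> t /fx[].
- by move=> t /fx[].
Qed.

(** Homogeneity of the kernel. The factor [h^k] serves twice: for the terms of the difference of
    order [n], and for the scaling that produces the multiplicative inequality. *)
Lemma singular_integral_dilation (R : realType) (k h : R) (g : R -> R) : 0 < h ->
  (@lebesgue R).-integrable `]0, +oo[ (EFin \o (fun t => g t / t `^ (1 + k))) ->
  (@lebesgue R).-integrable `]0, +oo[ (EFin \o (fun t => g (h * t) / t `^ (1 + k))) /\
  \int[lebesgue]_(t in `]0, +oo[) (g (h * t) / t `^ (1 + k)) =
  h `^ k * \int[lebesgue]_(t in `]0, +oo[) (g t / t `^ (1 + k)).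
Proof.
move=> h0 ig.
have mg : measurable_fun (`]0%R, +oo[%classic : set R) (fun t => g t / t `^ (1 + k)).
  by apply/measurable_EFinP; exact: measurable_int ig.
have D0 : (fun t : R => h * t + 0) @^-1` `]0, +oo[%classic = `]0, +oo[%classic.
  by apply/seteqP; split => t /=; rewrite !in_itv/= !andbT addr0 pmulr_rgt0.
have hk0 : h `^ (1 + k) != 0 by rewrite gt_eqF// powR_gt0.
have hE : h `^ k * h = h `^ (1 + k).
  by rewrite powRD ?(gt_eqF h0) ?implybT// powRr1 ?(ltW h0)// mulrC.
have E t : t \in `]0, +oo[%classic -> g (h * t) / t `^ (1 + k) =
    h `^ (1 + k) * (g (h * t + 0) / (h * t + 0) `^ (1 + k)).
  rewrite inE/= in_itv/= andbT => t0; rewrite addr0 powRM ?(ltW h0) ?(ltW t0)//.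
  by field; rewrite hk0 gt_eqF// powR_gt0.
have ih := @integrable_affine _ h 0 _ _ h0 (measurable_itv _) ig.
rewrite D0 in ih.
split.
  apply: eq_integrable (integrableMl_EFin (h `^ (1 + k)) (measurable_itv _) ih) => //.
  by move=> t tD; rewrite /= E.
rewrite (@Rintegral_affine _ h 0 `]0, +oo[%classic _ h0 (measurable_itv _) mg) D0.
by rewrite mulrA hE -RintegralZl//; exact: eq_Rintegral.
Qed.

Lemma weyl_scale (R : realType) (k a : R) (f : R -> R) (x L M : R) :
  0 < k -> k < 1 -> measurable_fun setT f -> lip_bounded L M f x ->
  weyl k (fun t => a * f t) x = a * weyl k f x.
Proof.
move=> k0 k1 mf fx; rewrite -RintegralZl//; last exact: weyl_integrable fx.
by apply: eq_Rintegral => t _; rewrite -mulrBr mulrA.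
Qed.

Lemma weylB (R : realType) (k : R) (f g : R -> R) (x L M L' M' : R) :
  0 < k -> k < 1 -> measurable_fun setT f -> lip_bounded L M f x ->
  measurable_fun setT g -> lip_bounded L' M' g x ->
  weyl k (fun t => f t - g t) x = weyl k f x - weyl k g x.
Proof.
move=> k0 k1 mf fx mg gx; rewrite -RintegralB//; last 2 first.
- exact: weyl_integrable fx.
- exact: weyl_integrable gx.
by apply: eq_Rintegral => t _; rewrite -mulrBl; congr (_ / _); ring.
Qed.

Lemma Rintegral_sum (R : realType) (D : set R) (I : Type) (r : seq I)
    (F : I -> R -> R) : measurable D ->
  (forall i, (@lebesgue R).-integrable D (EFin \o F i)) ->
  (@lebesgue R).-integrable D (EFin \o (fun t => \sum_(i <- r) F i t)) /\
  \int[lebesgue]_(t in D) (\sum_(i <- r) F i t) =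
  \sum_(i <- r) \int[lebesgue]_(t in D) F i t.
Proof.
move=> mD iF; elim: r => [|i r [ih1 ih2]].
  under [X in EFin \o X]eq_fun do rewrite big_nil.
  under eq_Rintegral do rewrite big_nil.
  by rewrite big_nil Rintegral_cst// mul0r; split => //; exact: integrable0.
under [X in EFin \o X]eq_fun do rewrite big_cons.
under eq_Rintegral do rewrite big_cons.
rewrite big_cons RintegralD// ih2; split => //.
rewrite (_ : EFin \o _ = (EFin \o F i) \+ (EFin \o (fun t => (\sum_(j <- r) F j t)%R)))%E//.
exact: integrableD.
Qed.

Lemma weyl_dilation (R : realType) (k h L M : R) (f : R -> R) (x : R) :
  0 < k -> k < 1 -> 0 < h -> measurable_fun setT f -> lip_bounded L M f x ->
  weyl k (fun t => f (x + h * t)) 0 = h `^ k * weyl k f x.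
Proof.
move=> k0 k1 h0 mf fx.
rewrite /weyl; have [_ <-] := @singular_integral_dilation R k h
  (fun t => f x - f (x + t)) h0 (weyl_integrable k0 k1 mf fx).
by apply: eq_Rintegral => t _; rewrite mulr0 addr0 add0r.
Qed.

Lemma sum_sign_binomial (R : realType) (n : nat) : (0 < n)%N ->
  \sum_(m < n.+1) (-1) ^+ m * 'C(n, m)%:R = 0 :> R.
Proof.
move=> n0; have := exprDn (1 : R) (-1) n; rewrite subrr expr0n gtn_eqF//= => /esym.
by under eq_bigr do rewrite expr1n mul1r -mulr_natr.
Qed.

(** The alternating binomial coefficients sum to 0, so [f x] can be subtracted in every term of the
    difference; the term of index [m] then gives [m^k] times [weyl]. The constant [c] enters the
    inequality and the sharp constant alike through the factor [|c|], which is why its existence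
    suffices. *)
Lemma marchaud_weyl (R : realType) (k : R) (n : nat) : 0 < k -> k < 1 -> k < n%:R ->
  exists c : R, forall (f : R -> R) (x L M : R),
    measurable_fun setT f -> lip_bounded L M f x ->
    marchaud k n f x = c * weyl k f x.
Proof.
move=> k0 k1 kn; have n0 : (0 < n)%N by rewrite -(ltr_nat R); exact: lt_trans kn.
pose a (m : 'I_n.+1) : R := (-1) ^+ m * 'C(n, m)%:R.
exists ((varkappa k n)^-1 * (- \sum_(m < n.+1) a m * m%:R `^ k)) => f x L M mf fx.
rewrite /marchaud -mulrA; congr (_ * _).
pose F (m : 'I_n.+1) t := - a m * ((f x - f (x + m%:R * t)) / t `^ (1 + k)).
have iw := weyl_integrable k0 k1 mf fx.
have FE m : (@lebesgue R).-integrable `]0, +oo[ (EFin \o F m) /\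
    \int[lebesgue]_(t in `]0, +oo[) F m t = - a m * m%:R `^ k * weyl k f x.
  (* The dilation lemma asks for a positive factor; at [m = 0] the increment vanishes, and so does
     the power [k] of 0. *)
  have [m0|m0] := posnP m.
    rewrite /F m0; under [X in EFin \o X]eq_fun do rewrite mul0r addr0 subrr mul0r mulr0.
    under eq_Rintegral do rewrite mul0r addr0 subrr mul0r mulr0.
    rewrite Rintegral_cst// powR0 ?gt_eqF// mulr0 !mul0r; split => //.
    exact: integrable0.
  have m0' : 0 < m%:R :> R by rewrite ltr0n.
  have [i1 i2] := @singular_integral_dilation R k m%:R (fun t => f x - f (x + t)) m0' iw.
  split; first exact: integrableMl_EFin.
  by rewrite RintegralZl// i2 mulrA.
have [_ S] := @Rintegral_sum R `]0, +oo[%classic _ (index_enum 'I_n.+1) F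
  (measurable_itv _) (fun m => (FE m).1).
transitivity (\int[lebesgue]_(t in `]0, +oo[) \sum_m F m t).
  apply: eq_Rintegral => t _; rewrite /F /Delta_minus.
  transitivity ((\sum_m (- a m * (f x - f (x + m%:R * t)))) / t `^ (1 + k)).
    congr (_ / _).
    transitivity (\sum_m (a m * f (x + m%:R * t) - a m * f x)).
      rewrite big_split/= sumrN -mulr_suml sum_sign_binomial// mul0r subr0.
      by apply: eq_bigr.
    by apply: eq_bigr => m _; ring.
  by rewrite mulr_suml; apply: eq_bigr => m _; rewrite mulrA.
rewrite S; under eq_bigr do rewrite (FE _).2.
by rewrite -mulr_suml -sumrN; congr (_ * _); apply: eq_bigr => m _; rewrite mulNr.
Qed.

(** * The singular integral in terms of the second derivative *)

(** [G] is any density of [g] rather than the total function given by the second derivative. The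
    notion is stable under affine substitutions and holds for double integrals of bounded functions
    without a discussion of exceptional points. *)
Definition ac_derivatives (R : realType) (f g G : R -> R) : Prop :=
  [/\ forall x : R, is_derive x 1 f (g x), continuous g, measurable_fun setT G &
      forall x y, x <= y ->
        (@lebesgue R).-integrable `]x, y] (EFin \o G) /\
        g y - g x = \int[lebesgue]_(t in `]x, y]) G t].

Lemma Rintegral_oc_cc (R : realType) (a b : R) (f : R -> R) :
  (@lebesgue R).-integrable `[a, b] (EFin \o f) ->
  (@lebesgue R).-integrable `]a, b] (EFin \o f) /\
  \int[lebesgue]_(t in `]a, b]) f t =
  \int[lebesgue]_(t in `[a, b]) f t.
Proof.
move=> fi; have fi' : (@lebesgue R).-integrable `]a, b] (EFin \o f).
  by apply: integrableS fi => //; exact: subset_itv_oc_cc.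
by split => //; exact: Rintegral_itv_obnd_cbnd.
Qed.

Lemma Rintegral_cst_oc (R : realType) (c a b : R) : a <= b ->
  \int[lebesgue]_(t in `]a, b]) c = c * (b - a).
Proof.
move=> ab; rewrite Rintegral_cst//; congr (_ * _).
have := @lebesgue_measure_itv R `]a, b]; rewrite /= lte_fin => E.
transitivity (fine (if a < b then (b%:E - a%:E)%E else 0%E)); first by congr fine.
by move: ab; rewrite le_eqVlt => /predU1P[->|->//]; rewrite ltxx subrr.
Qed.

Lemma Rintegral_oc_const (R : realType) (h : R -> R) (c a b : R) : a <= b ->
  (forall t, a < t -> t <= b -> h t = c) ->
  \int[lebesgue]_(t in `]a, b]) h t = c * (b - a).
Proof.
move=> ab hc; rewrite -Rintegral_cst_oc//.
by apply: eq_Rintegral => t; rewrite inE/= in_itv/= => /andP[]; exact: hc.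
Qed.

Lemma Rintegral_oc_eq0 (R : realType) (h : R -> R) (a b : R) :
  (forall t, a < t -> t <= b -> h t = 0) ->
  \int[lebesgue]_(t in `]a, b]) h t = 0.
Proof.
move=> h0; transitivity (\int[lebesgue]_(t in `]a, b]) (0 : R)).
  by apply: eq_Rintegral => t; rewrite inE/= in_itv/= => /andP[]; exact: h0.
by rewrite Rintegral_cst// mul0r.
Qed.

Lemma Rintegral_oc_empty (R : realType) (h : R -> R) (a b : R) : b <= a ->
  \int[lebesgue]_(t in `]a, b]) h t = 0.
Proof.
move=> ba; apply: Rintegral_oc_eq0 => t at' tb.
by have := lt_le_trans at' (le_trans tb ba); rewrite ltxx.
Qed.

Lemma integrableB_EFin (R : realType) (D : set R) (f g : R -> R) : measurable D ->
  (@lebesgue R).-integrable D (EFin \o f) ->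
  (@lebesgue R).-integrable D (EFin \o g) ->
  (@lebesgue R).-integrable D (EFin \o (fun t => f t - g t)).
Proof.
move=> mD fi gi; rewrite (_ : EFin \o _ = (EFin \o f) \- (EFin \o g))%E//.
exact: integrableB.
Qed.

Section integral_identity.
Context (R : realType) (f g G : R -> R).
Context (fgG : ac_derivatives f g G).

Lemma integral_first_derivative (x y : R) : x <= y ->
  (@lebesgue R).-integrable `]x, y] (EFin \o g) /\
  \int[lebesgue]_(t in `]x, y]) g t = f y - f x.
Proof.
move=> xy; have [df cg _ _] := fgG.
have [i1 i2] := @FTC_segment R f g x y xy (fun z _ _ => df z) (fun z _ _ => cg z).
by have [? ->] := Rintegral_oc_cc i1.
Qed.

Lemma first_derivative_bounded (x y : R) : x <= y ->
  exists K, forall t, x <= t -> t <= y -> `|g t| <= K.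
Proof.
move=> xy; have [_ cg _ _] := fgG.
have cng : {within `[x, y], continuous (fun t => `|g t|)}.
  apply: continuous_subspaceT => t.
  by apply: continuous_comp; [exact: cg|exact: norm_continuous].
have [c _ cP] := EVT_max xy cng.
by exists `|g c| => t xt ty; apply: cP; rewrite in_itv/= xt.
Qed.

Lemma continuous_antiderivative : continuous f.
Proof. by move=> x; have [df _ _ _] := fgG; exact: is_derive_continuous (df x). Qed.

Lemma measurable_antiderivative : measurable_fun setT f.
Proof. exact: continuous_measurable_fun continuous_antiderivative. Qed.

Lemma measurable_first_derivative : measurable_fun setT g.
Proof. by have [_ cg _ _] := fgG; exact: continuous_measurable_fun. Qed.

Lemma integral_second_derivative (x y : R) : x <= y ->
  (@lebesgue R).-integrable `[x, y] (EFin \o G) /\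
  \int[lebesgue]_(t in `[x, y]) G t = g y - g x.
Proof.
move=> xy; have [_ _ _ iG] := fgG; split; last first.
  by rewrite (iG _ _ xy).2 Rintegral_itv_obnd_cbnd//; exact: (iG _ _ xy).1.
have x1y : x - 1 <= y by lra.
apply: integrableS (iG _ _ x1y).1 => //.
by move=> t /=; rewrite !in_itv/= => /andP[xt ->]; rewrite andbT; lra.
Qed.

Lemma integrable_cst_oc (c a b : R) :
  (@lebesgue R).-integrable `]a, b] (EFin \o (fun _ : R => c)).
Proof.
have icc : (@lebesgue R).-integrable `[a, b] (EFin \o (fun _ : R => c)).
  apply: continuous_compact_integrable; first exact: segment_compact.
  by apply: continuous_subspaceT => x; exact: cvg_cst.
by apply: integrableS icc => //; exact: subset_itv_oc_cc.
Qed.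

Lemma integrableB_cst_oc (c a b : R) (h : R -> R) :
  (@lebesgue R).-integrable `]a, b] (EFin \o h) ->
  (@lebesgue R).-integrable `]a, b] (EFin \o (fun t => c - h t)).
Proof.
by move=> ih; apply: integrableB_EFin => //; exact: integrable_cst_oc.
Qed.

(** Integration by parts: the weight is written as the integral of [(1 + p)^-1] from [- p] to [t],
    and Fubini's theorem leaves [g 1 - g u] as inner integral. *)
Lemma second_derivative_affine (p : R) : 0 <= p ->
  (@lebesgue R).-integrable `]- p, 1] (EFin \o (fun t => G t * ((t + p) / (1 + p)))) /\
  \int[lebesgue]_(t in `]- p, 1]) (G t * ((t + p) / (1 + p))) =
  g 1 - (f 1 - f (- p)) / (1 + p).
Proof.
move=> p0; have p1 : - p <= 1 by lra.
have [df cg mG iG] := fgG.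
have cstE (t : R) : - p <= t -> \int[lebesgue]_(u in `]- p, t]) (1 + p)^-1 = (t + p) / (1 + p).
  by move=> pt; rewrite Rintegral_cst_oc// opprK mulrC.
have iGt : (@lebesgue R).-integrable `]- p, 1] (EFin \o (fun t => G t * ((t + p) / (1 + p)))).
  apply: le_integrable (iG (- p) 1 p1).1 => //.
    apply/measurable_EFinP; apply: measurable_funM; first exact: measurable_funTS.
    by apply: measurable_funM => //; exact: measurable_funD.
  move=> t /=; rewrite in_itv/= => /andP[pt t1].
  rewrite lee_fin normrM ler_piMr// ger0_norm ?divr_ge0 ?ler_pdivrMr//; lra.
split => //.
have := @fubini_triangle R (- p) 1 G (fun _ => (1 + p)^-1) (fun t => (t + p) / (1 + p)).
move=> /(_ (measurable_funTS mG) (integrable_cst_oc _ _ _)).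
rewrite (_ : \int[lebesgue]_(t in _) _ =
  \int[lebesgue]_(t in `]- p, 1]) (G t * ((t + p) / (1 + p)))); last first.
  by apply: eq_Rintegral => t; rewrite inE/= in_itv/= => /andP[/ltW pt _]; rewrite cstE.
move=> ->//.
- transitivity (\int[lebesgue]_(u in `]- p, 1]) ((1 + p)^-1 * (g 1 - g u))).
    apply: eq_Rintegral => u; rewrite inE/= in_itv/= => /andP[pu u1].
    by rewrite (integral_second_derivative u1).2.
  have [ig gE] := integral_first_derivative p1.
  rewrite RintegralZl//; last exact: integrableB_cst_oc.
  rewrite RintegralB//; last exact: integrable_cst_oc.
  by rewrite Rintegral_cst_oc// gE opprK; field; lra.
- by move=> u _ u1; exact: (integral_second_derivative u1).1.
- move=> t pt t1; have := cstE t (ltW pt); rewrite /Rintegral => <-.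
  rewrite fineK; last by apply: integrable_fin_num => //; exact: integrable_cst_oc.
  rewrite le_eqVlt; apply/orP; left; apply/eqP; apply: eq_integral => u _.
  by rewrite ger0_norm// invr_ge0; lra.
Qed.

End integral_identity.

(** The bound of [g] on [x, x + 1] handles [t <= 1]; for larger [t] the constant [2 * M] is at most
    [2 * M * t]. *)
Lemma ac_derivatives_lip_bounded (R : realType) (f g G : R -> R) (M x : R) :
  ac_derivatives f g G -> (forall t, `|f t| <= M) ->
  exists L, lip_bounded L (2 * M) f x.
Proof.
move=> fgG fM; have x1 : x <= x + 1 by lra.
have [K gK] := first_derivative_bounded fgG x1.
have M0 : 0 <= M by apply: le_trans (fM 0).
have K0 : 0 <= K by apply: le_trans (gK x _ _) => //.
have f2M s t : `|f s - f t| <= 2 * M.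
  by apply: le_trans (ler_normB _ _) _; have := fM s; have := fM t; lra.
exists (K + 2 * M) => t t0; split => //.
have [t1|t1] := leP t 1; last first.
  apply: le_trans (f2M _ _) _; rewrite mulrDl.
  have : 0 <= K * t by rewrite mulr_ge0// ltW.
  have : 2 * M * 1 <= 2 * M * t by rewrite ler_wpM2l ?mulr_ge0// ltW.
  by lra.
have xt : x <= x + t by rewrite lerDl ltW.
have [ig gE] := integral_first_derivative fgG xt.
rewrite distrC -gE.
have [||_ le] := @Rintegral_le_dominated R `]x, x + t]%classic g (fun=> K) (measurable_itv _)
  (measurable_funTS (measurable_first_derivative fgG)).
- exact: integrable_cst_oc.
- by move=> s /=; rewrite in_itv/= => /andP[/ltW xs st]; apply: gK => //; lra.
apply: le_trans le _; rewrite Rintegral_cst_oc//.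
rewrite [X in X <= _](_ : _ = K * t); last by ring.
by rewrite mulrDl lerDl !mulr_ge0// ltW.
Qed.

Section singular_identity.
Context (R : realType) (f g G : R -> R) (fgG : ac_derivatives f g G).
Context (k : R) (k0 : 0 < k) (k1 : k < 1).

Lemma integrable_powR_first_derivative :
  (@lebesgue R).-integrable `]0, 1] (EFin \o (fun u => u `^ (- k) * g u)).
Proof.
have [K gK] := first_derivative_bounded fgG (@ler01 R).
have [ih _] := powR_head_integral k1 (@ltr01 R).
have [|||] // := @Rintegral_le_dominated R `]0, 1]%classic (fun u => u `^ (- k) * g u)
  (fun u => K * u `^ (- k)) (measurable_itv _).
- apply: measurable_funM; first exact: measurable_powRr.
  exact: measurable_funTS (measurable_first_derivative fgG).
- exact: integrableMl_EFin.
move=> t /=; rewrite in_itv/= => /andP[/ltW t0 t1].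
rewrite normrM ger0_norm ?powR_ge0// mulrC ler_wpM2r ?powR_ge0//.
exact: gK.
Qed.

(** The same integration by parts for the weight [t^(1 - k)], the integral of [(1 - k) * u^(- k)],
    which is unbounded but integrable at 0. *)
Lemma second_derivative_powR :
  (@lebesgue R).-integrable `]0, 1] (EFin \o (fun t => G t * t `^ (1 - k))) /\
  \int[lebesgue]_(t in `]0, 1]) (G t * t `^ (1 - k)) =
  g 1 - (1 - k) * \int[lebesgue]_(t in `]0, 1]) (t `^ (- k) * g t).
Proof.
have [df cg mG iG] := fgG; have k10 : 1 - k != 0 by rewrite gt_eqF// subr_gt0.
have BE (t : R) : 0 < t ->
    (@lebesgue R).-integrable `]0, t] (EFin \o (fun u => (1 - k) * u `^ (- k))) /\
    \int[lebesgue]_(u in `]0, t]) ((1 - k) * u `^ (- k)) = t `^ (1 - k).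
  move=> t0; have [ih hE] := powR_head_integral k1 t0.
  by split; [exact: integrableMl_EFin|rewrite RintegralZl// hE mulrC divfK].
have iGt : (@lebesgue R).-integrable `]0, 1] (EFin \o (fun t => G t * t `^ (1 - k))).
  apply: le_integrable (iG 0 1 ler01).1 => //.
    apply/measurable_EFinP; apply: measurable_funM; first exact: measurable_funTS.
    exact: measurable_powRr.
  move=> t /=; rewrite in_itv/= => /andP[t0 t1].
  rewrite lee_fin normrM ler_piMr// ger0_norm ?powR_ge0//.
  have e1 : 1 = 1 `^ (1 - k) :> R by rewrite powR1.
  by rewrite [leRHS]e1; apply: ge0_ler_powR; rewrite ?nnegrE ?subr_ge0 ?(ltW t0) ?(ltW k1).
split => //.
have := @fubini_triangle R 0 1 G (fun u => (1 - k) * u `^ (- k)) (fun t => t `^ (1 - k)).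
move=> /(_ (measurable_funTS mG) (BE 1 ltr01).1).
rewrite (_ : \int[lebesgue]_(t in _) _ =
  \int[lebesgue]_(t in `]0, 1]) (G t * t `^ (1 - k))); last first.
  by apply: eq_Rintegral => t; rewrite inE/= in_itv/= => /andP[t0 _]; rewrite (BE t t0).2.
move=> ->//.
- transitivity (\int[lebesgue]_(u in `]0, 1])
      (g 1 * ((1 - k) * u `^ (- k)) - (1 - k) * (u `^ (- k) * g u))).
    apply: eq_Rintegral => u; rewrite inE/= in_itv/= => /andP[u0 u1].
    by rewrite (integral_second_derivative fgG u1).2; ring.
  have i2 := integrable_powR_first_derivative.
  rewrite RintegralB//; last 2 first.
  + by apply: integrableMl_EFin => //; exact: (BE 1 ltr01).1.
  + exact: integrableMl_EFin.
  rewrite RintegralZl//; last exact: (BE 1 ltr01).1.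
  by rewrite (BE 1 ltr01).2 powR1 mulr1 RintegralZl.
- by move=> u _ u1; exact: (integral_second_derivative fgG u1).1.
- move=> t t0 t1; have [i2 <-] := BE t t0; rewrite /Rintegral.
  rewrite fineK; last by apply: integrable_fin_num.
  rewrite le_eqVlt; apply/orP; left; apply/eqP; apply: eq_integral => u _.
  by rewrite ger0_norm// mulr_ge0 ?powR_ge0// subr_ge0 ltW.
Qed.

(** With [f 0 - f t] written as minus an integral of [g], Fubini's theorem replaces the kernel by
    its integral from [u] to 1, namely [(u^(- k) - 1) / k]. The kernel is not integrable at 0; the
    bound [K * t] of the inner integral compensates. *)
Lemma singular_head :
  (@lebesgue R).-integrable `]0, 1] (EFin \o (fun t => (f 0 - f t) / t `^ (1 + k))) /\
  k * \int[lebesgue]_(t in `]0, 1]) ((f 0 - f t) / t `^ (1 + k)) =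
  f 1 - f 0 - \int[lebesgue]_(t in `]0, 1]) (t `^ (- k) * g t).
Proof.
have k00 : k != 0 by rewrite gt_eqF.
have [K gK] := first_derivative_bounded fgG (@ler01 R).
have [ih _] := powR_head_integral k1 (@ltr01 R).
have AK (t : R) : 0 < t -> t `^ (- (1 + k)) * (K * t) = K * t `^ (- k).
  move=> t0; rewrite mulrCA; congr (_ * _).
  rewrite -[X in _ * X]powRr1 ?ltW// -powRD ?(gt_eqF t0) ?implybT//.
  by congr (_ `^ _); ring.
have gbound (t : R) : 0 < t -> t <= 1 -> `|f t - f 0| <= K * t.
  move=> t0 t1; have [ig <-] := integral_first_derivative fgG (ltW t0).
  have [||_ le] := @Rintegral_le_dominated R `]0, t]%classic g (fun=> K) (measurable_itv _)
    (measurable_funTS (measurable_first_derivative fgG)).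
  - exact: integrable_cst_oc.
  - move=> s /=; rewrite in_itv/= => /andP[/ltW xs st]; apply: gK => //.
    exact: le_trans t1.
  by apply: le_trans le _; rewrite Rintegral_cst_oc ?(ltW t0)// subr0.
have iKk : (@lebesgue R).-integrable `]0, 1] (EFin \o (fun t => K * t `^ (- k))).
  exact: integrableMl_EFin.
have mA (D : set R) : measurable_fun D (fun t : R => (t `^ (1 + k))^-1).
  under eq_fun do rewrite -powRN; exact: measurable_powRr.
have mf := measurable_antiderivative fgG.
have iH : (@lebesgue R).-integrable `]0, 1]
    (EFin \o (fun t => (f 0 - f t) / t `^ (1 + k))).
  have [||] // := @Rintegral_le_dominated R `]0, 1]%classic
    (fun t => (f 0 - f t) / t `^ (1 + k)) (fun t => K * t `^ (- k)) (measurable_itv _) _ iKk.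
    apply: measurable_funM => //; apply: measurable_funB => //.
    exact: measurable_funTS.
  move=> t /=; rewrite in_itv/= => /andP[t0 t1].
  rewrite normrM distrC [X in _ * X]ger0_norm ?invr_ge0 ?powR_ge0// -powRN.
  by rewrite -AK// mulrC ler_wpM2l ?powR_ge0// gbound.
split => //.
have dA (x : R) : 0 < x -> is_derive x 1 (fun t : R => t `^ (- k) / (- k)) (x `^ (- (1 + k))).
  move=> x0; have -> : - (1 + k) = - k - 1 by ring.
  by apply: is_derive_powR_div; [rewrite oppr_eq0|].
have AE u : 0 < u -> u <= 1 ->
    (@lebesgue R).-integrable `[u, 1] (EFin \o (fun t => t `^ (- (1 + k)))) /\
    \int[lebesgue]_(t in `[u, 1]) (t `^ (- (1 + k))) = (u `^ (- k) - 1) / k.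
  move=> u0 u1; have [||i1 ->] := @FTC_segment R (fun t : R => t `^ (- k) / (- k))
     (fun t => t `^ (- (1 + k))) u 1 u1.
  - by move=> x ux _; apply: dA; exact: lt_le_trans ux.
  - by move=> x ux _; apply: powR_continuous; exact: lt_le_trans ux.
  by split => //; rewrite powR1; field.
have [ig gE] := integral_first_derivative fgG (@ler01 R).
have := @fubini_triangle R 0 1 (fun t => t `^ (- (1 + k))) g (fun t => K * t)
  (@measurable_powRr _ _ _) ig (fun u u0 u1 => (AE u u0 u1).1).
have i2 := integrable_powR_first_derivative.
rewrite (_ : \int[lebesgue]_(t in _) _ =
  - \int[lebesgue]_(t in `]0, 1]) ((f 0 - f t) / t `^ (1 + k))); last first.
  transitivity (\int[lebesgue]_(t in `]0, 1]) (-1 * ((f 0 - f t) / t `^ (1 + k))));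
    last by rewrite RintegralZl// mulN1r.
  apply: eq_Rintegral => t; rewrite inE/= in_itv/= => /andP[t0 _].
  by rewrite (integral_first_derivative fgG (ltW t0)).2 powRN; ring.
rewrite (_ : \int[lebesgue]_(u in _) (g _ * _) =
  k^-1 * (\int[lebesgue]_(t in `]0, 1]) (t `^ (- k) * g t) - (f 1 - f 0))); last first.
  transitivity (\int[lebesgue]_(t in `]0, 1]) (k^-1 * (t `^ (- k) * g t - g t))); last first.
    rewrite RintegralZl//; first by rewrite RintegralB// gE.
    exact: integrableB_EFin.
  apply: eq_Rintegral => t; rewrite inE/= in_itv/= => /andP[t0 t1].
  by rewrite (AE t t0 t1).2; ring.
move=> E; rewrite -[X in k * X]opprK E.
- by field.
- move=> t t0 t1; have := @Rintegral_cst_oc R K 0 t (ltW t0).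
  rewrite subr0 /Rintegral => <-.
  rewrite fineK; last by apply: integrable_fin_num => //; exact: integrable_cst_oc.
  apply: ge0_le_integral => //.
  + apply: measurableT_comp => //; apply: measurableT_comp => //.
    exact: measurable_funTS (measurable_first_derivative fgG).
  + move=> s /=; rewrite in_itv/= => /andP[/ltW s0 st]; rewrite lee_fin gK//.
    exact: le_trans t1.
- apply: eq_integrable iKk => //.
  by move=> t; rewrite inE/= in_itv/= => /andP[t0 _]; rewrite /= AK.
Qed.

End singular_identity.

Section weyl_identity.
Context (R : realType) (f g G : R -> R) (fgG : ac_derivatives f g G).
Context (k p M : R) (k0 : 0 < k) (k1 : k < 1) (p0 : 0 <= p).
Context (fM : forall t, `|f t| <= M).

Lemma integrable_tail : (@lebesgue R).-integrable `]1, +oo[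
    (EFin \o (fun t => f t / t `^ (1 + k))) /\
  `|\int[lebesgue]_(t in `]1, +oo[) (f t / t `^ (1 + k))| <= M / k.
Proof.
have [it tE] := powR_tail_integral k0 (@ltr01 R).
have mf := measurable_antiderivative fgG.
have [|||i1 le1] := @Rintegral_le_dominated R `]1, +oo[%classic
  (fun t => f t / t `^ (1 + k)) (fun t => M * t `^ (- (1 + k))) (measurable_itv _).
- apply: measurable_funM; first exact: measurable_funTS.
  have -> : (fun t : R => (t `^ (1 + k))^-1) = (fun t => t `^ (- (1 + k))).
    by apply/funext => t; rewrite powRN.
  exact: measurable_powRr.
- exact: integrableMl_EFin.
- move=> t _; rewrite normrM [X in _ * X]ger0_norm ?invr_ge0 ?powR_ge0//.
  by rewrite powRN ler_wpM2r ?invr_ge0 ?powR_ge0.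
split => //; apply: le_trans le1 _.
by rewrite RintegralZl// tE powR1 mul1r.
Qed.

(** Beyond 1 the constant [f 0] contributes [f 0 / k], which cancels the boundary term [- f 0] of
    the head. *)
Lemma weyl_split :
  k * weyl k f 0 = f 1 - \int[lebesgue]_(t in `]0, 1]) (t `^ (- k) * g t)
    - k * \int[lebesgue]_(t in `]1, +oo[) (f t / t `^ (1 + k)).
Proof.
have [ih hE] := singular_head fgG k0 k1.
have [it tE] := powR_tail_integral k0 (@ltr01 R).
have [i1 _] := integrable_tail.
have E' t : (f 0 - f t) / t `^ (1 + k) = f 0 * t `^ (- (1 + k)) - f t / t `^ (1 + k).
  by rewrite powRN; ring.
have i3 : (@lebesgue R).-integrable `]1, +oo[
    (EFin \o (fun t => f 0 * t `^ (- (1 + k)))) by exact: integrableMl_EFin.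
have i2 : (@lebesgue R).-integrable `]1, +oo[
    (EFin \o (fun t => (f 0 - f t) / t `^ (1 + k))).
  by apply: eq_integrable (integrableB_EFin (measurable_itv _) i3 i1) => // t _; rewrite /= E'.
rewrite /weyl.
rewrite (_ : \int[lebesgue]_(t in _) _ =
  \int[lebesgue]_(t in `]0, +oo[) ((f 0 - f t) / t `^ (1 + k))); last first.
  by apply: eq_Rintegral => t _; rewrite add0r.
have [||_ ->] := Rintegral_itv_split _ _ ih i2; [by rewrite bnd_simp|by []|].
rewrite mulrDr hE.
have -> : \int[lebesgue]_(t in `]1, +oo[) ((f 0 - f t) / t `^ (1 + k)) =
   (f 0 / k - \int[lebesgue]_(t in `]1, +oo[) (f t / t `^ (1 + k))).
  transitivity (\int[lebesgue]_(t in `]1, +oo[)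
      (f 0 * t `^ (- (1 + k)) - f t / t `^ (1 + k))).
    by apply: eq_Rintegral => t _; exact: E'.
  by rewrite RintegralB// RintegralZl// tE powR1 mul1r.
by field; rewrite gt_eqF.
Qed.

(** The two integrations by parts, with weights [rho] and [(t + p) / (1 + p)], have the same
    boundary term [g 1], which cancels in the difference. *)
Lemma second_derivative_rho :
  (@lebesgue R).-integrable `]- p, 1]
    (EFin \o (fun t => (rho k t - (t + p) / (1 + p)) * G t)) /\
  \int[lebesgue]_(t in `]- p, 1]) ((rho k t - (t + p) / (1 + p)) * G t) =
  (f 1 - f (- p)) / (1 + p)
    - (1 - k) * \int[lebesgue]_(t in `]0, 1]) (t `^ (- k) * g t).
Proof.
have [ia aE] := second_derivative_affine fgG p0.
have [ir rE] := second_derivative_powR fgG k1.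
have E0 t : t \in `]- p, 0]%classic -> G t * rho k t = 0.
  by rewrite inE/= in_itv/= => /andP[_ t0]; rewrite /rho ltNge t0/= mulr0.
have E1 t : t \in `]0, 1]%classic -> G t * rho k t = G t * t `^ (1 - k).
  by rewrite inE/= in_itv/= => /andP[t0 _]; rewrite /rho t0.
have j0 : (@lebesgue R).-integrable `]- p, 0] (EFin \o (fun t => G t * rho k t)).
  apply: eq_integrable (integrable0 _ _) => // t tD.
  by rewrite /= E0.
have j1 : (@lebesgue R).-integrable `]0, 1] (EFin \o (fun t => G t * rho k t)).
  by apply: eq_integrable ir => // t tD; rewrite /= E1.
have [||j jE] := Rintegral_itv_split _ _ j0 j1; [by rewrite bnd_simp oppr_le0|by rewrite bnd_simp|].
have E t : (rho k t - (t + p) / (1 + p)) * G t = G t * rho k t - G t * ((t + p) / (1 + p)).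
  by ring.
have i : (@lebesgue R).-integrable `]- p, 1]
    (EFin \o (fun t => (rho k t - (t + p) / (1 + p)) * G t)).
  under [X in EFin \o X]eq_fun do rewrite E.
  exact: integrableB_EFin.
split => //.
under eq_Rintegral do rewrite E.
rewrite RintegralB// aE jE.
have z0 : \int[lebesgue]_(t in `]- p, 0]) (G t * rho k t) = 0.
  transitivity (\int[lebesgue]_(t in `]- p, 0]) (0 : R)); first exact: eq_Rintegral.
  by rewrite Rintegral_cst// mul0r.
have z1 : \int[lebesgue]_(t in `]0, 1]) (G t * rho k t) =
    \int[lebesgue]_(t in `]0, 1]) (G t * t `^ (1 - k)).
  exact: eq_Rintegral.
by rewrite z0 z1 rE; ring.
Qed.

(* [k (1 - k)] times the singular integral is [- \int f' rho'], where [rho'] is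
   replaced by [omega] at the price of [\int f'' tau]. *)
Lemma weyl_identity :
  k * (1 - k) * weyl k f 0 =
  f (- p) / (1 + p) - f 1 * ((1 + p)^-1 - (1 - k))
  - k * (1 - k) * \int[lebesgue]_(t in `]1, +oo[) (f t / t `^ (1 + k))
  + \int[lebesgue]_(t in `]- p, 1]) ((rho k t - (t + p) / (1 + p)) * G t).
Proof.
rewrite (second_derivative_rho).2.
have -> : k * (1 - k) * weyl k f 0 = (1 - k) * (k * weyl k f 0) by ring.
by rewrite weyl_split; ring.
Qed.

(** The bound on [p] says that [(1 + p)^-1 - (1 - k)] is nonnegative. The absolute weights of [f] at
    [- p], at 1 and over the tail are then [(1 + p)^-1], [(1 + p)^-1 - (1 - k)] and [1 - k], with
    sum [2 / (1 + p)]. *)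
Lemma weyl_additive_bound : p <= k / (1 - k) ->
  k * (1 - k) * `|weyl k f 0| <= 2 / (1 + p) * M +
  `|\int[lebesgue]_(t in `]- p, 1]) ((rho k t - (t + p) / (1 + p)) * G t)|.
Proof.
move=> pk; have k10 : 0 < 1 - k by rewrite subr_gt0.
have kk : 0 <= k * (1 - k) by rewrite mulr_ge0// ltW.
have p1 : 0 < 1 + p by rewrite ltr_wpDr.
have c0 : 0 <= (1 + p)^-1 - (1 - k).
  rewrite subr_ge0 -[leRHS]mul1r ler_pdivlMr//.
  by move: pk; rewrite ler_pdivlMr// => pk'; rewrite mulrDr mulr1 -lerBrDl; lra.
rewrite -{1}(ger0_norm kk) -normrM weyl_identity.
apply: le_trans (ler_normD _ _) _; rewrite lerD2r.
have [_ tl] := integrable_tail.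
set I := \int[lebesgue]_(t in _) _ in tl *.
apply: le_trans (ler_normB _ _) _.
have h1 : `|k * (1 - k) * I| <= (1 - k) * M.
  rewrite normrM (ger0_norm kk).
  have -> : (1 - k) * M = k * (1 - k) * (M / k) by field; rewrite gt_eqF.
  by rewrite ler_wpM2l.
have h2 : `|f (- p) / (1 + p) - f 1 * ((1 + p)^-1 - (1 - k))| <=
    M / (1 + p) + M * ((1 + p)^-1 - (1 - k)).
  apply: le_trans (ler_normB _ _) _; rewrite !normrM (ger0_norm c0).
  have -> : `|(1 + p)^-1| = (1 + p)^-1 by rewrite ger0_norm// invr_ge0 ltW.
  by rewrite lerD// ler_wpM2r// invr_ge0 ltW.
by apply: le_trans (lerD h2 h1) _; rewrite le_eqVlt; apply/orP; left; apply/eqP; ring.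
Qed.

(** Such an [f] realises all three weights of the additive bound with the same sign, and its tail is
    explicit. *)
Lemma weyl_additive_equality : f (- p) = M -> (forall t, 1 <= t -> f t = - M) ->
  k * (1 - k) * weyl k f 0 = 2 / (1 + p) * M +
  \int[lebesgue]_(t in `]- p, 1]) ((rho k t - (t + p) / (1 + p)) * G t).
Proof.
move=> fp f1; rewrite weyl_identity fp f1//; congr (_ + _).
have [it tE] := powR_tail_integral k0 (@ltr01 R).
rewrite (_ : \int[lebesgue]_(t in `]1, +oo[) _ = - M / k); last first.
  transitivity (\int[lebesgue]_(t in `]1, +oo[) (- M * t `^ (- (1 + k)))).
    apply: eq_Rintegral => t; rewrite inE/= in_itv/= andbT => /ltW t1.
    by rewrite f1// powRN.
  by rewrite RintegralZl// tE powR1 mul1r.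
by field; rewrite ?(gt_eqF k0)// gt_eqF// ltr_wpDr.
Qed.

End weyl_identity.

(** * The multiplicative inequality *)

Lemma is_derive_affine (R : realType) (f g : R -> R) (h c : R) :
  (forall x : R, is_derive x 1 f (g x)) ->
  forall x : R, is_derive x 1 (fun t => f (h * t + c)) (h * g (h * x + c)).
Proof.
move=> df x.
have da : is_derive x 1 (fun t : R => h * t + c) h.
  rewrite (_ : (fun t : R => h * t + c) = (h \*: id) \+ cst c); last by apply/funext.
  apply: is_derive_eq.
  by rewrite /GRing.scale/= mulr1 addr0.
have := @is_derive1_comp R f (fun t : R => h * t + c) x (g (h * x + c)) h (df _) da.
by rewrite mulrC.
Qed.

Lemma ac_derivatives_affine (R : realType) (f g G : R -> R) (h c : R) : 0 < h ->
  ac_derivatives f g G ->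
  ac_derivatives (fun t => f (h * t + c)) (fun t => h * g (h * t + c))
    (fun t => h ^+ 2 * G (h * t + c)).
Proof.
move=> h0 [df cg mG iG].
have mphi : measurable_fun setT (fun t : R => h * t + c).
  by apply: measurable_funD => //; exact: measurable_funM.
have cphi : continuous (fun t : R => h * t + c).
  by move=> t; apply: cvgD; [apply: cvgM; [exact: cvg_cst|exact: cvg_id]|exact: cvg_cst].
split.
- exact: is_derive_affine.
- move=> x; apply: cvgM; first exact: cvg_cst.
  by apply: continuous_comp; [exact: cphi|exact: cg].
- by apply: measurable_funM => //; exact: (measurableT_comp mG).
- move=> x y xy.
  have xy' : h * x + c <= h * y + c by rewrite lerD2r ler_wpM2l// ltW.
  have [i1 E1] := iG _ _ xy'.
  have D0 : (fun t : R => h * t + c) @^-1` `]h * x + c, h * y + c]%classic = `]x, y]%classic.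
    by apply/seteqP; split => t /=; rewrite !in_itv/= ltrD2r lerD2r ltr_pM2l// ler_pM2l.
  have i2 := @integrable_affine R h c _ _ h0 (measurable_itv _) i1.
  rewrite D0 in i2.
  split; first exact: integrableMl_EFin.
  rewrite -mulrBr E1 (@Rintegral_affine _ h c _ _ h0 (measurable_itv _)); last first.
    exact: measurable_funTS.
  by rewrite D0 mulrA -expr2 RintegralZl.
Qed.

Section multiplicative_bound.
Context (R : realType) (k p B : R) (s : \bar R).
Context (k0 : 0 < k) (k1 : k < 1) (p0 : 0 <= p) (pk : p <= k / (1 - k)).
Context (s1 : (1 <= s)%E).
Context (tau_bound : forall (f g G : R -> R) (S : R), ac_derivatives f g G ->
  (Ls_norm s G <= S%:E)%E ->
  `|\int[lebesgue]_(t in `]- p, 1]) ((rho k t - (t + p) / (1 + p)) * G t)| <= B * S).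
Context (f g G : R -> R) (M S : R) (fgG : ac_derivatives f g G).
Context (fM : forall t, `|f t| <= M) (GS : (Ls_norm s G <= S%:E)%E).

Let nu : R := 2 - fine s^-1%E.

Lemma nu_bounds : 1 <= nu /\ nu <= 2.
Proof.
rewrite /nu; case: s s1 => [r|_|//].
- rewrite lee_fin => r1; have r0 : 0 < r by exact: lt_le_trans r1.
  rewrite inver gt_eqF//=.
  have : r^-1 <= 1 by rewrite invf_le1.
  have : 0 <= r^-1 by rewrite invr_ge0 ltW.
  by lra.
- by rewrite invey /=; lra.
Qed.

(** The additive bound for the function [t -> f (h * t + x)] at 0: the sup bound is unchanged, and
    the second derivative has norm multiplied by [h^2] and by [h^(- 1/s)], together [h^nu]. *)
Lemma weyl_scaled_bound (h x : R) : 0 < h ->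
  k * (1 - k) * `|weyl k f x| * h `^ k <= 2 / (1 + p) * M + B * (h `^ nu * S).
Proof.
move=> h0; have mf := measurable_antiderivative fgG.
have [L Lf] := ac_derivatives_lip_bounded x fgG fM.
have hfgG := ac_derivatives_affine x h0 fgG.
have := @weyl_additive_bound R _ _ _ hfgG k p M k0 k1 p0 _ pk.
move=> /(_ (fun t => fM _)) bound.
have E : weyl k (fun t => f (h * t + x)) 0 = h `^ k * weyl k f x.
  rewrite -(weyl_dilation k0 k1 h0 mf Lf); congr (weyl _ _ _).
  by apply/funext => t; rewrite addrC.
have -> : k * (1 - k) * `|weyl k f x| * h `^ k =
    k * (1 - k) * `|weyl k (fun t => f (h * t + x)) 0|.
  by rewrite E normrM (ger0_norm (powR_ge0 _ _)); ring.
apply: le_trans bound _; rewrite lerD2l.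
apply: (tau_bound hfgG).
have [_ _ mG _] := fgG.
rewrite (@Ls_normZ _ _ (h ^+ 2) (fun t => G (h * t + x)))//; last first.
  apply: (measurableT_comp mG).
  by apply: measurable_funD => //; exact: measurable_funM.
rewrite Ls_norm_affine// muleA ger0_norm ?exprn_ge0 ?(ltW h0)// -EFinM.
have -> : h ^+ 2 * h `^ (- fine s^-1%E) = h `^ nu.
  by rewrite -powR_mulrn ?(ltW h0)// -powRD ?(gt_eqF h0) ?implybT.
by rewrite EFinM; apply: lee_wpmul2l => //; rewrite lee_fin powR_ge0.
Qed.

Lemma powR_bounded_le0 (a C : R) : (forall h : R, 0 < h -> a * h `^ k <= C) -> a <= 0.
Proof.
move=> aC; rewrite leNgt; apply/negP => a0.
have C0 : 0 <= C.
  by apply: le_trans (aC 1 ltr01); rewrite mulr_ge0 ?powR_ge0// ltW.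
have C1 : 0 < (C + 1) / a by rewrite divr_gt0// ltr_wpDl.
(* At this [h] the left-hand side equals [C + 1]. *)
have := aC (((C + 1) / a) `^ k^-1); rewrite powR_gt0// => /(_ isT).
rewrite -powRrM mulVf ?gt_eqF// powRr1 ?(ltW C1)// mulrC divfK ?gt_eqF//.
by rewrite leNgt ltrDl ltr01.
Qed.

(** The dilation with [h^nu = (M / M0) * (S0 / S)] turns the scaled bound into [M / M0] times the
    additive bound for the pair [M0], [S0]; since [lambda = k / nu], the factor [h^k] splits into
    powers [lambda]. The reference pair is free here; later it consists of norms of an extremal
    function. *)
Lemma weyl_multiplicative_bound (M0 S0 x : R) : 0 < M0 -> 0 < S0 -> 0 <= B ->
  k * (1 - k) * `|weyl k f x| <=
  (2 / (1 + p) * M0 + B * S0) * ((M / M0) `^ (1 - lambda k s) * (S / S0) `^ lambda k s).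
Proof.
move=> M00 S00 B0; have [nu1 nu2] := nu_bounds.
have nu0 : 0 < nu by lra.
have kk : 0 <= k * (1 - k) by rewrite mulr_ge0 ?subr_ge0// ltW.
have p1 : 0 < 1 + p by rewrite ltr_wpDr.
have K0 : 0 <= 2 / (1 + p) * M0 + B * S0.
  by rewrite addr_ge0// mulr_ge0 ?divr_ge0 ?(ltW M00) ?(ltW S00) ?(ltW p1).
have rhs0 : 0 <= (2 / (1 + p) * M0 + B * S0) *
    ((M / M0) `^ (1 - lambda k s) * (S / S0) `^ lambda k s).
  by rewrite !mulr_ge0 ?powR_ge0.
have M_ge0 : 0 <= M by apply: le_trans (fM 0).
have S_ge0 : 0 <= S by rewrite -lee_fin; apply: le_trans (Ls_norm_ge0 _ _) GS.
move: M_ge0; rewrite le_eqVlt => /predU1P[M0'|M_gt0].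
  have fz t : f t = 0 by apply/eqP; rewrite -normr_le0 M0'.
  have -> : weyl k f x = 0.
    rewrite /weyl; transitivity (\int[lebesgue]_(t in `]0, +oo[) (0 : R)).
      by apply: eq_Rintegral => t _; rewrite !fz subrr mul0r.
    by rewrite Rintegral_cst// mul0r.
  by rewrite normr0 mulr0.
move: S_ge0; rewrite le_eqVlt => /predU1P[S0'|S_gt0].
  (* When [f'' = 0], large dilations show that [weyl k f x = 0]. *)
  apply: le_trans rhs0; apply: powR_bounded_le0 => h h0.
  have := weyl_scaled_bound x h0; rewrite -S0' !mulr0 addr0; exact.
(* This dilation makes the two norms proportional to [M0] and [S0]. *)
pose h := (M / M0 * (S0 / S)) `^ nu^-1.
have q0 : 0 < M / M0 * (S0 / S) by rewrite mulr_gt0// divr_gt0.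
have h0 : 0 < h by rewrite powR_gt0.
have hnu : h `^ nu = M / M0 * (S0 / S).
  by rewrite -powRrM mulVf ?gt_eqF// powRr1// ltW.
have hk : h `^ k = (M / M0) `^ lambda k s * (S0 / S) `^ lambda k s.
  rewrite -powRM ?divr_ge0 ?ltW// -powRrM; congr (_ `^ _).
  by rewrite mulrC.
have := weyl_scaled_bound x h0; rewrite hnu => le.
have hk0 : 0 < h `^ k by rewrite powR_gt0.
rewrite -(ler_pM2r hk0); apply: le_trans le _.
rewrite le_eqVlt; apply/orP; left; apply/eqP.
have e1 : (S / S0) `^ lambda k s * (S0 / S) `^ lambda k s = 1.
  rewrite -powRM ?divr_ge0 ?ltW// (_ : S / S0 * (S0 / S) = 1) ?powR1//.
  by field; rewrite !gt_eqF.
have e2 : (M / M0) `^ (1 - lambda k s) * (M / M0) `^ lambda k s = M / M0.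
  have MM : 0 < M / M0 by rewrite divr_gt0.
  by rewrite -powRD ?(gt_eqF MM) ?implybT// subrK powRr1 ?ltW.
rewrite hk.
transitivity ((2 / (1 + p) * M0 + B * S0) *
  (((M / M0) `^ (1 - lambda k s) * (M / M0) `^ lambda k s) *
   ((S / S0) `^ lambda k s * (S0 / S) `^ lambda k s))); last by ring.
by rewrite e1 e2; field; rewrite !gt_eqF.
Qed.

End multiplicative_bound.

(** * Essential suprema, exceptional points, and continuity of the singular integral *)

Lemma ae_lebesgue_filter (R : realType) :
  Filter (almost_everywhere (@lebesgue R)).
Proof. exact: ae_filter_ringOfSetsType. Qed.

#[local] Existing Instance ae_lebesgue_filter.

Lemma L2infty_ac_derivatives (R : realType) (s : \bar R) (f : R -> R) :
  L2infty s f -> ac_derivatives f f^`()%classic f^`(2)%classic.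
Proof.
move=> [_ df acf f2]; have m2 : measurable_fun setT f^`(2)%classic.
  by move: f2 => /andP[/[!inE]].
split; [|exact: ac_continuous|exact: m2|exact: ac_FTC].
by move=> x; rewrite derive1E; apply: DeriveDef => //; exact: df.
Qed.

(** By continuity any number below [|u x|] is exceeded on a ball, and a ball has positive
    measure. *)
Lemma Ls_norm_pinfty_ge (R : realType) (u : R -> R) (x : R) :
  {for x, continuous u} -> (`|u x|%:E <= Ls_norm +oo%E u)%E.
Proof.
move=> cu; rewrite leNgt; apply/negP => lt.
have [y yE] : exists y, Ls_norm +oo%E u = y%:E.
  exists (fine (Ls_norm +oo%E u)); rewrite fineK// ge0_fin_numE ?Ls_norm_ge0//.
  exact: lt_trans lt (ltry _).
move: lt; rewrite yE lte_fin => yu.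
have [A [mA A0 uA]] : {ae @lebesgue R, forall t, `|u t| <= y}.
  have := (Ls_norm_pinfty_le u y%:E).2; rewrite yE lexx => /(_ isT).
  by apply: filterS => t; rewrite lee_fin.
have [e e0 be] : exists2 e : R, 0 < e & forall t, `|x - t| < e -> y < `|u t|.
  have yux : 0 < `|u x| - y by rewrite subr_gt0.
  move/cvgrPdist_lt : cu => /(_ _ yux)[e /= e0 ue].
  exists e => // t xt; have := ue t xt => h.
  have := ler_dist_dist (u x) (u t); have := ler_norm (`|u x| - `|u t|); lra.
have sub : ball x e `<=` A.
  move=> t xt; apply: uA => /=; apply/negP; rewrite -ltNge.
  exact: be.
have : (lebesgue (ball x e) <= lebesgue A)%E.
  by apply: le_measure; rewrite ?inE//; exact: measurable_ball.
rewrite A0 lebesgue_measure_ball ?(ltW e0)// lee_fin leNgt => /negP; apply.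
by rewrite mulr2n addr_gt0.
Qed.

Lemma Ls_norm_fineK (R : realType) (s : \bar R) (f : R -> R) :
  f \in Lfun (@lebesgue R) s -> (Ls_norm s f = (fine (Ls_norm s f))%:E)%E.
Proof.
move=> /andP[_ /[!inE] fin]; rewrite fineK// ge0_fin_numE//; exact: Ls_norm_ge0.
Qed.

Lemma L2infty_bounded (R : realType) (s : \bar R) (f : R -> R) : L2infty s f ->
  forall t, `|f t| <= fine (Ls_norm +oo%E f).
Proof.
move=> Lf t; have [fy _ _ _] := Lf.
rewrite -lee_fin -Ls_norm_fineK//; apply: Ls_norm_pinfty_ge.
exact: continuous_antiderivative (L2infty_ac_derivatives Lf) t.
Qed.

Lemma lipschitz_locally_ac (R : realType) (K : R) (f : R -> R) :
  (forall x y, x <= y -> `|f y - f x| <= K * (y - x)) -> locally_abs_continuous f.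
Proof.
move=> fK a b ab e e0.
have K0 : 0 <= K by have := le_trans (normr_ge0 _) (fK 0 1 ler01); rewrite subr0 mulr1.
have K10 : 0 < K + 1 by lra.
exists (e / (K + 1)); first by rewrite divr_gt0.
move=> N u v uv _; rewrite ltr_pdivlMr// => lt; apply: le_lt_trans lt.
rewrite mulr_suml; apply: ler_sum => i _; have [_ [uvi _]] := uv i.
apply: le_trans (fK _ _ uvi) _; rewrite mulrC ler_wpM2l ?subr_ge0//; lra.
Qed.

(** For the second derivatives of the extremal functions, which are known only outside finitely many
    points. *)
Lemma measurable_fun_finite_change (R : realType) (f g : R -> R) (s : seq R) :
  measurable_fun setT f -> (forall x, x \notin s -> g x = f x) ->
  measurable_fun setT g.
Proof.
move=> mf fg _ Y mY; rewrite setTI.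
have ms (P : set R) : measurable [set x | x \in s /\ P x].
  apply: countable_measurable => //.
  apply: (@sub_countable _ _ _ [set` s]); last exact/finite_set_countable/finite_seq.
  by apply: subset_card_le => x [].
rewrite (_ : g @^-1` Y = (f @^-1` Y `\` [set x | x \in s /\ True]) `|`
    [set x | x \in s /\ Y (g x)]); last first.
  apply/seteqP; split => x /=.
    have [xs|xs] := boolP (x \in s); first by right.
    by move=> gY; left; split; [rewrite -fg|case].
  by case=> [[fY xs]|[]//]; rewrite fg//; apply/negP => xs'; apply: xs.
apply: measurableU => //; apply: measurableD => //.
by rewrite -[_ @^-1` _]setTI; exact: mf.
Qed.

Lemma ae_finite_change (R : realType) (f g : R -> R) (s : seq R) :
  (forall x, x \notin s -> g x = f x) -> {ae @lebesgue R, forall x, g x = f x}.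
Proof.
move=> fg; exists [set` s]; split.
- by apply: countable_measurable => //; exact/finite_set_countable/finite_seq.
- by apply: countable_lebesgue_measure0; exact/finite_set_countable/finite_seq.
- by move=> x /= gf; apply/negPn/negP => xs; apply: gf; exact: fg.
Qed.

Lemma Ls_norm_ae_eq (R : realType) (s : \bar R) (f g : R -> R) : (1 <= s)%E ->
  measurable_fun setT f -> measurable_fun setT g ->
  {ae @lebesgue R, forall x, g x = f x} -> Ls_norm s g = Ls_norm s f.
Proof.
move=> s1 mf mg gf; case: s s1 => [r|_|//].
- move=> r1; rewrite !Ls_norm_EFin; congr (_ `^ _)%E.
  apply: ge0_ae_eq_integral => //.
  + exact: measurable_normr_powR.
  + exact: measurable_normr_powR.
  + case: gf => A [mA A0 gA]; exists A; split => // x /= ne.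
    by apply: gA => /= E; apply: ne => _; rewrite E.
- rewrite !Ls_norm_pinfty; apply: eq_ess_sup.
  case: gf => A [mA A0 gA]; exists A; split => // x /= ne.
  by apply: gA => /= E; apply: ne; rewrite E.
Qed.

Lemma lipschitz_lip_bounded (R : realType) (f : R -> R) (K M x : R) :
  (forall x y, `|f x - f y| <= K * `|x - y|) -> (forall t, `|f t| <= M) ->
  lip_bounded K (2 * M) f x.
Proof.
move=> fK fM t t0; split.
  by have := fK x (x + t); rewrite opprD addNKr normrN (gtr0_norm t0).
by apply: le_trans (ler_normB _ _) _; rewrite mulr_natl mulr2n lerD.
Qed.

Lemma lipschitz_continuous (R : realType) (f : R -> R) (K : R) :
  (forall x y, `|f x - f y| <= K * `|x - y|) -> continuous f.
Proof.
move=> fK x; have K0 : 0 <= K.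
  by have := le_trans (normr_ge0 _) (fK 0 1); rewrite sub0r normrN1 mulr1.
apply/cvgrPdist_lt => e e0; near=> y.
apply: le_lt_trans (fK x y) _.
have h : `|x - y| < e / (K + 1).
  near: y; exists (e / (K + 1)) => //=; apply: divr_gt0 => //; lra.
move: h; rewrite ltr_pdivlMr; last lra.
by rewrite mulrDr mulr1 mulrC; have := normr_ge0 (x - y); lra.
Unshelve. all: by end_near. Qed.

(** The function [f (t + h) - f t] is bounded by [K * |h|] and has Lipschitz constant [2 * K];
    cutting its singular integral at [|h|] makes both parts of order [|h|^(1 - k)]. *)
Lemma weyl_hoelder (R : realType) (k K M : R) (f : R -> R) (x h : R) :
  0 < k -> k < 1 -> h != 0 -> (forall x y, `|f x - f y| <= K * `|x - y|) ->
  (forall t, `|f t| <= M) ->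
  `|weyl k f (x + h) - weyl k f x| <=
    2 * K * ((1 - k)^-1 + k^-1) * `|h| `^ (1 - k).
Proof.
move=> k0 k1 h0 fK fM.
have hp : 0 < `|h| by rewrite normr_gt0.
have mf : measurable_fun setT f.
  by apply: continuous_measurable_fun; exact: lipschitz_continuous fK.
have mfh : measurable_fun setT (fun t : R => f (t + h)).
  by apply: (measurableT_comp mf); exact: measurable_funD.
have E : weyl k f (x + h) = weyl k (fun t : R => f (t + h)) x.
  by apply: eq_Rintegral => t _; rewrite addrAC.
have lf : lip_bounded K (2 * M) f x by exact: lipschitz_lip_bounded.
have lfh : lip_bounded K (2 * M) (fun t : R => f (t + h)) x.
  apply: lipschitz_lip_bounded => // y z.
  by have := fK (y + h) (z + h); rewrite opprD addrACA subrr addr0.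
rewrite E -(weylB k0 k1 mfh lfh mf lf).
have lg : lip_bounded (2 * K) (2 * (K * `|h|)) (fun t : R => f (t + h) - f t) x.
  have fh t : `|f (t + h) - f t| <= K * `|h|.
    by have := fK (t + h) t; rewrite addrAC subrr add0r.
  move=> t t0; split.
    have [h1 _] := lf t t0; have [h2 _] := lfh t t0.
    have -> : f (x + h) - f x - (f (x + t + h) - f (x + t)) =
        (f (x + h) - f (x + t + h)) - (f x - f (x + t)) by ring.
    by apply: le_trans (ler_normB _ _) _; rewrite -mulrA mulr_natl mulr2n lerD.
  by apply: le_trans (ler_normB _ _) _; rewrite mulr_natl mulr2n lerD.
have := weyl_bound k0 k1 hp (measurable_funB mfh mf) lg; rewrite /= => /le_trans; apply.
have -> : 2 * (K * `|h|) * (`|h| `^ (- k) / k) = 2 * K * (`|h| * `|h| `^ (- k)) / k by ring.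
have -> : `|h| * `|h| `^ (- k) = `|h| `^ (1 - k).
  by rewrite powRD ?(gt_eqF hp) ?implybT// powRr1// ltW.
by rewrite le_eqVlt; apply/orP; left; apply/eqP; ring.
Qed.

Lemma weyl_continuous (R : realType) (k K M : R) (f : R -> R) : 0 < k -> k < 1 ->
  (forall x y, `|f x - f y| <= K * `|x - y|) -> (forall t, `|f t| <= M) ->
  continuous (weyl k f).
Proof.
move=> k0 k1 fK fM x; have K0 : 0 <= K.
  by have := le_trans (normr_ge0 _) (fK 0 1); rewrite sub0r normrN1 mulr1.
set c := 2 * K * ((1 - k)^-1 + k^-1).
have c0 : 0 <= c.
  by rewrite /c mulr_ge0 ?mulr_ge0// addr_ge0 ?invr_ge0 ?subr_ge0// ltW.
have k10 : 0 < 1 - k by rewrite subr_gt0.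
apply/cvgrPdist_lt => e e0; near=> y.
have [->|yx] := eqVneq y x; first by rewrite subrr normr0.
have h : `|y - x| < (e / (c + 1)) `^ (1 - k)^-1.
  rewrite distrC; near: y; exists ((e / (c + 1)) `^ (1 - k)^-1) => //=.
  by apply: powR_gt0; apply: divr_gt0 => //; lra.
have yx0 : y - x != 0 by rewrite subr_eq0.
have := weyl_hoelder x k0 k1 yx0 fK fM; rewrite [x + _]addrC subrK -/c distrC.
move=> /le_lt_trans; apply.
have h' : `|y - x| `^ (1 - k) < e / (c + 1).
  have eE : e / (c + 1) = ((e / (c + 1)) `^ (1 - k)^-1) `^ (1 - k).
    rewrite -powRrM mulVf ?gt_eqF// powRr1//; apply: divr_ge0; lra.
  by rewrite eE; apply: gt0_ltr_powR => //; rewrite nnegrE ?powR_ge0.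
move: h'; rewrite ltr_pdivlMr; last lra.
by rewrite mulrDr mulr1 mulrC; have := powR_ge0 `|y - x| (1 - k); lra.
Unshelve. all: by end_near. Qed.

Lemma Ls_norm_pinfty_max (R : realType) (u : R -> R) (W z : R) :
  {for z, continuous u} -> (forall x, `|u x| <= W) -> `|u z| = W ->
  Ls_norm +oo%E u = W%:E.
Proof.
move=> cu uW uz; apply/eqP; rewrite eq_le -{2}uz Ls_norm_pinfty_ge// andbT.
by apply/Ls_norm_pinfty_le; apply: aeW => x; rewrite lee_fin.
Qed.

(** Continuity of [weyl] makes the value at the single point [z] count in the essential supremum. *)
Lemma Ls_norm_marchaud (R : realType) (k K M W c z : R) (n : nat) (f : R -> R) :
  0 < k -> k < 1 -> (forall x y, `|f x - f y| <= K * `|x - y|) ->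
  (forall t, `|f t| <= M) -> (forall x, marchaud k n f x = c * weyl k f x) ->
  (forall x, `|weyl k f x| <= W) -> `|weyl k f z| = W ->
  Ls_norm +oo%E (marchaud k n f) = (`|c| * W)%:E.
Proof.
move=> k0 k1 fK fM fc fW fz.
have -> : marchaud k n f = (fun x => c * weyl k f x) by apply/funext.
apply: (@Ls_norm_pinfty_max _ _ _ z).
- by apply: cvgM; [exact: cvg_cst|exact: (weyl_continuous k0 k1 fK fM)].
- by move=> x; rewrite normrM ler_wpM2l.
- by rewrite normrM fz.
Qed.

(** * Double integrals *)

Lemma is_derive_quadratic_error (R : realType) (f : R -> R) (x v K : R) :
  (forall y, `|f y - f x - (y - x) * v| <= K * (y - x) ^+ 2) -> is_derive x 1 f v.
Proof.
move=> fK.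
have K0 : 0 <= K.
  have := le_trans (normr_ge0 _) (fK (x + 1)).
  by rewrite addrAC subrr add0r expr1n mulr1.
have cv : h^-1 *: (f (h + x) - f x) @[h --> 0^'] --> v.
  apply/cvgrPdist_lt => e e0; near=> h.
  have h0 : h != 0 by near: h; exact: nbhs_dnbhs_neq.
  have hK : `|h| < e / (K + 1).
    near: h; apply: dnbhs0_lt; rewrite divr_gt0//; lra.
  have := fK (h + x); rewrite addrK => le.
  have -> : v - h^-1 *: (f (h + x) - f x) = - (h^-1 * (f (h + x) - f x - h * v)).
    by rewrite /GRing.scale/=; field.
  rewrite normrN normrM normfV ltr_pdivrMl ?normr_gt0//.
  apply: le_lt_trans le _; rewrite -(real_normK (num_real h)) expr2 mulrCA ltr_pM2l ?normr_gt0//.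
  move: hK; rewrite ltr_pdivlMr; last lra.
  by rewrite mulrDr mulr1 mulrC => hK; have := normr_ge0 h; lra.
have cv1 : h^-1 *: (f (h *: (1 : R) + x) - f x) @[h --> 0^'] --> v.
  by under eq_fun do rewrite scaler1.
apply: DeriveDef; first exact: (cvgP _ cv1).
by apply/cvg_lim => //; exact: Rhausdorff.
Unshelve. all: by end_near. Qed.

Section double_integral.
Context (R : realType) (T : R -> R) (a C c : R).
Context (mT : measurable_fun setT T) (TC : forall t, `|T t| <= C).
Context (Ta : forall t, t <= a -> T t = 0).

Let V x := \int[lebesgue]_(t in `]a, x]) T t.
Let W x := \int[lebesgue]_(t in `]a, x]) (t * T t).
Let F x := c + \int[lebesgue]_(t in `]a, x]) ((x - t) * T t).

Lemma bounded_integrable_oc (h : R -> R) (K x y : R) : measurable_fun setT h ->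
  (forall t, x < t -> t <= y -> `|h t| <= K) ->
  (@lebesgue R).-integrable `]x, y] (EFin \o h) /\
  (x <= y -> `|\int[lebesgue]_(t in `]x, y]) h t| <= K * (y - x)).
Proof.
move=> mh hK.
have [||i le] := @Rintegral_le_dominated R `]x, y]%classic h (fun=> K) (measurable_itv _)
  (measurable_funTS mh).
- exact: integrable_cst_oc.
- by move=> t /=; rewrite in_itv/= => /andP[xt ty]; exact: hK.
by split => // xy; rewrite -Rintegral_cst_oc.
Qed.

Lemma integral_from_left (h : R -> R) (x y : R) :
  (forall t, t <= a -> h t = 0) ->
  (forall x y, (@lebesgue R).-integrable `]x, y] (EFin \o h)) -> x <= y ->
  \int[lebesgue]_(t in `]a, y]) h t - \int[lebesgue]_(t in `]a, x]) h t =
  \int[lebesgue]_(t in `]x, y]) h t.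
Proof.
move=> ha ih xy.
have z (u v : R) : v <= a -> \int[lebesgue]_(t in `]u, v]) h t = 0.
  by move=> va; apply: Rintegral_oc_eq0 => t _ tv; rewrite ha// (le_trans tv).
have [ax|xa] := leP a x.
  have [||_ ->] := Rintegral_itv_split _ _ (ih a x) (ih x y); rewrite ?bnd_simp//.
  by rewrite addrAC subrr add0r.
have [ay|ya] := leP a y.
  have [||_ ->] := Rintegral_itv_split _ _ (ih x a) (ih a y); rewrite ?bnd_simp ?(ltW xa)//.
  by rewrite (z a x (ltW xa)) (z x a (lexx a)) subr0 add0r.
by rewrite (z a y (ltW ya)) (z a x (ltW xa)) (z x y (ltW ya)) subrr.
Qed.

Lemma integrable_density (x y : R) :
  (@lebesgue R).-integrable `]x, y] (EFin \o T).
Proof. by have [] := @bounded_integrable_oc T C x y mT (fun t _ _ => TC t). Qed.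

Lemma integrable_first_moment (x y : R) :
  (@lebesgue R).-integrable `]x, y] (EFin \o (fun t => t * T t)).
Proof.
have C0 : 0 <= C by apply: le_trans (TC 0).
have [] // := @bounded_integrable_oc (fun t => t * T t) ((`|x| + `|y|) * C) x y.
  exact: measurable_funM.
move=> t xt ty; rewrite normrM ler_pM//.
have [t0|t0] := leP 0 t.
  by rewrite ger0_norm//; apply: le_trans ty _; have := ler_norm y; have := normr_ge0 x; lra.
by rewrite ltr0_norm//; have := ler_norm (- x); rewrite normrN; have := normr_ge0 y; lra.
Qed.

Lemma double_integralE (x : R) : F x = c + (x * V x - W x).
Proof.
rewrite /F /V /W; congr (_ + _).
rewrite -RintegralZl//; last exact: integrable_density.
rewrite -RintegralB//; last 2 first.
- by apply: integrableMl_EFin => //; exact: integrable_density.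
- exact: integrable_first_moment.
by apply: eq_Rintegral => t _; ring.
Qed.

Lemma integral_density (x y : R) : x <= y ->
  V y - V x = \int[lebesgue]_(t in `]x, y]) T t.
Proof. by move=> xy; apply: integral_from_left => //; exact: integrable_density. Qed.

Lemma integral_density_lipschitz (x y : R) : x <= y -> `|V y - V x| <= C * (y - x).
Proof.
move=> xy; rewrite integral_density//.
by have [_] := @bounded_integrable_oc T C x y mT (fun t _ _ => TC t); apply.
Qed.

(** Taylor's formula with integral remainder. The quadratic error yields the derivative of [F] at
    every point, whatever the discontinuities of [T]. *)
Lemma double_integral_increment (x y : R) : x <= y ->
  F y - F x - (y - x) * V x = \int[lebesgue]_(t in `]x, y]) ((y - t) * T t) /\
  `|F y - F x - (y - x) * V x| <= C * (y - x) ^+ 2.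
Proof.
move=> xy.
have C0 : 0 <= C by apply: le_trans (TC 0).
have E : F y - F x - (y - x) * V x = \int[lebesgue]_(t in `]x, y]) ((y - t) * T t).
  transitivity (y * (V y - V x) - (W y - W x)); first by rewrite !double_integralE; ring.
  rewrite integral_density// /W integral_from_left//; last 2 first.
  - by move=> t ta; rewrite Ta// mulr0.
  - exact: integrable_first_moment.
  rewrite -RintegralZl//; last exact: integrable_density.
  rewrite -RintegralB//; last 2 first.
  - by apply: integrableMl_EFin => //; exact: integrable_density.
  - exact: integrable_first_moment.
  by apply: eq_Rintegral => t _; ring.
split => //; rewrite E.
have [|_] := @bounded_integrable_oc (fun t => (y - t) * T t) (C * (y - x)) x y
  (measurable_funM (measurable_funB (measurable_cst _) (@measurable_id _ _ _)) mT).
  move=> t xt ty; rewrite normrM mulrC ler_pM// ger0_norm ?subr_ge0//; lra.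
by move=> /(_ xy); rewrite expr2 mulrA.
Qed.

Lemma ac_derivatives_double_integral : ac_derivatives F V T.
Proof.
have C0 : 0 <= C by apply: le_trans (TC 0).
have dF (x : R) : is_derive x 1 F (V x).
  (* The factor 2 is for [y < x]: the expansion at [y] is moved to [x], and replacing [V y] by [V x]
     costs a second term [C * (x - y)^2]. *)
  apply: (@is_derive_quadratic_error _ _ _ _ (2 * C)) => y.
  have [xy|/ltW yx] := leP x y.
    apply: le_trans (double_integral_increment xy).2 _.
    by rewrite ler_wpM2r ?sqr_ge0//; lra.
  have [_ h1] := double_integral_increment yx; have h2 := integral_density_lipschitz yx.
  have -> : F y - F x - (y - x) * V x =
      - (F x - F y - (x - y) * V y) + (x - y) * (V x - V y) by ring.
  apply: le_trans (ler_normD _ _) _; rewrite normrN normrM (@ger0_norm _ (x - y)) ?subr_ge0//.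
  have h3 : (x - y) * `|V x - V y| <= C * (x - y) ^+ 2.
    by rewrite expr2 mulrCA ler_wpM2l ?subr_ge0.
  by rewrite -(sqrrN (y - x)) opprB; lra.
split => //.
- apply: ac_continuous; exact: lipschitz_locally_ac integral_density_lipschitz.
- by move=> x y xy; split; [exact: integrable_density|exact: integral_density].
Qed.

Lemma derivable_double_integral (x : R) : derivable F x 1.
Proof. by have [dF _ _ _] := ac_derivatives_double_integral; have [] := dF x. Qed.

Lemma derive1_double_integral : F^`()%classic = V.
Proof.
apply/funext => x; rewrite derive1E.
by have [dF _ _ _] := ac_derivatives_double_integral; have [_] := dF x.
Qed.

Lemma derive1n2_double_integral (x : R) : {for x, continuous T} -> F^`(2)%classic x = T x.
Proof.
move=> cT; rewrite /= derive1_double_integral.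
(* A base point to the left of both [a] and [x] makes [x] interior; since [T] vanishes up to [a],
   the integral does not change. *)
pose a0 := Num.min a x - 1.
have a0a : a0 <= a by rewrite /a0; have := ge_min a a x; rewrite lexx /=; lra.
have a0x : a0 < x by rewrite /a0; have := ge_min x a x; rewrite lexx orbT /=; lra.
have -> : V = (fun y => \int[lebesgue]_(t in `]a0, y]) T t).
  apply/funext => y; have z (u v : R) : v <= a -> \int[lebesgue]_(t in `]u, v]) T t = 0.
    by move=> va; apply: Rintegral_oc_eq0 => t _ tv; rewrite Ta// (le_trans tv).
  have [ay|ya] := leP a y.
    rewrite /V; have [||_ ->] := Rintegral_itv_split _ _ (integrable_density a0 a) (integrable_density a y);
      rewrite ?bnd_simp//.
    by rewrite (z a0 a)// add0r.
  by rewrite /V (z a y (ltW ya)) (z a0 y (ltW ya)).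
have x1 : x < x + 1 by rewrite ltrDl.
by have [] := @continuous_FTC1 R T (BRight a0) x (x + 1) x1 (integrable_density _ _) _ cT.
Qed.

Lemma double_integral_left (x : R) : x <= a -> F x = c.
Proof. by move=> xa; rewrite /F Rintegral_oc_empty// addr0. Qed.

Lemma double_integral_right (b x : R) : (forall t, b <= t -> T t = 0) -> V b = 0 ->
  b <= x -> F x = F b.
Proof.
move=> Tb Vb bx; have [E _] := double_integral_increment bx.
move: E; rewrite Vb mulr0 subr0 => /eqP; rewrite subr_eq => /eqP ->.
rewrite -[RHS]add0r; congr (_ + _).
by apply: Rintegral_oc_eq0 => t /ltW bt _; rewrite Tb// mulr0.
Qed.

End double_integral.

Section descending_double_integral.
Context (R : realType) (T : R -> R) (a b C : R) (L : seq R).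
Context (mT : measurable_fun setT T) (TC : forall t, `|T t| <= C).
Context (Ta : forall t, t <= a -> T t = 0) (Tb : forall t, b <= t -> T t = 0).
Context (Tcont : forall t, t \notin L -> {for t, continuous T}).

Let V x := \int[lebesgue]_(t in `]a, x]) T t.
Let c := 2^-1 * \int[lebesgue]_(t in `]a, b]) (t * T t).

(* The constant makes the limits at [-oo] and [+oo] opposite when [T] has integral 0. *)
Definition descent (x : R) : R :=
  2^-1 * (\int[lebesgue]_(t in `]a, b]) (t * T t)) +
  \int[lebesgue]_(t in `]a, x]) ((x - t) * T t).

Lemma descent_ac_derivatives : ac_derivatives descent V T.
Proof. exact: (ac_derivatives_double_integral _ mT TC Ta). Qed.

Lemma descent_second_derivative (x : R) : x \notin L -> descent^`(2)%classic x = T x.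
Proof. by move=> xL; apply: (derive1n2_double_integral _ mT TC Ta); exact: Tcont. Qed.

Lemma measurable_descent_second_derivative : measurable_fun setT descent^`(2)%classic.
Proof. exact: measurable_fun_finite_change mT descent_second_derivative. Qed.

Lemma Ls_norm_descent (s : \bar R) : (1 <= s)%E ->
  Ls_norm s descent^`(2)%classic = Ls_norm s T.
Proof.
move=> s1; apply: Ls_norm_ae_eq => //; first exact: measurable_descent_second_derivative.
exact: ae_finite_change descent_second_derivative.
Qed.

Context (Vb : \int[lebesgue]_(t in `]a, b]) T t = 0).
Context (V0 : forall x, \int[lebesgue]_(t in `]a, x]) T t <= 0).

Lemma descent_left (x : R) : x <= a -> descent x = c.
Proof. exact: (double_integral_left T c). Qed.

(** At [b] the double integral is [c] plus [b] times the integral of [T], which is 0, minus the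
    first moment, which is [2 * c]. Beyond [b] it is constant. *)
Lemma descent_right (x : R) : b <= x -> descent x = - c.
Proof.
move=> bx; rewrite /descent (double_integral_right _ mT TC Ta Tb Vb bx) /=.
rewrite [LHS](double_integralE a c mT TC b) /= Vb mulr0 sub0r /c; set w := Rintegral _ _ _.
by field.
Qed.

Lemma descent_nonincreasing (x y : R) : x <= y -> descent y <= descent x.
Proof.
move=> xy; have [dF cV _ _] := descent_ac_derivatives.
have [z _ E] : exists2 z : R, z \in `[x, y] & descent y - descent x = V z * (y - x).
  apply: MVT_segment => //; apply: continuous_subspaceT => z.
  exact: is_derive_continuous (dF z).
by rewrite -subr_le0 E mulr_le0_ge0 ?subr_ge0// V0.
Qed.

Lemma descent_bounded (x : R) : `|descent x| <= c.
Proof.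
rewrite ler_norml; apply/andP; split.
  have [xb|/ltW bx] := leP x b; last by rewrite descent_right.
  by rewrite -(descent_right (lexx b)); exact: descent_nonincreasing.
have [ax|/ltW xa] := leP a x; last by rewrite descent_left.
by rewrite -(descent_left (lexx a)); exact: descent_nonincreasing.
Qed.

Lemma descent_L2infty (s : \bar R) : (1 <= s)%E -> (Ls_norm s T < +oo)%E ->
  L2infty s descent.
Proof.
move=> s1 sT; have fgG := descent_ac_derivatives; split.
- apply/andP; split; rewrite inE/=.
    exact: measurable_antiderivative fgG.
  apply: (@le_lt_trans _ _ c%:E); last exact: ltry.
  by apply/Ls_norm_pinfty_le; apply: aeW => t; rewrite lee_fin descent_bounded.
- by move=> x; exact: (derivable_double_integral mT TC Ta).
- rewrite [X in locally_abs_continuous X](derive1_double_integral _ mT TC Ta).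
  apply: (@lipschitz_locally_ac _ C) => x y.
  exact: (integral_density_lipschitz mT TC Ta).
- apply/andP; split; rewrite inE/=; first exact: measurable_descent_second_derivative.
  by rewrite /finite_norm -/(Ls_norm _ _) Ls_norm_descent.
Qed.

Lemma descent_derivative_ge (x : R) : a <= b -> - (C * (b - a)) <= V x.
Proof.
move=> ab; have C0 : 0 <= C by exact: le_trans (normr_ge0 _) (TC a).
have Cab : 0 <= C * (b - a) by rewrite mulr_ge0// subr_ge0.
have Vleft y : y <= a -> V y = 0 by exact: Rintegral_oc_empty.
have [xa|/ltW ax] := leP x a; first by rewrite Vleft// oppr_le0.
have mid y : a <= y -> y <= b -> - (C * (b - a)) <= V y.
  move=> ay yb; have := integral_density_lipschitz mT TC Ta ay.
  rewrite -/(V y) -/(V a) (Vleft a)// subr0 ler_norml => /andP[+ _]; apply: le_trans.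
  by rewrite lerN2 ler_wpM2l// lerB.
have [xb|/ltW bx] := leP x b; first exact: mid.
have -> : V x = V b; last exact: mid.
apply/eqP; rewrite -subr_eq0 [X in X == _](integral_density mT TC Ta bx); apply/eqP.
by apply: Rintegral_oc_eq0 => t /ltW bt _; rewrite Tb.
Qed.

(** Mean value theorem, the derivative lying between [- K] and 0. [K] is a parameter because the
    smoothed ramp needs its exact slope 1/2, where [descent_derivative_ge] gives only a crude
    bound. *)
Lemma descent_lipschitz (K : R) : (forall x, - K <= V x) -> forall x y,
  `|descent x - descent y| <= K * `|x - y|.
Proof.
move=> VK; have [dF _ _ _] := descent_ac_derivatives.
suff le x y : x <= y -> `|descent x - descent y| <= K * `|x - y|.
  move=> x y; have [/le//|/ltW /le] := leP x y.
  by rewrite distrC [in leRHS]distrC.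
move=> xy; have [z _ E] : exists2 z : R, z \in `[x, y] & descent y - descent x = V z * (y - x).
  apply: MVT_segment => //; apply: continuous_subspaceT => z.
  exact: is_derive_continuous (dF z).
rewrite distrC E normrM [in leRHS]distrC ler_wpM2r// ler_norml VK.
have := V0 z; have := VK z; rewrite -/(V z); lra.
Qed.

End descending_double_integral.

(** * The function tau *)

Lemma rho_continuous (R : realType) (k : R) : k < 1 -> continuous (rho k).
Proof.
move=> k1 x; have k10 : 0 < 1 - k by rewrite subr_gt0.
have [x0|x0|->] := ltgtP x 0.
- have near0 : \near x, cst 0 x = rho k x.
    near=> y; rewrite /rho ifF//; apply/negbTE; rewrite -leNgt ltW//.
    by near: y; exact: lt_nbhsl.
  rewrite /continuous_at /rho ltNge (ltW x0)/=.
  apply: cvg_trans (near_eq_cvg near0) _; exact: cvg_cst.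
- have near0 : \near x, x `^ (1 - k) = rho k x.
    near=> y; rewrite /rho ifT//.
    by near: y; exact: lt_nbhsr.
  rewrite /continuous_at {2}/rho x0/=.
  apply: cvg_trans (near_eq_cvg near0) _; exact: powR_continuous.
- apply/cvgrPdist_lt => e e0; near=> y.
  have -> : rho k 0 = 0 by rewrite /rho ltxx.
  rewrite /rho sub0r normrN; case: ifPn => y0; last by rewrite normr0.
  rewrite ger0_norm ?powR_ge0//.
  have ye : y < e `^ (1 - k)^-1 by near: y; apply: lt_nbhsl; rewrite powR_gt0.
  have eE : e = (e `^ (1 - k)^-1) `^ (1 - k).
    by rewrite -powRrM mulVf ?gt_eqF// powRr1// ltW.
  by rewrite [ltRHS]eE; apply: gt0_ltr_powR => //; rewrite nnegrE ?powR_ge0// ltW.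
Unshelve. all: by end_near. Qed.

Lemma rho_ge0 (R : realType) (k x : R) : 0 <= rho k x.
Proof. by rewrite /rho; case: ifP => // _; exact: powR_ge0. Qed.

Lemma rho_le1 (R : realType) (k x : R) : k < 1 -> x <= 1 -> rho k x <= 1.
Proof.
move=> k1 x1; rewrite /rho; case: ifPn => // x0.
have e1 : 1 = 1 `^ (1 - k) :> R by rewrite powR1.
by rewrite [leRHS]e1; apply: ge0_ler_powR; rewrite ?nnegrE ?subr_ge0 ?(ltW x0) ?(ltW k1).
Qed.

Section tau.
Context (R : realType) (k p : R) (k0 : 0 < k) (k1 : k < 1) (p0 : 0 <= p).

Local Ltac plra := have := p0; have := k0; have := k1; lra.

(** The formula of [tau] on [-p, 1] without the cut-offs at the ends, hence derivable at every
    positive point, 1 included. *)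
Definition gap (t : R) : R := rho k t - (t + p) / (1 + p).

Lemma onep_gt0 : 0 < 1 + p. Proof. by rewrite ltr_wpDr. Qed.

Lemma gap_negp : gap (- p) = 0.
Proof. by rewrite /gap /rho ltrNr oppr0 ltNge p0/= addNr mul0r subrr. Qed.

Lemma gap1 : gap 1 = 0.
Proof. by rewrite /gap /rho ltr01 powR1 divff ?subrr// gt_eqF// onep_gt0. Qed.

Lemma integral_omega_left (x : R) : x <= - p ->
  (@lebesgue R).-integrable `]-oo, x] (EFin \o omega k p) /\
  \int[lebesgue]_(t in `]-oo, x]) omega k p t = 0.
Proof.
move=> xp; have z t : t \in `]-oo, x]%classic -> omega k p t = 0.
  by rewrite inE/= in_itv/= => tx; rewrite /omega (le_trans tx xp).
split.
  by apply: eq_integrable (integrable0 _ _) => // t /z /= ->.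
transitivity (\int[lebesgue]_(t in `]-oo, x]) (0 : R)); first exact: eq_Rintegral.
by rewrite Rintegral_cst// mul0r.
Qed.

Lemma integral_omega_mid (x : R) : - p <= x -> x < 1 ->
  (@lebesgue R).-integrable `]-oo, x] (EFin \o omega k p) /\
  \int[lebesgue]_(t in `]-oo, x]) omega k p t = (x + p) / (1 + p).
Proof.
move=> px x1; have [i1 E1] := integral_omega_left (lexx _).
have z t : t \in `]- p, x]%classic -> omega k p t = (1 + p)^-1.
  rewrite inE/= in_itv/= => /andP[pt tx]; rewrite /omega leNgt pt/=.
  by rewrite (le_lt_trans tx x1).
have i2 : (@lebesgue R).-integrable `]- p, x] (EFin \o omega k p).
  by apply: eq_integrable (integrable_cst_oc (1 + p)^-1 _ _) => // t /z /= ->.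
have [||i ->] := Rintegral_itv_split _ _ i1 i2; rewrite ?bnd_simp//.
split => //; rewrite E1 add0r.
transitivity (\int[lebesgue]_(t in `]- p, x]) (1 + p)^-1); first exact: eq_Rintegral.
by rewrite Rintegral_cst_oc// opprK mulrC.
Qed.

Lemma integral_omega_right (x : R) : 1 <= x ->
  \int[lebesgue]_(t in `]-oo, x]) omega k p t = x `^ (1 - k).
Proof.
move=> x1; have p11 : - p <= 1 by plra.
have [i1 E1] := integral_omega_left (lexx _).
have z t : t \in `]- p, 1[%classic -> omega k p t = (1 + p)^-1.
  by rewrite inE/= in_itv/= => /andP[pt tx]; rewrite /omega leNgt pt/= tx.
have ic := integrable_cst_oc (1 + p)^-1 (- p) 1.
have i2 : (@lebesgue R).-integrable `]- p, 1[ (EFin \o omega k p).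
  apply: (@eq_integrable _ _ _ _ _ _ (EFin \o (fun=> (1 + p)^-1))) => //.
    by move=> t /z /= ->.
  by apply: integrableS ic => //; exact: subset_itv_oo_oc.
have E2 : \int[lebesgue]_(t in `]- p, 1[) omega k p t = 1.
  transitivity (\int[lebesgue]_(t in `]- p, 1[) (1 + p)^-1); first exact: eq_Rintegral.
  rewrite Rintegral_itv_bndo_bndc; last first.
    by apply: integrableS ic => //; exact: subset_itv_oo_oc.
  by rewrite Rintegral_cst_oc// opprK mulVf// gt_eqF// onep_gt0.
have k10 : 1 - k != 0 by rewrite gt_eqF// subr_gt0.
have [||i3 E3] := @FTC_segment R (fun t : R => t `^ (1 - k)) (fun t => (1 - k) * t `^ (- k)) 1 x x1.
- move=> t t1 _; have t0 : 0 < t by exact: lt_le_trans t1.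
  by have := is_derive1_powR (1 - k) t0; rewrite (_ : 1 - k - 1 = - k)//; ring.
- move=> t t1 _; have t0 : 0 < t by exact: lt_le_trans t1.
  by apply: cvgM; [exact: cvg_cst|exact: powR_continuous].
have z3 t : t \in `[1, x]%classic -> omega k p t = (1 - k) * t `^ (- k).
  rewrite inE/= in_itv/= => /andP[t1 tx]; rewrite /omega.
  have pt : - p < t by plra.
  by rewrite leNgt pt/= ltNge t1.
have i4 : (@lebesgue R).-integrable `[1, x] (EFin \o omega k p).
  by apply: eq_integrable i3 => // t /z3 /= ->.
have [||i5 E5] := Rintegral_itv_split _ _ i2 i4; rewrite ?bnd_simp//; first plra.
have [||i6 E6] := Rintegral_itv_split _ _ i1 i5; rewrite ?bnd_simp//; first plra.
rewrite E6 E1 E5 E2 add0r.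
transitivity (1 + \int[lebesgue]_(t in `[1, x]) ((1 - k) * t `^ (- k))).
  by congr (_ + _); exact: eq_Rintegral.
by rewrite E3 powR1 addrC subrK.
Qed.

(** [gap] vanishes at [- p] and at 1, and [tau] vanishes outside [-p, 1], so clamping the argument
    to this interval reproduces [tau]. Continuity in [x], and later in [p], is read off from this
    form. *)
Lemma tauE (x : R) : tau k p x = gap (Num.max (Num.min x 1) (- p)).
Proof.
rewrite /tau; have [x1|x1] := leP 1 x.
  rewrite integral_omega_right// /rho (lt_le_trans ltr01 x1) subrr.
  by rewrite max_l ?gap1//; plra.
have [xp|xp] := leP x (- p).
  rewrite (integral_omega_left xp).2 subr0 gap_negp /rho ifF//.
  by apply/negbTE; rewrite -leNgt; plra.
by rewrite (integral_omega_mid (ltW xp) x1).2.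
Qed.

Lemma tau_left (x : R) : x <= - p -> tau k p x = 0.
Proof.
by move=> xp; rewrite tauE min_l ?max_r ?gap_negp//; plra.
Qed.

Lemma tau_right (x : R) : 1 <= x -> tau k p x = 0.
Proof. by move=> x1; rewrite tauE min_r// max_l ?gap1//; plra. Qed.

Lemma tau_mid (x : R) : - p <= x -> x <= 1 -> tau k p x = gap x.
Proof. by move=> px x1; rewrite tauE min_l// max_l. Qed.

Lemma gap_continuous : continuous gap.
Proof.
move=> x; apply: cvgB; first exact: rho_continuous.
by apply: cvgM; [apply: cvgD; [exact: cvg_id|exact: cvg_cst]|exact: cvg_cst].
Qed.

Lemma tau_continuous : continuous (tau k p).
Proof.
rewrite (_ : tau k p = gap \o (fun x => Num.max (Num.min x 1) (- p))); last first.
  by apply/funext => x; rewrite tauE.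
move=> x; apply: continuous_comp; last exact: gap_continuous.
by apply: continuous_max; [apply: continuous_min; [exact: cvg_id|exact: cvg_cst]|exact: cvg_cst].
Qed.

Lemma tau_le1 (x : R) : `|tau k p x| <= 1.
Proof.
have [x1|x1] := leP 1 x; first by rewrite tau_right// normr0.
have [xp|xp] := leP x (- p); first by rewrite tau_left// normr0.
rewrite tau_mid ?(ltW xp) ?(ltW x1)// /gap.
have h1 := rho_ge0 k x; have h2 := rho_le1 k1 (ltW x1).
have h3 : 0 <= (x + p) / (1 + p) by rewrite divr_ge0 ?(ltW onep_gt0)//; plra.
have h4 : (x + p) / (1 + p) <= 1 by rewrite ler_pdivrMr ?onep_gt0//; plra.
by rewrite ler_norml; apply/andP; split; plra.
Qed.

(* The critical point of [gap]. *)
Definition peak : R := ((1 - k) * (1 + p)) `^ k^-1.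

Lemma peak_gt0 : 0 < peak.
Proof. by rewrite powR_gt0// mulr_gt0 ?subr_gt0 ?onep_gt0. Qed.

Lemma peak_powR : peak `^ k = (1 - k) * (1 + p).
Proof.
rewrite -powRrM mulVf ?gt_eqF// powRr1// mulr_ge0// ?(ltW onep_gt0)//.
by rewrite subr_ge0 ltW.
Qed.

Lemma is_derive_gap (x : R) : 0 < x -> is_derive x 1 gap ((1 - k) * x `^ (- k) - (1 + p)^-1).
Proof.
move=> x0.
have d1 : is_derive x 1 (fun t : R => t `^ (1 - k)) ((1 - k) * x `^ (- k)).
  by have := is_derive1_powR (1 - k) x0; rewrite (_ : 1 - k - 1 = - k)//; ring.
have d2 : is_derive x 1 (fun t : R => (t + p) / (1 + p)) (1 + p)^-1.
  have := @is_derive_affine R id (fun=> 1) (1 + p)^-1 (p / (1 + p)) (fun y => is_derive_id y 1) x.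
  rewrite mulr1 (_ : (fun t => _) = (fun t : R => (t + p) / (1 + p)))//.
  by apply/funext => t /=; rewrite mulrDl mulrC.
apply: (@near_eq_is_derive _ _ _ (fun t : R => t `^ (1 - k) - (t + p) / (1 + p))).
  near=> t; rewrite /gap /rho ifT//.
  by near: t; exact: lt_nbhsr.

Unshelve. all: by end_near. Qed.

Lemma gap_increasing (u v : R) : 0 <= u -> u < v -> v <= peak -> gap u < gap v.
Proof.
move=> u0 uv vp.
have [||c] := @MVT R gap (fun x => (1 - k) * x `^ (- k) - (1 + p)^-1) u v uv.
- move=> x; rewrite in_itv/= => /andP[ux _]; apply: is_derive_gap.
  exact: le_lt_trans ux.
- exact: continuous_subspaceT gap_continuous.
rewrite in_itv/= => /andP[uc cv] E.
have c0 := le_lt_trans u0 uc.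
rewrite -subr_gt0 E mulr_gt0 ?subr_gt0// powRN.
rewrite ltr_pdivlMr ?powR_gt0// mulrC ltr_pdivrMr ?onep_gt0// -peak_powR.
by apply: gt0_ltr_powR; rewrite ?nnegrE ?(ltW c0) ?(ltW peak_gt0)//; exact: lt_le_trans vp.
Qed.

Lemma gap_decreasing (u v : R) : peak <= u -> u < v -> gap v < gap u.
Proof.
move=> pu uv; have u0 := lt_le_trans peak_gt0 pu.
have [||c] := @MVT R gap (fun x => (1 - k) * x `^ (- k) - (1 + p)^-1) u v uv.
- move=> x; rewrite in_itv/= => /andP[ux _]; apply: is_derive_gap.
  exact: lt_trans ux.
- exact: continuous_subspaceT gap_continuous.
rewrite in_itv/= => /andP[uc cv] E.
have c0 := lt_trans u0 uc.
rewrite -subr_lt0 E pmulr_llt0 ?subr_gt0// subr_lt0 powRN.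
rewrite ltr_pdivrMr ?powR_gt0// mulrC ltr_pdivlMr ?onep_gt0// -peak_powR.
by apply: gt0_ltr_powR; rewrite ?nnegrE ?(ltW c0) ?(ltW peak_gt0)//; exact: le_lt_trans uc.
Qed.

Context (pk : p <= k / (1 - k)).

(** The bound on [p] says exactly that [(1 - k) * (1 + p) <= 1]. *)
Lemma peak_le1 : peak <= 1.
Proof.
have k10 : 0 < 1 - k by rewrite subr_gt0.
have h : (1 - k) * (1 + p) <= 1.
  by move: pk; rewrite ler_pdivlMr// => pk'; rewrite mulrDr mulr1 -lerBrDl; plra.
have e1 : 1 = 1 `^ k^-1 :> R by rewrite powR1.
rewrite /peak [leRHS]e1; apply: ge0_ler_powR; rewrite ?nnegrE ?invr_ge0 ?(ltW k0)//.
by rewrite mulr_ge0 ?(ltW k10) ?(ltW onep_gt0).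
Qed.

(** Up to 0 the function is a decreasing affine one that starts from 0 at [- p]; then it rises up to
    [peak] and falls to its value 0 at 1. So it is nonnegative at [peak], and the sign changes once,
    between 0 and [peak]. *)
Lemma gap_sign_change : exists x0 : R, [/\ 0 <= x0, x0 <= peak,
  forall t, - p < t -> t < x0 -> gap t < 0 & forall t, x0 < t -> t < 1 -> 0 < gap t].
Proof.
have g0 : gap 0 = - (p / (1 + p)) by rewrite /gap /rho ltxx !add0r.
have g0' : gap 0 <= 0 by rewrite g0 oppr_le0 divr_ge0 ?(ltW onep_gt0).
have gp : 0 <= gap peak.
  have := peak_le1; rewrite le_eqVlt => /predU1P[->|p1]; first by rewrite gap1.
  by rewrite -gap1; apply/ltW/gap_decreasing.
have [||x0] := @IVT R gap 0 peak 0 (ltW peak_gt0).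
- exact: continuous_subspaceT gap_continuous.
- by rewrite ge_min g0' le_max gp orbT.
rewrite in_itv/= => /andP[x00 x0p] gx0.
exists x0; split => //.
- move=> t pt tx0; have [t0|t0] := leP 0 t.
    by rewrite -gx0; exact: gap_increasing.
  have tn : (0 < t) = false by rewrite ltNge (ltW t0).
  rewrite /gap /rho tn sub0r oppr_lt0 divr_gt0 ?onep_gt0//.
  by rewrite -ltrBlDr sub0r.
- move=> t x0t t1; have [tp|pt] := leP t peak.
    by rewrite -gx0; exact: gap_increasing.
  by rewrite -gap1; exact: gap_decreasing (ltW pt) t1.
Qed.

End tau.

(** * The case s > 1 *)

(** The real exponent [q] covers finite and infinite [s] alike, being 1 for [s = +oo]. The relation
    [r * (q - 1) = q] is what gives the power [s] of [tau_pow] and the power [s'] of [tau] the same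
    absolute value. *)
Lemma hoelder_conjugate_bounds (R : realType) (s : \bar R) : (1 < s)%E ->
  let q := fine (hoelder_conjugate s) in
  [/\ 1 <= q, fine s^-1%E = 1 - q^-1 &
      forall r : R, s = r%:E -> 0 < r /\ r * (q - 1) = q].
Proof.
case: s => [r|_|//] /=.
- rewrite lte_fin => r1; have r0 : 0 < r by exact: lt_trans r1.
  have rr : 0 < r - 1 by rewrite subr_gt0.
  have -> : fine (hoelder_conjugate r%:E) = r / (r - 1).
    by rewrite /hoelder_conjugate /= eqe gt_eqF// -EFinB inver gt_eqF.
  rewrite inver gt_eqF//=; split.
  + by rewrite ler_pdivlMr// mul1r gerBl.
  + by field; rewrite !gt_eqF.
  + by move=> _ [<-]; split => //; field; rewrite gt_eqF.
- by rewrite ?invey ?invr1 ?subrr; split => // r.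
Qed.

(** The map from g to g_(s'), with [e = s' - 1]. For [e = 0] it is the sign, which jumps at 0, while
    the power 0 of 0 is 1; hence the hypotheses [y != 0] and [r * e != 0] below. *)
Definition sgpow (R : realType) (e y : R) : R := `|y| `^ e * Num.sg y.

Lemma sgpow0 (R : realType) (e : R) : sgpow e 0 = 0.
Proof. by rewrite /sgpow sgr0 mulr0. Qed.

Lemma sgpow_gt0 (R : realType) (e y : R) : 0 < y -> 0 < sgpow e y.
Proof. by move=> y0; rewrite /sgpow gtr0_sg// mulr1 powR_gt0// normr_gt0 gt_eqF. Qed.

Lemma sgpow_lt0 (R : realType) (e y : R) : y < 0 -> sgpow e y < 0.
Proof.
move=> y0; rewrite /sgpow ltr0_sg// mulrN1 oppr_lt0 powR_gt0// normr_gt0 lt_eqF//.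
Qed.

Lemma normr_sgpow (R : realType) (e y : R) : y != 0 -> `|sgpow e y| = `|y| `^ e.
Proof.
by move=> y0; rewrite /sgpow normrM normr_sg y0 mulr1 ger0_norm// powR_ge0.
Qed.

Lemma sgpow_le1 (R : realType) (e y : R) : 0 <= e -> `|y| <= 1 -> `|sgpow e y| <= 1.
Proof.
move=> e0 y1; have [->|y0] := eqVneq y 0; first by rewrite sgpow0 normr0.
have e1 : 1 = 1 `^ e :> R by rewrite powR1.
by rewrite normr_sgpow// [leRHS]e1; apply: ge0_ler_powR; rewrite ?nnegrE.
Qed.

Lemma mulr_sgpow (R : realType) (e y : R) : 0 <= e -> y * sgpow e y = `|y| `^ (e + 1).
Proof.
move=> e0; have [->|y0] := eqVneq y 0.
  by rewrite mul0r normr0 powR0// gt_eqF// ltr_wpDl.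
rewrite powRD ?normr_eq0 ?y0 ?implybT// powRr1// /sgpow mulrCA; congr (_ * _).
by rewrite mulrC -normrEsg.
Qed.

Lemma normr_sgpow_powR (R : realType) (e r y : R) : r != 0 -> r * e != 0 ->
  `|sgpow e y| `^ r = `|y| `^ (r * e).
Proof.
move=> r0 re0; have [->|y0] := eqVneq y 0.
  by rewrite sgpow0 normr0 !powR0.
by rewrite normr_sgpow// -powRrM mulrC.
Qed.

Lemma measurable_sgpow (R : realType) (e : R) : measurable_fun setT (@sgpow R e).
Proof.
have m1 : measurable_fun setT (fun y : R => `|y| `^ e).
  apply: (@measurableT_comp _ _ _ _ _ _ (@powR R ^~ e)) => //.
have m2 : measurable_fun setT (@Num.sg R).
  have -> : @Num.sg R = (fun y => if 0 < y then 1 else if y < 0 then -1 else 0).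
    by apply/funext => y; case: sgrP.
  have p1 : measurable_fun setT (fun y : R => 0 < y) by exact: measurable_fun_ltr.
  have p2 : measurable_fun setT (fun y : R => y < 0) by exact: measurable_fun_ltr.
  by apply: measurable_fun_ifT => //; exact: measurable_fun_ifT.
exact: measurable_funM.
Qed.

Lemma sgpow_continuous (R : realType) (e y : R) : y != 0 ->
  {for y, continuous (@sgpow R e)}.
Proof.
move=> y0; have n0 : 0 < `|y| by rewrite normr_gt0.
have cn : {for y, continuous (fun z : R => `|z| `^ e)}.
  apply: (@continuous_comp _ _ _ (fun z : R => `|z|) (fun t : R => t `^ e)).
    exact: norm_continuous.
  exact: powR_continuous.
have nr : \forall z \near y, `|z| `^ e * Num.sg y = sgpow e z.
  have [yn|yp|/eqP] := ltgtP y 0; last by rewrite (negbTE y0).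
    apply: filterS (lt_nbhsl yn) => z z0.
    by rewrite /sgpow !ltr0_sg.
  apply: filterS (lt_nbhsr yp) => z z0.
  by rewrite /sgpow !gtr0_sg.
rewrite /prop_for /continuous_at -(nbhs_singleton nr).
apply: cvg_trans (near_eq_cvg nr) _.
by apply: cvgM; [exact: cn|exact: cvg_cst].
Qed.

Lemma integral_gt0 (R : realType) (u : R -> R) (a b t0 : R) : measurable_fun setT u ->
  (@lebesgue R).-integrable `]a, b] (EFin \o u) ->
  (forall t, a < t -> t <= b -> 0 <= u t) ->
  a < t0 -> t0 < b -> {for t0, continuous u} -> 0 < u t0 ->
  0 < \int[lebesgue]_(t in `]a, b]) u t.
Proof.
move=> mu iu u0 at0 t0b cu ut0.
have [e e0 eP] : exists2 e : R, 0 < e & forall t, `|t0 - t| < e -> u t0 / 2 < u t.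
  have u2 : 0 < u t0 / 2 by rewrite divr_gt0.
  move/cvgrPdist_lt : cu => /(_ _ u2)[e /= e0 ue].
  exists e => // t /ue; rewrite ltr_norml => /andP[_]; lra.
pose d := Num.min (e / 2) (Num.min (t0 - a) (b - t0)).
have d0 : 0 < d by rewrite !lt_min divr_gt0//= !subr_gt0 at0.
have de : d < e by apply: (@le_lt_trans _ _ (e / 2)); [rewrite ge_min lexx|lra].
have da : a <= t0 - d.
  have : d <= t0 - a by rewrite !ge_min lexx !orbT.
  by lra.
have db : t0 + d <= b.
  have : d <= b - t0 by rewrite !ge_min lexx !orbT.
  by lra.
have dd : t0 - d <= t0 + d by lra.
have iS (x y : R) : a <= x -> y <= b ->
    (@lebesgue R).-integrable `]x, y] (EFin \o u).
  move=> ax yb; apply: integrableS iu => // t /=; rewrite !in_itv/= => /andP[xt ty].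
  by rewrite (le_lt_trans ax xt) (le_trans ty yb).
have [||i1 ->] := Rintegral_itv_split _ _ (iS a (t0 - d) (lexx _) (le_trans dd db))
  (iS (t0 - d) b da (lexx _)); rewrite ?bnd_simp//; first exact: le_trans dd db.
have [||i2 ->] := Rintegral_itv_split _ _ (iS (t0 - d) (t0 + d) da db)
  (iS (t0 + d) b (le_trans da dd) (lexx _)); rewrite ?bnd_simp//.
have p (x y : R) : a <= x -> y <= b -> 0 <= \int[lebesgue]_(t in `]x, y]) u t.
  move=> ax yb; apply: Rintegral_ge0 => t /=; rewrite in_itv/= => /andP[xt ty].
  by apply: u0; [exact: le_lt_trans xt|exact: le_trans yb].
have mid : u t0 / 2 * (2 * d) <= \int[lebesgue]_(t in `]t0 - d, t0 + d]) u t.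
  have -> : 2 * d = t0 + d - (t0 - d) by ring.
  rewrite -Rintegral_cst_oc//; apply: le_Rintegral => //.
  - exact: integrable_cst_oc.
  - exact: iS.
  - move=> t /=; rewrite in_itv/= => /andP[h1 h2]; apply/ltW/eP.
    by rewrite ltr_norml; apply/andP; split; lra.
have mid0 : 0 < u t0 / 2 * (2 * d) by rewrite !mulr_gt0// divr_gt0.
apply: (lt_le_trans mid0); apply: (le_trans mid).
rewrite -[leLHS]add0r; apply: lerD; first exact: p a (t0 - d) (lexx _) (le_trans dd db).
by rewrite -[leLHS]addr0; apply: lerD => //; exact: p (t0 + d) b (le_trans da dd) (lexx _).
Qed.

Lemma integral_oc_support (R : realType) (u : R -> R) (a b : R) :
  (forall x y, (@lebesgue R).-integrable `]x, y] (EFin \o u)) ->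
  (forall t, t <= a -> u t = 0) -> (forall t, b < t -> u t = 0) ->
  (\int[lebesgue]_t (u t)%:E = (\int[lebesgue]_(t in `]a, b]) u t)%:E)%E.
Proof.
move=> iu ua ub; rewrite /Rintegral fineK; last exact: integrable_fin_num.
rewrite [RHS]integral_mkcond; apply: eq_integral => t _; rewrite patchE.
case: ifPn => //; rewrite notin_setE/= in_itv/= => /negP; rewrite negb_and -leNgt.
case/orP=> [ta|bt]; first by rewrite ua.
by move: bt; rewrite -ltNge => /ub ->.
Qed.

Section dual_function.
Context (R : realType) (k p : R) (s : \bar R).
Context (k0 : 0 < k) (k1 : k < 1) (p0 : 0 <= p) (s1 : (1 < s)%E).

Let q := fine (hoelder_conjugate s).

(** The power [q] of the L_q norm of [tau]; the constant in Hoelder's inequality is its power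
    [q^-1]. *)
Definition tau_moment : R :=
  \int[lebesgue]_(t in `]- p, 1]) (`|tau k p t| `^ q).

Let q1 : 1 <= q. Proof. by have [] := hoelder_conjugate_bounds s1. Qed.

Let q0 : 0 < q. Proof. exact: lt_le_trans q1. Qed.

Let e0 : 0 <= q - 1. Proof. by rewrite subr_ge0. Qed.

Lemma measurable_tau : measurable_fun setT (tau k p).
Proof. by apply: continuous_measurable_fun; exact: tau_continuous. Qed.

Lemma measurable_tau_pow : measurable_fun setT (tau_pow k s p).
Proof.
exact: (measurableT_comp (@measurable_sgpow R (q - 1)) measurable_tau).
Qed.

Lemma tau_pow_le1 (t : R) : `|tau_pow k s p t| <= 1.
Proof. by apply: sgpow_le1 => //; exact: tau_le1. Qed.

Lemma tau_pow_left (t : R) : t <= - p -> tau_pow k s p t = 0.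
Proof. by move=> tp; rewrite /tau_pow tau_left// sgr0 mulr0. Qed.

Lemma tau_pow_right (t : R) : 1 <= t -> tau_pow k s p t = 0.
Proof. by move=> tp; rewrite /tau_pow tau_right// sgr0 mulr0. Qed.

Lemma tau_pow_continuous (t : R) : tau k p t != 0 ->
  {for t, continuous (tau_pow k s p)}.
Proof.
move=> t0; apply: (@continuous_comp _ _ _ (tau k p) (@sgpow R (q - 1))).
  exact: tau_continuous.
exact: sgpow_continuous.
Qed.

Lemma measurable_tau_powR : measurable_fun setT (fun t => `|tau k p t| `^ q).
Proof. by apply/measurable_EFinP; apply: measurable_normr_powR measurable_tau. Qed.

Lemma tau_powR_le1 (t : R) : `| `|tau k p t| `^ q| <= 1.
Proof.
rewrite ger0_norm ?powR_ge0//.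
have e1 : 1 = 1 `^ q :> R by rewrite powR1.
by rewrite [leRHS]e1; apply: ge0_ler_powR; rewrite ?nnegrE// ?(ltW q0)// tau_le1.
Qed.

Lemma integral_tau_powR :
  (\int[lebesgue]_t (`|tau k p t| `^ q)%:E = tau_moment%:E)%E.
Proof.
have z : `|0 : R| `^ q = 0 by rewrite normr0 powR0// gt_eqF.
apply: integral_oc_support => [x y|t tp|t /ltW t1].
- exact: (bounded_integrable_oc measurable_tau_powR (fun t _ _ => tau_powR_le1 t)).1.
- by rewrite tau_left.
- by rewrite tau_right.
Qed.

(** For [p = 0] the function is [t^(1 - k) - t] on [0, 1], positive at 1/2; for [p > 0] its value at
    0 is [- p / (1 + p)]. *)
Lemma gap_neq0 : exists t0 : R, [/\ - p < t0, t0 < 1 & tau k p t0 != 0].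
Proof.
have p0' := p0; have p1 : 0 < 1 + p by lra.
have [p00|pp] := eqVneq p 0.
  exists 2^-1; split; [lra|lra|].
  have [h0 h1] : (- p <= 2^-1 /\ 2^-1 <= 1 :> R)%R by split; lra.
  rewrite tau_mid// /gap /rho p00 !addr0 divr1 invr_gt0 ltr0n/=.
  rewrite gt_eqF// subr_gt0 -[ltLHS]powRr1 ?invr_ge0//.
  have l2 : ln (2^-1 : R) < 0 by apply: ln_lt0; apply/andP; split; lra.
  rewrite /powR gt_eqF ?invr_gt0// ltr_expR ltr_nM2r//.
  by have := k0; lra.
have {}pp : 0 < p by rewrite lt_neqAle eq_sym pp.
exists 0; split; [lra|lra|].
have h0 : - p <= 0 by lra.
rewrite tau_mid// /gap /rho ltxx sub0r add0r oppr_eq0.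
by rewrite mulf_neq0// ?invr_eq0 gt_eqF.
Qed.

Lemma tau_moment_gt0 : 0 < tau_moment.
Proof.
have [t0 [pt t1 tau0]] := gap_neq0.
apply: (@integral_gt0 _ (fun t => `|tau k p t| `^ q) _ _ t0) => //.
- exact: measurable_tau_powR.
- exact: (bounded_integrable_oc measurable_tau_powR (fun t _ _ => tau_powR_le1 t)).1.
- apply: (@continuous_comp _ _ _ (fun t : R => `|tau k p t|) (fun t : R => t `^ q)).
    apply: (@continuous_comp _ _ _ (tau k p) (fun t : R => `|t|)).
      exact: tau_continuous.
    exact: norm_continuous.
  by apply: powR_continuous; rewrite normr_gt0.
- by rewrite powR_gt0// normr_gt0.
Qed.

(** For finite [s] the integrand is the power [q] of [|tau|]. For [s = +oo] the function is the sign
    of [tau], of norm 1, and the exponent [1 - q^-1] is 0, so the formula still holds. *)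
Lemma Ls_norm_tau_pow :
  Ls_norm s (tau_pow k s p) = (tau_moment `^ (1 - q^-1))%:E.
Proof.
have [_ sq rq] := hoelder_conjugate_bounds s1.
rewrite -/q in sq rq; rewrite -sq.
have [t0 [_ _ tau0]] := gap_neq0.
have [se|[r sr]] : s = +oo%E \/ exists r, s = r%:E.
  by case: s s1 => [r|_|//]; [right; exists r|left].
- have sq0 : fine s^-1%E = 0 by rewrite se invey.
  have e00 : q - 1 = 0.
    have /eqP := sq; rewrite sq0 eq_sym subr_eq0 => /eqP qi.
    by rewrite -[q]invrK -qi invr1 subrr.
  rewrite sq0 powRr0 se; apply/eqP; rewrite eq_le; apply/andP; split.
    by apply/Ls_norm_pinfty_le; apply: aeW => t /=; rewrite lee_fin -se tau_pow_le1.
  have := Ls_norm_pinfty_ge (tau_pow_continuous tau0); rewrite se; apply: le_trans.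
  by rewrite lee_fin [X in _ <= X](normr_sgpow _ tau0) -se -/q e00 powRr0.
- have [r0 rqq] := rq _ sr.
  rewrite sr Ls_norm_EFin -sr.
  transitivity ((\int[lebesgue]_t (`|tau k p t| `^ q)%:E) `^ r^-1)%E.
    congr (_ `^ _)%E; apply: eq_integral => t _; congr EFin.
    rewrite -[in RHS]rqq -normr_sgpow_powR// ?(gt_eqF r0)// rqq gt_eqF//.
  by rewrite integral_tau_powR poweR_EFin sr inver gt_eqF.
Qed.

Lemma gap_hoelder (G : R -> R) (S : R) : measurable_fun setT G ->
  (Ls_norm s G <= S%:E)%E ->
  `|\int[lebesgue]_(t in `]- p, 1]) ((rho k t - (t + p) / (1 + p)) * G t)|
    <= tau_moment `^ q^-1 * S.
Proof.
move=> mG GS; have [_ sq rq] := hoelder_conjugate_bounds s1.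
rewrite -/q in sq rq.
have mtG : measurable_fun setT (fun t => tau k p t * G t).
  by apply: measurable_funM => //; exact: measurable_tau.
have main : (\int[lebesgue]_t `|tau k p t * G t|%:E <=
    (tau_moment `^ q^-1 * S)%:E)%E.
  have [se|[r sr]] : s = +oo%E \/ exists r, s = r%:E.
    by case: s s1 => [r|_|//]; [right; exists r|left].
  (* For [s = +oo] the estimate is direct: almost everywhere [|tau * G|] is at most [S * |tau|]. *)
  - have q11 : q = 1.
      have /eqP := sq; rewrite se invey/= eq_sym subr_eq0 => /eqP qi.
      by rewrite -[q]invrK -qi invr1.
    have S0 : 0 <= S by rewrite -lee_fin; apply: le_trans (Ls_norm_ge0 _ _) GS.
    rewrite q11 invr1 powRr1 ?(ltW tau_moment_gt0)// mulrC EFinM -integral_tau_powR.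
    rewrite -ge0_integralZl//; last first.
      by apply/measurable_EFinP; exact: measurable_tau_powR.
    move: GS; rewrite se => /Ls_norm_pinfty_le GS.
    apply: ae_ge0_le_integral => //.
    + by apply/measurable_EFinP; exact: measurableT_comp.
    + by move=> t _; rewrite -EFinM lee_fin mulr_ge0// powR_ge0.
    + by apply: measurable_funeM; apply/measurable_EFinP; exact: measurable_tau_powR.
    + apply: filterS GS => t; rewrite !lee_fin => Gt _.
      by rewrite normrM q11 powRr1// mulrC ler_wpM2r.
  - have [r0 rqq] := rq _ sr.
    have qr : q^-1 + r^-1 = 1.
      by move: sq; rewrite sr inver (gt_eqF r0)/= => ->; rewrite addrC subrK.
    have H := hoelder (@lebesgue R) measurable_tau mG q0 r0 qr.
    have E1 : (\int[lebesgue]_t `|tau k p t * G t|%:E =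
        Lnorm (@lebesgue R) 1 (EFin \o (tau k p \* G)%R))%E.
      rewrite [RHS](Ls_norm_EFin 1) invr1 poweRe1; last exact: integral_ge0.
      by apply: eq_integral => t _; rewrite powRr1.
    have E2 : Lnorm (@lebesgue R) q%:E (EFin \o tau k p) = (tau_moment `^ q^-1)%:E.
      by rewrite [LHS](Ls_norm_EFin q) integral_tau_powR poweR_EFin.
    rewrite E1; apply: le_trans H _; rewrite E2 EFinM; apply: lee_pmul => //.
    + by rewrite lee_fin powR_ge0.
    + exact: Ls_norm_ge0.
    + by move: GS; rewrite sr.
have iD : (\int[lebesgue]_(t in `](- p)%R, 1%R]) `|tau k p t * G t|%:E <=
    (tau_moment `^ q^-1 * S)%:E)%E.
  apply: le_trans main; apply: ge0_subset_integral => //.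
  by apply/measurable_EFinP; exact: measurableT_comp.
have -> : \int[lebesgue]_(t in `]- p, 1]) ((rho k t - (t + p) / (1 + p)) * G t) =
    \int[lebesgue]_(t in `]- p, 1]) (tau k p t * G t).
  apply: eq_Rintegral => t; rewrite inE/= in_itv/= => /andP[pt t1].
  by rewrite tau_mid// ltW.
exact: normr_Rintegral_le iD.
Qed.

Lemma integral_gap_tau_pow :
  \int[lebesgue]_(t in `]- p, 1])
    ((rho k t - (t + p) / (1 + p)) * tau_pow k s p t) = tau_moment.
Proof.
apply: eq_Rintegral => t; rewrite inE/= in_itv/= => /andP[pt t1].
rewrite -[_ - _]/(gap k p t) -tau_mid// ?ltW//.
by rewrite [LHS](@mulr_sgpow _ (q - 1))// subrK.
Qed.

Lemma tau_moment_split : tau_moment `^ q^-1 * tau_moment `^ (1 - q^-1) = tau_moment.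
Proof.
rewrite -powRD; last by rewrite (gt_eqF tau_moment_gt0) implybT.
by rewrite addrC subrK powRr1// ltW// tau_moment_gt0.
Qed.

End dual_function.

Section extremal_function.
Context (R : realType) (k p : R) (s : \bar R).
Context (k0 : 0 < k) (k1 : k < 1) (p0 : 0 <= p) (pk : p <= k / (1 - k)).
Context (s1 : (1 < s)%E).
Context (pE : \int[lebesgue]_(t in `[- p, 1]) tau_pow k s p t = 0).

Let T := tau_pow k s p.

Let mT : measurable_fun setT T. Proof. exact: measurable_tau_pow. Qed.

Let TC (t : R) : `|T t| <= 1. Proof. exact: tau_pow_le1. Qed.

Let Tl (t : R) : t <= - p -> T t = 0. Proof. exact: tau_pow_left. Qed.

Let Tr (t : R) : 1 <= t -> T t = 0. Proof. exact: tau_pow_right. Qed.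

Let iT (x y : R) : (@lebesgue R).-integrable `]x, y] (EFin \o T).
Proof. exact: (bounded_integrable_oc mT (fun t _ _ => TC t)).1. Qed.

Let p1 : - p <= 1. Proof. by have := p0; lra. Qed.

Lemma integral_tau_pow : \int[lebesgue]_(t in `]- p, 1]) T t = 0.
Proof. by rewrite -pE; exact: Rintegral_itv_obnd_cbnd. Qed.

Lemma phi_gt1_descent : phi_gt1 k s p = descent T (- p) 1.
Proof.
apply/funext => x; rewrite /phi_gt1 /descent.
have it (h : R -> R) (K y z : R) : measurable_fun setT h ->
    (forall t, y <= t -> t <= z -> `|h t| <= K) ->
    \int[lebesgue]_(t in `[y, z]) (h t * T t) =
    \int[lebesgue]_(t in `]y, z]) (h t * T t).
  move=> mh hK; apply/esym/Rintegral_itv_obnd_cbnd.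
  have mhT : measurable_fun setT (fun t => h t * T t) by exact: measurable_funM.
  apply: (bounded_integrable_oc mhT (K := K) _).1 => t /ltW yt tz.
  by rewrite normrM; apply: le_trans (hK t yt tz); rewrite ler_piMr.
congr (_ * _ + _).
  apply: (it id (1 + p)) => //= t h1 h2.
  by rewrite ler_norml; apply/andP; split; have := p0; lra.
apply: (it (fun t => x - t) `|x + p|) => [|t h1 h2]; first exact: measurable_funB.
by rewrite !ger0_norm; lra.
Qed.

Lemma tau_pow_sign : exists x0 : R, [/\ forall t, t < x0 -> T t <= 0,
  forall t, x0 < t -> 0 <= T t &
  forall t, - p < t -> t < 1 -> t != x0 -> tau k p t != 0].
Proof.
have [x0 [_ _ neg pos]] := gap_sign_change k0 k1 p0 pk.
exists x0; split => t.
- move=> tx; have [tp|pt] := leP t (- p); first by rewrite Tl.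
  have [t1|t1] := ltP t 1; last by rewrite Tr.
  have : T t < 0 by apply: sgpow_lt0; rewrite tau_mid// ?(ltW pt) ?(ltW t1)//; exact: neg.
  exact: ltW.
- move=> xt; have [tp|pt] := leP t (- p); first by rewrite Tl.
  have [t1|t1] := ltP t 1; last by rewrite Tr.
  have : 0 < T t by apply: sgpow_gt0; rewrite tau_mid// ?(ltW pt) ?(ltW t1)//; exact: pos.
  exact: ltW.
- move=> pt t1; rewrite tau_mid// ?(ltW pt) ?(ltW t1)// neq_lt => /orP[tx|xt].
    by rewrite lt_eqF// neg.
  by rewrite gt_eqF// pos.
Qed.

(** The function [T] is first nonpositive, then nonnegative, with total integral 0; so its primitive
    goes down from 0 and comes back to 0. *)
Lemma integral_tau_pow_le0 (x : R) : \int[lebesgue]_(t in `]- p, x]) T t <= 0.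
Proof.
have [x0 [neg pos _]] := tau_pow_sign.
have le0 (y z : R) : (forall t, y < t -> t <= z -> T t <= 0) ->
    \int[lebesgue]_(t in `]y, z]) T t <= 0.
  move=> h; rewrite -[leRHS](mul0r (fine (lebesgue `]y, z]))) -Rintegral_cst//.
  apply: le_Rintegral => //; first exact: integrable_cst_oc.
  by move=> t /=; rewrite in_itv/= => /andP[]; exact: h.
have [xx0|x0x] := ltP x x0.
  by apply: le0 => t _ tx; apply: neg; exact: le_lt_trans xx0.
have [x1|/ltW x1] := leP x 1; last first.
  have := integral_density mT TC Tl x1; rewrite /= integral_tau_pow subr0 => ->.
  by apply: le0 => t /ltW t1 _; rewrite Tr.
have := integral_density mT TC Tl x1; rewrite /= integral_tau_pow sub0r => E.
rewrite -oppr_ge0 E; apply: Rintegral_ge0 => t /=; rewrite in_itv/= => /andP[xt _].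
by apply: pos; exact: le_lt_trans xt.
Qed.

(** For [s = +oo] the sign of [tau] may jump at the zeros [- p], [x0] and 1; elsewhere [tau] is
    either nonzero or locally 0. *)
Lemma tau_pow_discontinuities : exists L : seq R,
  forall t, t \notin L -> {for t, continuous T}.
Proof.
have [x0 [_ _ ne]] := tau_pow_sign.
exists [:: - p; x0; 1] => t; rewrite !inE !negb_or => /and3P[tp tx t1].
have cst0 (A : set R) : nbhs t A -> (forall u, A u -> T u = 0) -> {for t, continuous T}.
  move=> At AT; have near0 : \forall u \near t, cst 0 u = T u by apply: filterS At => u /AT ->.
  rewrite /prop_for /continuous_at -(nbhs_singleton near0).
  by apply: cvg_trans (near_eq_cvg near0) _; exact: cvg_cst.
have [lt|gt|e] := ltgtP t (- p); last by rewrite e eqxx in tp.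
  by apply: (cst0 _ (lt_nbhsl lt)) => u /ltW; exact: Tl.
have [lt|gt'|e] := ltgtP t 1; last by rewrite e eqxx in t1.
  by apply: tau_pow_continuous => //; exact: ne.
by apply: (cst0 _ (lt_nbhsr gt')) => u /ltW; exact: Tr.
Qed.

(** Since [T] has integral 0, its first moment may be taken about the sign change [x0], where
    [(t - x0) * T t] is nonnegative. *)
Lemma phi_gt1_pos : 0 < phi_gt1 k s p (- p).
Proof.
rewrite phi_gt1_descent [ltRHS](descent_left T 1 (lexx (- p))).
rewrite mulr_gt0 ?invr_gt0//.
have [x0 [neg pos ne]] := tau_pow_sign.
(* The midpoint of [-p, 1], or the midpoint of its right half if the former is [x0]. *)
have [t0 [pt t1 tx]] : exists t0, [/\ - p < t0, t0 < 1 & t0 != x0].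
  have p0' := p0; have [e|ne'] := eqVneq ((1 - p) / 2) x0; last first.
    by exists ((1 - p) / 2); split => //; lra.
  exists (((1 - p) / 2 + 1) / 2); split; [lra|lra|].
  by rewrite -e; apply/eqP; lra.
have tau0 := ne _ pt t1 tx.
have mu : measurable_fun setT (fun t : R => (t - x0) * T t).
  by apply: measurable_funM => //; exact: measurable_funB.
have im : (@lebesgue R).-integrable `]- p, 1] (EFin \o (fun t : R => t * T t)).
  exact: integrable_first_moment mT TC _ _.
have E : \int[lebesgue]_(t in `]- p, 1]) ((t - x0) * T t) =
    \int[lebesgue]_(t in `]- p, 1]) (t * T t).
  rewrite -[RHS]subr0 -[in RHS](mulr0 x0) -integral_tau_pow -RintegralZl//.
  rewrite -RintegralB//; last exact: integrableMl_EFin.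
  by apply: eq_Rintegral => t _; rewrite mulrBl.
rewrite -E; apply: (@integral_gt0 _ (fun t : R => (t - x0) * T t) _ _ t0) => //.
- rewrite (_ : EFin \o _ = EFin \o (fun t : R => t * T t - x0 * T t)); last first.
    by apply/funext => t /=; rewrite mulrBl.
  by apply: integrableB_EFin => //; exact: integrableMl_EFin.
- move=> t _ _; have [lt|gt|->] := ltgtP t x0; last by rewrite subrr mul0r.
    by rewrite mulr_le0// ?neg// subr_le0 ltW.
  by rewrite mulr_ge0// ?pos// subr_ge0 ltW.
- apply: cvgM; last exact: tau_pow_continuous.
  by apply: cvgB; [exact: cvg_id|exact: cvg_cst].
- have T0 : T t0 != 0.
    by rewrite -normr_gt0 (normr_sgpow _ tau0) powR_gt0// normr_gt0.
  have := tx; rewrite neq_lt => /orP[lt|gt].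
    by rewrite nmulr_rgt0 ?subr_lt0// lt_neqAle T0 neg.
  by rewrite pmulr_rgt0 ?subr_gt0// lt_neqAle eq_sym T0 pos.
Qed.

Lemma phi_gt1_L2infty : L2infty s (phi_gt1 k s p).
Proof.
have [L cL] := tau_pow_discontinuities; rewrite phi_gt1_descent.
apply: (descent_L2infty mT TC Tl Tr cL integral_tau_pow integral_tau_pow_le0).
  exact: ltW.
by rewrite Ls_norm_tau_pow// ltry.
Qed.

Lemma Ls_norm_phi_gt1 : Ls_norm s (phi_gt1 k s p)^`(2)%classic =
  (tau_moment k p s `^ (1 - (fine (hoelder_conjugate s))^-1))%:E.
Proof.
have [L cL] := tau_pow_discontinuities; rewrite phi_gt1_descent.
by rewrite (Ls_norm_descent 1 mT TC Tl cL) ?(ltW s1)// Ls_norm_tau_pow.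
Qed.

Lemma phi_gt1_bounded (t : R) : `|phi_gt1 k s p t| <= phi_gt1 k s p (- p).
Proof.
rewrite phi_gt1_descent [leRHS](descent_left T 1 (lexx (- p))).
exact: (descent_bounded mT TC Tl Tr integral_tau_pow integral_tau_pow_le0).
Qed.

Lemma phi_gt1_right (t : R) : 1 <= t -> phi_gt1 k s p t = - phi_gt1 k s p (- p).
Proof.
move=> t1; rewrite phi_gt1_descent [in RHS](descent_left T 1 (lexx (- p))).
exact: (descent_right mT TC Tl Tr integral_tau_pow).
Qed.

Lemma phi_gt1_lipschitz (x y : R) :
  `|phi_gt1 k s p x - phi_gt1 k s p y| <= (1 + p) * `|x - y|.
Proof.
rewrite phi_gt1_descent; apply: (descent_lipschitz 1 mT TC Tl integral_tau_pow_le0) => z.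
have := descent_derivative_ge mT TC Tl Tr z p1.
by rewrite mul1r opprK.
Qed.

Lemma weyl_phi_gt1 : k * (1 - k) * weyl k (phi_gt1 k s p) 0 =
  2 / (1 + p) * phi_gt1 k s p (- p) + tau_moment k p s.
Proof.
have acd := descent_ac_derivatives 1 mT TC Tl; rewrite -phi_gt1_descent in acd.
have -> := weyl_additive_equality acd k0 k1 p0 phi_gt1_bounded erefl phi_gt1_right.
by rewrite integral_gap_tau_pow.
Qed.

End extremal_function.

(** * Solvability of the equation for [p_opt] when s > 1 *)

Lemma bounded_Rintegral_cvg (R : realType) (u : nat -> R -> R) (v : R -> R)
    (a b K : R) : (forall n, measurable_fun setT (u n)) -> measurable_fun setT v ->
  (forall n t, `|u n t| <= K) ->
  {ae @lebesgue R, forall t, u ^~ t @ \oo --> v t} ->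
  \int[lebesgue]_(t in `]a, b]) u n t @[n --> \oo] -->
  \int[lebesgue]_(t in `]a, b]) v t.
Proof.
move=> mu mv uK uv.
have mD : measurable (`]a, b] : set R) by exact: measurable_itv.
have uvE : {ae @lebesgue R, forall t, (`]a, b]%classic t : Prop) ->
    (EFin \o u n) t @[n --> \oo] --> (EFin \o v) t}.
  by apply: filterS uv => t ct _; apply: cvg_EFin => //; exact: nearW.
have uKE : {ae @lebesgue R, forall t, forall n, (`]a, b]%classic t : Prop) ->
    (`|(EFin \o u n) t| <= (EFin \o cst K) t)%E}.
  by apply: aeW => t n _; rewrite lee_fin.
have mu' n : measurable_fun `]a, b] (EFin \o u n).
  by apply: measurable_funTS; apply/measurable_EFinP.
have mv' : measurable_fun `]a, b] (EFin \o v).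
  by apply: measurable_funTS; apply/measurable_EFinP.
have [iv _ cv] := @dominated_convergence _ _ _
  (@lebesgue R) _ mD (fun n => EFin \o u n) (EFin \o v) (EFin \o cst K)
  mu' mv' uvE (integrable_cst_oc K a b) uKE.
apply: fine_cvg; rewrite fineK; last exact: integrable_fin_num.
exact: cv.
Qed.

Section existence.
Context (R : realType) (k : R) (s : \bar R).
Context (k0 : 0 < k) (k1 : k < 1) (s1 : (1 < s)%E).

Let P := k / (1 - k).

Let P0 : 0 < P. Proof. by rewrite divr_gt0// subr_gt0. Qed.

(** Truncation to [0, P] makes the facts on [tau] available for every real parameter, so that
    continuity in [p] is stated on the whole line. *)
Let clip (p : R) := Num.max 0 (Num.min p P).

Let clip0 (p : R) : 0 <= clip p. Proof. by rewrite le_max lexx. Qed.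

Let clipP (p : R) : clip p <= P. Proof. by rewrite ge_max (ltW P0) ge_min lexx orbT. Qed.

Let clip_id (p : R) : 0 <= p -> p <= P -> clip p = p.
Proof. by move=> p0 pP; rewrite /clip (min_idPl pP) (max_idPr p0). Qed.

Let clip_continuous : continuous clip.
Proof.
move=> p; apply: (@continuous_max _ _ (cst 0) (fun p => Num.min p P)).
  exact: cvg_cst.
by apply: (@continuous_min _ _ id (cst P)); [exact: cvg_id|exact: cvg_cst].
Qed.

Lemma tau_continuous_param (t p : R) : tau k (clip q) t @[q --> p] --> tau k (clip p) t.
Proof.
have E q : tau k (clip q) t = rho k (Num.max (Num.min t 1) (- clip q)) -
    (Num.max (Num.min t 1) (- clip q) + clip q) / (1 + clip q) by rewrite tauE.
have cm : Num.max (Num.min t 1) (- clip q) @[q --> p] -->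
    Num.max (Num.min t 1) (- clip p).
  apply: (@continuous_max _ _ (cst (Num.min t 1)) (fun q => - clip q)).
    exact: cvg_cst.
  by apply: cvgN; exact: clip_continuous.
rewrite E; under eq_fun do rewrite E.
apply: cvgB.
  by apply: (cvg_comp _ _ cm); exact: rho_continuous.
apply: cvgM; first by apply: cvgD => //; exact: clip_continuous.
apply: cvgV; first by rewrite gt_eqF// ltr_wpDr.
by apply: cvgD; [exact: cvg_cst|exact: clip_continuous].
Qed.

(** Two points are set aside: [- clip p], where the support begins, and the sign change [x0], where
    [sgpow] may jump. *)
Lemma tau_pow_cvg (u : nat -> R) (p : R) : u @ \oo --> p ->
  {ae @lebesgue R, forall t,
    tau_pow k s (clip (u n)) t @[n --> \oo] --> tau_pow k s (clip p) t}.
Proof.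
move=> up; have [x0 [_ _ ne]] := tau_pow_sign s k0 k1 (clip0 p) (clipP p).
exists [set` [:: - clip p; x0]]; split.
- by apply: countable_measurable => //; exact/finite_set_countable/finite_seq.
- by apply: countable_lebesgue_measure0; exact/finite_set_countable/finite_seq.
move=> t /= nc; apply/negPn/negP; rewrite !inE negb_or => /andP[tp tx]; apply: nc.
have cu : clip (u n) @[n --> \oo] --> clip p.
  by apply: (cvg_comp _ _ up); exact: clip_continuous.
have [lt|gt|e] := ltgtP t (- clip p); last by rewrite e eqxx in tp.
  rewrite tau_pow_left ?(ltW lt)//.
  have nr : \forall n \near \oo, cst 0 n = tau_pow k s (clip (u n)) t.
    have tn : clip p < - t by rewrite ltrNr.
    apply: filterS (cvgr_lt _ cu _ tn) => n cn.
    by rewrite tau_pow_left// lerNr ltW.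
  by apply: cvg_trans (near_eq_cvg nr) _; exact: cvg_cst.
have [t1|t1] := leP 1 t.
  have z q : tau_pow k s (clip q) t = 0 by exact: tau_pow_right.
  by rewrite z; under eq_fun do rewrite z; exact: cvg_cst.
have tau0 := ne t gt t1 tx.
have ct : tau k (clip (u n)) t @[n --> \oo] --> tau k (clip p) t.
  exact: (cvg_comp u (fun q => tau k (clip q) t) up (@tau_continuous_param t p)).
exact: (cvg_comp (fun n => tau k (clip (u n)) t)
  (@sgpow R (fine (hoelder_conjugate s) - 1)) ct (sgpow_continuous tau0)).
Qed.

(** The interval does not depend on [p]; as [tau_pow] vanishes up to [- p], this is still the
    integral in the equation. *)
Let J (p : R) := \int[lebesgue]_(t in `]- P, 1]) tau_pow k s (clip p) t.

Lemma tau_pow_integral_continuous : continuous J.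
Proof.
move=> p; apply/(@cvg_nbhsP R R^o) => u up.
apply: (@bounded_Rintegral_cvg R (fun n => tau_pow k s (clip (u n)))
  (tau_pow k s (clip p)) (- P) 1 1).
- by move=> n; exact: measurable_tau_pow.
- exact: measurable_tau_pow.
- by move=> n t; exact: tau_pow_le1.
- exact: (tau_pow_cvg up).
Qed.

(** For [p = 0] the function [tau] is [t^(1 - k) - t] on [0, 1], which is nonnegative there. *)
Lemma tau_pow_integral_ge0 : 0 <= J 0.
Proof.
apply: Rintegral_ge0 => t /=; rewrite in_itv/= clip_id// ?(ltW P0)// => /andP[_ t1].
have [t0|t0] := leP t 0; first by rewrite tau_pow_left// oppr0.
have h : 0 <= tau k 0 t.
  rewrite tau_mid// ?oppr0 ?(ltW t0)// /gap /rho t0 !addr0 divr1 subr_ge0.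
  rewrite -[leLHS]powRr1 ?(ltW t0)//; apply: ger_powR; first by rewrite t0.
  by have := k0; lra.
by rewrite /tau_pow mulr_ge0 ?powR_ge0// sgr_ge0.
Qed.

Lemma peak_right : peak k P = 1.
Proof.
rewrite /peak; have -> : (1 - k) * (1 + P) = 1.
  by rewrite /P; field; rewrite gt_eqF// subr_gt0.
by rewrite powR1.
Qed.

(** At this end of the range the peak is at 1, so [gap] increases on [0, 1] up to its value 0 at 1
    and [tau] is nonpositive. *)
Lemma tau_pow_integral_le0 : J P <= 0.
Proof.
rewrite -oppr_ge0 /J clip_id ?(ltW P0)//.
have h (t : R) : - P < t -> t <= 1 -> tau k P t <= 0.
  move=> Pt t1; rewrite tau_mid// ?(ltW P0) ?(ltW Pt)//.
  have [t0|t0] := leP t 0.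
    rewrite /gap /rho ltNge t0/= sub0r oppr_le0 divr_ge0//; have := P0; lra.
  move: t1; rewrite le_eqVlt => /predU1P[->|t1]; first by rewrite gap1// ltW.
  rewrite -(@gap1 _ k P) ?(ltW P0)//; apply: ltW; apply: gap_increasing => //.
  - exact: ltW.
  - exact: ltW.
  - by rewrite peak_right.
rewrite -[leRHS]mulN1r -RintegralZl//; last first.
  have mT := measurable_tau_pow s k0 k1 (ltW P0).
  exact: (bounded_integrable_oc mT (fun t _ _ => tau_pow_le1 k0 k1 (ltW P0) s1 t)).1.
apply: Rintegral_ge0 => t /=; rewrite in_itv/= => /andP[Pt t1].
by rewrite mulN1r oppr_ge0 /tau_pow mulr_ge0_le0 ?powR_ge0// sgr_le0 h.
Qed.

Lemma p_equation_solvable : exists p : R, 0 <= p <= P /\ p_equation k s p.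
Proof.
have [p] : exists2 p, p \in `[0, P] & J p = 0.
  apply: IVT; [exact: ltW|exact: continuous_subspaceT tau_pow_integral_continuous|].
  move: (J 0) (J P) tau_pow_integral_ge0 tau_pow_integral_le0 => x y x0 y0.
  by rewrite ge_min le_max y0 x0 orbT.
rewrite in_itv/= => /andP[p0 pP] Jp; exists p; split; first by rewrite p0.
rewrite /p_equation; have -> : (s == 1%E) = false by rewrite gt_eqF.
move: Jp; rewrite /J (clip_id p0 pP) => Jp; rewrite -[RHS]Jp.
have mT := measurable_tau_pow s k0 k1 p0.
have iT (x y : R) := (bounded_integrable_oc mT
  (fun t (_ : x < t) (_ : t <= y) => tau_pow_le1 k0 k1 p0 s1 t)).1.
have p1 : - p <= 1 by lra.
have Pp : - P <= - p by rewrite lerN2.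
rewrite -Rintegral_itv_obnd_cbnd//.
have := Rintegral_itv_split _ _ (iT (- P) (- p)) (iT (- p) 1).
rewrite !bnd_simp => /(_ Pp p1)[_ ->].
rewrite -[LHS]add0r; congr (_ + _).
by apply/esym/Rintegral_oc_eq0 => t _ tp; rewrite tau_pow_left.
Qed.

(** Solvability ensures that [xget] returns a solution and not its default 0. *)
Lemma p_opt_gt1 : 0 <= p_opt k s <= k / (1 - k) /\
  \int[lebesgue]_(t in `[- p_opt k s, 1]) tau_pow k s (p_opt k s) t = 0.
Proof.
have /(xgetPex 0)[h] := p_equation_solvable; rewrite -/(p_opt k s) /p_equation.
have -> : (s == 1%E) = false by rewrite gt_eqF.
by move=> hp; split; [exact: h|exact: hp].
Qed.

End existence.

(** * From pointwise bounds on [weyl] to the inequality for the Marchaud derivative *)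

Section kolmogorov.
Context (R : realType) (k c : R) (n : nat) (s : \bar R).
Context (k0 : 0 < k) (k1 : k < 1).
Context (mw : forall (f : R -> R) (x L M : R), measurable_fun setT f ->
  lip_bounded L M f x -> marchaud k n f x = c * weyl k f x).

Lemma marchaud_L2infty (f : R -> R) (x : R) : L2infty s f ->
  marchaud k n f x = c * weyl k f x.
Proof.
move=> Lf; have fgG := L2infty_ac_derivatives Lf.
have [L] := ac_derivatives_lip_bounded x fgG (L2infty_bounded Lf).
exact: mw (measurable_antiderivative fgG).
Qed.

Lemma kolmogorov_of_weyl_bound (K : R) (f : R -> R) : L2infty s f ->
  (forall x, `|weyl k f x| <=
    K * fine (Ls_norm +oo%E f) `^ (1 - lambda k s)
      * fine (Ls_norm s f^`(2)%classic) `^ lambda k s) ->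
  kolmogorov_inequality k n s (`|c| * K) f.
Proof.
move=> Lf fK; apply/Ls_norm_pinfty_le; apply: aeW => x; rewrite lee_fin.
by rewrite marchaud_L2infty// normrM -!mulrA ler_wpM2l// mulrA.
Qed.

End kolmogorov.

Lemma quotient_powR (R : realType) (x y e : R) : 0 <= x -> 0 < y ->
  (x / y) `^ e = x `^ e / y `^ e.
Proof.
move=> x0 y0; rewrite powRM ?invr_ge0 ?(ltW y0)//; congr (_ * _).
by rewrite -powR_inv1 ?(ltW y0)// -powRrM mulN1r powRN.
Qed.

(** * The inequality and its sharpness for s > 1 *)

Section large_exponent.
Context (R : realType) (k : R) (n : nat) (s : \bar R).
Context (k0 : 0 < k) (k1 : k < 1) (kn : k < n%:R) (s1 : (1 < s)%E).

Let p := p_opt k s.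
Let q := fine (hoelder_conjugate s).
(** [M0] and [S0] are the norms of [phi_gt1] and of its second derivative; [K0] is its [weyl] at 0,
    by [weyl_phi_gt1]. *)
Let M0 := phi_gt1 k s p (- p).
Let S0 := tau_moment k p s `^ (1 - q^-1).
Let K0 := (2 / (1 + p) * M0 + tau_moment k p s) / (k * (1 - k)).

Let p0 : 0 <= p. Proof. by have [/andP[]] := p_opt_gt1 k0 k1 s1. Qed.

Let pk : p <= k / (1 - k). Proof. by have [/andP[]] := p_opt_gt1 k0 k1 s1. Qed.

Let pE : \int[lebesgue]_(t in `[- p, 1]) tau_pow k s p t = 0.
Proof. by have [] := p_opt_gt1 k0 k1 s1. Qed.

Let s1' : (1 <= s)%E. Proof. exact: ltW. Qed.

Let M00 : 0 < M0. Proof. exact: phi_gt1_pos. Qed.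

Let A0 : 0 < tau_moment k p s. Proof. exact: tau_moment_gt0. Qed.

Let S00 : 0 < S0. Proof. by rewrite powR_gt0// tau_moment_gt0. Qed.

Let kk : 0 < k * (1 - k). Proof. by rewrite mulr_gt0// subr_gt0. Qed.

Let K00 : 0 <= K0.
Proof.
rewrite divr_ge0 ?(ltW kk)// addr_ge0//; last exact/ltW/tau_moment_gt0.
by rewrite mulr_ge0 ?(ltW M00)// divr_ge0// addr_ge0.
Qed.

(** Hoelder's inequality is an equality for the pair [tau], [tau_pow], so with the reference pair
    [M0], [S0] the additive bound is exactly [k * (1 - k) * K0]. *)
Lemma weyl_bound_gt1 (f : R -> R) (x : R) : L2infty s f ->
  `|weyl k f x| <= K0 / (M0 `^ (1 - lambda k s) * S0 `^ lambda k s) *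
    fine (Ls_norm +oo%E f) `^ (1 - lambda k s) *
    fine (Ls_norm s f^`(2)%classic) `^ lambda k s.
Proof.
move=> Lf; have fgG := L2infty_ac_derivatives Lf.
have [_ _ _ f2] := Lf.
have GS : (Ls_norm s f^`(2)%classic <= (fine (Ls_norm s f^`(2)%classic))%:E)%E.
  by rewrite -Ls_norm_fineK.
have tb (g g' G : R -> R) (S : R) : ac_derivatives g g' G -> (Ls_norm s G <= S%:E)%E ->
    `|\int[lebesgue]_(t in `]- p, 1]) ((rho k t - (t + p) / (1 + p)) * G t)| <=
    tau_moment k p s `^ q^-1 * S.
  by move=> [_ _ mG _]; exact: gap_hoelder.
have := weyl_multiplicative_bound k0 k1 p0 pk s1' tb fgG (L2infty_bounded Lf) GS x
  M00 S00 (powR_ge0 _ _).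
rewrite tau_moment_split// !quotient_powR ?fine_ge0 ?Ls_norm_ge0//.
rewrite mulrC -ler_pdivlMr// => /le_trans; apply; rewrite le_eqVlt; apply/orP; left.
have p1 : 0 < 1 + p by rewrite ltr_wpDr.
by apply/eqP; rewrite /K0; field; rewrite !gt_eqF ?powR_gt0 ?subr_gt0.
Qed.

(** That [|weyl|] of [phi_gt1] is maximal at 0 is deduced from the inequality applied to this very
    function: the right-hand side is then [K0], the value at 0. *)
Lemma sharp_constant_gt1 (c : R) :
  (forall (f : R -> R) (x L M : R), measurable_fun setT f ->
    lip_bounded L M f x -> marchaud k n f x = c * weyl k f x) ->
  Ls_norm +oo%E (marchaud k n (phi_gt1 k s p)) = (`|c| * K0)%:E /\
  sharp_constant k n s =
    `|c| * (K0 / (M0 `^ (1 - lambda k s) * S0 `^ lambda k s)).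
Proof.
move=> mw; pose phi := phi_gt1 k s p.
have Lphi : L2infty s phi by exact: phi_gt1_L2infty.
have mphi := measurable_antiderivative (L2infty_ac_derivatives Lphi).
have phiK := phi_gt1_lipschitz k0 k1 p0 pk s1 pE; rewrite -/phi in phiK.
have phiM := phi_gt1_bounded k0 k1 p0 pk s1 pE; rewrite -/phi in phiM.
have phi2 : Ls_norm s phi^`(2)%classic = S0%:E by exact: Ls_norm_phi_gt1.
have cphi := lipschitz_continuous phiK.
have phiy : Ls_norm +oo%E phi = M0%:E.
  by apply: (@Ls_norm_pinfty_max _ _ _ (- p)); [exact: cphi|exact: phiM|exact: ger0_norm (ltW M00)].
have phiW x : `|weyl k phi x| <= K0.
  have := weyl_bound_gt1 x Lphi; rewrite phi2 phiy/= => /le_trans; apply.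
  rewrite le_eqVlt; apply/orP; left; apply/eqP; field.
  by rewrite !gt_eqF ?powR_gt0.
have phiz : `|weyl k phi 0| = K0.
  have -> : weyl k phi 0 = K0; last by rewrite ger0_norm.
  apply: (mulfI (lt0r_neq0 kk)); rewrite weyl_phi_gt1// -/M0 /K0.
  by rewrite mulrCA divff ?mulr1// gt_eqF.
have mphiE x : marchaud k n phi x = c * weyl k phi x by exact: marchaud_L2infty Lphi.
split; first exact: (Ls_norm_marchaud k0 k1 phiK phiM mphiE phiW phiz).
have PhiE : Phi k s = (fun x => S0^-1 * phi x).
  rewrite /Phi /phi_opt /Defs.phi gt_eqF//; apply/funext => x.
  by rewrite -/p -/phi phi2.
have Sphi x : weyl k (Phi k s) x = S0^-1 * weyl k phi x.
  rewrite PhiE; apply: (weyl_scale S0^-1 k0 k1 mphi).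
  exact: (lipschitz_lip_bounded x phiK phiM).
have S0i : `|S0^-1| = S0^-1 by rewrite ger0_norm// invr_ge0 ltW.
have PhiK x y : `|Phi k s x - Phi k s y| <= S0^-1 * (1 + p) * `|x - y|.
  by rewrite PhiE -mulrBr normrM S0i -mulrA ler_wpM2l// invr_ge0 ltW.
have PhiM x : `|Phi k s x| <= S0^-1 * M0.
  by rewrite PhiE normrM S0i ler_wpM2l// invr_ge0 ltW.
have PhimE x : marchaud k n (Phi k s) x = c * weyl k (Phi k s) x.
  apply: mw (lipschitz_lip_bounded x PhiK PhiM).
  by apply: continuous_measurable_fun; exact: lipschitz_continuous PhiK.
have PhiW x : `|weyl k (Phi k s) x| <= S0^-1 * K0.
  by rewrite Sphi normrM S0i ler_wpM2l// invr_ge0 ltW.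
have Phiz : `|weyl k (Phi k s) 0| = S0^-1 * K0 by rewrite Sphi normrM S0i phiz.
rewrite /sharp_constant (Ls_norm_marchaud k0 k1 PhiK PhiM PhimE PhiW Phiz).
have -> : Ls_norm +oo%E (Phi k s) = (M0 / S0)%:E.
  have cPhi := lipschitz_continuous PhiK.
  rewrite mulrC; apply: (@Ls_norm_pinfty_max _ _ _ (- p)); [exact: cPhi|exact: PhiM|].
  by rewrite PhiE normrM S0i -/M0 (gtr0_norm M00).
rewrite /= quotient_powR ?(ltW M00)//.
(* The normalisation by [S0] changes the quotient by [S0^-1 * S0^(1 - lambda)], that is by
   [S0^(- lambda)], the missing factor of the second derivative. *)
have S1 : S0 `^ (1 - lambda k s) = S0 / S0 `^ lambda k s.
  by rewrite powR1B.
by rewrite S1; field; rewrite !gt_eqF ?powR_gt0.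
Qed.

Lemma corollary10_gt1 :
  (forall f : R -> R, L2infty s f ->
     kolmogorov_inequality k n s (sharp_constant k n s) f) /\
  (forall C : R,
     (forall f : R -> R, L2infty s f -> kolmogorov_inequality k n s C f) ->
     sharp_constant k n s <= C).
Proof.
have [c mw] := marchaud_weyl k0 k1 kn.
have [mphi sE] := sharp_constant_gt1 mw.
have Lphi : L2infty s (phi_gt1 k s p) by exact: phi_gt1_L2infty.
have den : 0 < M0 `^ (1 - lambda k s) * S0 `^ lambda k s by rewrite mulr_gt0 ?powR_gt0.
split=> [f Lf|C /(_ _ Lphi)].
  rewrite sE; apply: (kolmogorov_of_weyl_bound mw Lf) => x.
  exact: weyl_bound_gt1.
have -> : sharp_constant k n s =
    (`|c| * K0) / (M0 `^ (1 - lambda k s) * S0 `^ lambda k s) by rewrite sE mulrA.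
rewrite /kolmogorov_inequality mphi Ls_norm_phi_gt1// ler_pdivrMr//.
have -> : Ls_norm +oo%E (phi_gt1 k s p) = M0%:E.
  apply: (@Ls_norm_pinfty_max _ _ _ (- p)).
  - exact: (lipschitz_continuous (phi_gt1_lipschitz k0 k1 p0 pk s1 pE)).
  - exact: phi_gt1_bounded.
  - by rewrite (gtr0_norm M00).
by rewrite lee_fin /= -mulrA.
Qed.

End large_exponent.

(** * The case s = 1 *)

Section exponent_one.
Context (R : realType) (k : R) (k0 : 0 < k) (k1 : k < 1).

Let k10 : 0 < 1 - k. Proof. by rewrite subr_gt0. Qed.

Lemma lambda1 : lambda k 1%E = k.
Proof.
rewrite /lambda inver oner_eq0 /= invr1.
by rewrite (_ : 2 - 1 = 1 :> R) ?divr1//; ring.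
Qed.

Lemma p_opt_eq1 : 0 <= p_opt k 1 <= k / (1 - k) /\
  k `^ k * (1 - k) `^ (1 - k) * (1 + p_opt k 1) = (2 * p_opt k 1) `^ k.
Proof.
have [p p_bounds pE] : exists2 p, 0 <= p <= k / (1 - k) & p_equation k 1 p.
  (* [rho (1 - k)] is the power [k] on nonnegative numbers, in a form already proved continuous at
     0. *)
  pose h (p : R) := k `^ k * (1 - k) `^ (1 - k) * (1 + p) - rho (1 - k) (2 * p).
  have P0 : 0 < k / (1 - k) by rewrite divr_gt0.
  have hE p : 0 <= p -> h p = k `^ k * (1 - k) `^ (1 - k) * (1 + p) - (2 * p) `^ k.
    rewrite le_eqVlt => /predU1P[<-|p0].
      by rewrite /h /rho mulr0 ltxx powR0 ?gt_eqF.
    by rewrite /h /rho mulr_gt0// opprB addrCA subrr addr0.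
  have ch : continuous h.
    move=> p; apply: cvgB.
      apply: cvgM; first exact: cvg_cst.
      by apply: cvgD; [exact: cvg_cst|exact: cvg_id].
    apply: (cvg_comp (fun p => 2 * p) (rho (1 - k)) _ (rho_continuous _ (x := 2 * p))).
      by apply: cvgM; [exact: cvg_cst|exact: cvg_id].
    by rewrite gtrBl.
  have h0 : 0 <= h 0.
    by rewrite hE// mulr0 powR0 ?gt_eqF// subr0 !mulr_ge0 ?powR_ge0.
  have hP : h (k / (1 - k)) <= 0.
    rewrite hE ?(ltW P0)// subr_le0.
    have -> : 1 + k / (1 - k) = (1 - k)^-1 by field; rewrite gt_eqF.
    (* At the right end the first term is the power [k] of [k / (1 - k)], the second that of twice
       this number. *)
    have -> : k `^ k * (1 - k) `^ (1 - k) * (1 - k)^-1 = (k / (1 - k)) `^ k.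
      rewrite quotient_powR ?(ltW k0)// powR1B//.
      by field; rewrite !gt_eqF ?powR_gt0.
    apply: ge0_ler_powR; rewrite ?nnegrE ?(ltW k0)//; lra.
  have [p] : exists2 p, p \in `[0, k / (1 - k)] & h p = 0.
    apply: IVT; [exact: ltW|exact: continuous_subspaceT|].
    by rewrite ge_min le_max h0 hP orbT.
  rewrite in_itv/= => /andP[p0 pP] hp; exists p; first by rewrite p0.
  by rewrite /p_equation eqxx -hE.
have ex : exists p, 0 <= p <= k / (1 - k) /\ p_equation k 1 p by exists p.
have /(xgetPex 0)[h] := ex; rewrite -/(p_opt k 1) /p_equation eqxx => /eqP.
by rewrite subr_eq0 => /eqP.
Qed.

Let p := p_opt k 1.

Let p0' : 0 <= p. Proof. by have [/andP[]] := p_opt_eq1. Qed.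

Let p1 : 0 < 1 + p. Proof. by rewrite ltr_wpDr. Qed.

Lemma p_opt_eq1_gt0 : 0 < p.
Proof.
have [_ E] := p_opt_eq1; rewrite lt_neqAle p0' andbT eq_sym; apply/eqP => pE.
move: E; rewrite -/p pE mulr0 powR0 ?gt_eqF// addr0 mulr1 => /eqP.
by rewrite gt_eqF// mulr_gt0// powR_gt0.
Qed.

(** The equation for [p_opt], solved for the critical point. In this form it says that [gap] takes
    the value [p / (1 + p)] at its peak, opposite to its value at 0. *)
Lemma peak_opt : peak k p = 2 * p * (1 - k) / k.
Proof.
have x0 : 0 <= 2 * p * (1 - k) / k.
  by rewrite divr_ge0 ?(ltW k0)// mulr_ge0 ?(ltW k10)// mulr_ge0.
rewrite /peak; have -> : (1 - k) * (1 + p) = (2 * p * (1 - k) / k) `^ k.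
  rewrite quotient_powR// ?mulr_ge0 ?(ltW k10)// powRM ?mulr_ge0 ?(ltW k10)//.
  have [_ <-] := p_opt_eq1; rewrite -/p powR1B//.
  by field; rewrite !gt_eqF ?powR_gt0.
by rewrite -powRrM mulfV ?gt_eqF// powRr1.
Qed.

(** The minimum of [gap], at 0, and its maximum, at [peak], are opposite: [p / (1 + p)] is the sup
    norm of [tau], the constant of the duality for s = 1. *)
Lemma gap_opt_bounded (t : R) : - p <= t -> t <= 1 -> `|gap k p t| <= p / (1 + p).
Proof.
move=> pt t1; have gap0 : gap k p 0 = - (p / (1 + p)).
  by rewrite /gap /rho ltxx sub0r add0r.
have [/andP[_ pk] _] := p_opt_eq1.
have B0 : 0 <= p / (1 + p) by rewrite divr_ge0// ltW.
have pp := peak_gt0 k1 p0'; have pl1 := peak_le1 k0 k1 p0' pk.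
have gap_peak : gap k p (peak k p) = p / (1 + p).
  have pe : peak k p `^ (1 - k) = peak k p / ((1 - k) * (1 + p)).
    rewrite powR1B// peak_powR//.
  rewrite /gap /rho pp pe peak_opt; field.
  by rewrite !gt_eqF.
rewrite ler_norml; have [t0|t0] := leP t 0.
  rewrite /gap /rho ltNge t0/= sub0r lerN2 ler_pM2r ?invr_gt0//.
  apply/andP; split; first by rewrite gerDr.
  by apply: le_trans B0; rewrite oppr_le0 divr_ge0 ?(ltW p1)// -lerBlDr sub0r.
have [tp|pt'] := leP t (peak k p).
  apply/andP; split.
    by rewrite -gap0 ltW//; apply: gap_increasing.
  move: tp; rewrite le_eqVlt => /predU1P[->|tp]; first by rewrite gap_peak.
  by rewrite -gap_peak ltW//; apply: gap_increasing => //; exact: ltW.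
apply/andP; split.
  apply: (@le_trans _ _ 0); first by rewrite oppr_le0.
  move: t1; rewrite le_eqVlt => /predU1P[->|t1]; first by rewrite gap1.
  by rewrite -(@gap1 _ k p)// ltW//; apply: gap_decreasing => //; exact: ltW.
by rewrite -gap_peak ltW//; apply: gap_decreasing.
Qed.

Lemma gap_opt_integral (G : R -> R) (S : R) : measurable_fun setT G ->
  (Ls_norm 1 G <= S%:E)%E ->
  `|\int[lebesgue]_(t in `]- p, 1]) ((rho k t - (t + p) / (1 + p)) * G t)|
    <= p / (1 + p) * S.
Proof.
move=> mG GS; have B0 : 0 <= p / (1 + p) by rewrite divr_ge0// ltW.
have mgap : measurable_fun setT (gap k p).
  by apply: continuous_measurable_fun; exact: gap_continuous.
have mgG : measurable_fun setT (fun t => gap k p t * G t) by exact: measurable_funM.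
apply: normr_Rintegral_le => //.
apply: (@le_trans _ _ (\int[lebesgue]_(t in `](- p)%R, 1%R])
    ((p / (1 + p))%:E * `|G t|%:E))%E).
  apply: ge0_le_integral => //.
  - by apply/measurable_EFinP; apply: measurableT_comp => //; exact: measurable_funTS.
  - by apply: measurable_funeM; apply/measurable_EFinP; apply: measurableT_comp => //;
      exact: measurable_funTS.
  - move=> t /=; rewrite in_itv/= => /andP[/ltW pt t1].
    by rewrite -EFinM lee_fin normrM ler_wpM2r// gap_opt_bounded.
rewrite ge0_integralZl//; last first.
  by apply/measurable_EFinP; apply: measurableT_comp => //; exact: measurable_funTS.
rewrite [leRHS]EFinM lee_wpmul2l//; apply: le_trans GS.
rewrite Ls_norm_EFin invr1 poweRe1; last exact: integral_ge0.
under [leRHS]eq_integral do rewrite powRr1//.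
apply: ge0_subset_integral => //.
by apply/measurable_EFinP; exact: measurableT_comp.
Qed.

Lemma weyl_bound_eq1 (f : R -> R) (x : R) : L2infty 1 f ->
  `|weyl k f x| <= 4 `^ (1 - k) / (2 * k * (1 - k)) *
    fine (Ls_norm +oo%E f) `^ (1 - lambda k 1) *
    fine (Ls_norm 1 f^`(2)%classic) `^ lambda k 1.
Proof.
move=> Lf; have fgG := L2infty_ac_derivatives Lf.
have [_ _ _ f2] := Lf; have [/andP[_ pk] _] := p_opt_eq1.
have GS : (Ls_norm 1 f^`(2)%classic <= (fine (Ls_norm 1 f^`(2)%classic))%:E)%E.
  by rewrite -Ls_norm_fineK.
have tb (g g' G : R -> R) (S : R) : ac_derivatives g g' G -> (Ls_norm 1 G <= S%:E)%E ->
    `|\int[lebesgue]_(t in `]- p, 1]) ((rho k t - (t + p) / (1 + p)) * G t)| <=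
    p / (1 + p) * S.
  by move=> [_ _ mG _]; exact: gap_opt_integral.
have pp := peak_gt0 k1 p0'; have p0 := p_opt_eq1_gt0.
(* The reference pair [peak / 4], [1] belongs to the ramp of slope -1/2 on [0, peak]: its second
   derivative consists of masses -1/2 and 1/2 where [gap] has its minimum and its maximum. *)
have M00 : 0 < peak k p / 4 by rewrite divr_gt0.
have B0 : 0 <= p / (1 + p) by rewrite divr_ge0// ltW.
have := weyl_multiplicative_bound k0 k1 p0' pk (lexx 1%E) tb fgG (L2infty_bounded Lf) GS x
  M00 ltr01 B0.
have kk : 0 < k * (1 - k) by rewrite mulr_gt0.
rewrite lambda1 divr1 !quotient_powR ?fine_ge0 ?Ls_norm_ge0 ?(ltW pp)//.
rewrite mulrC -ler_pdivlMr// => /le_trans; apply; rewrite le_eqVlt; apply/orP; left.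
have -> : peak k p `^ (1 - k) = peak k p / ((1 - k) * (1 + p)).
  by rewrite powR1B// peak_powR.
apply/eqP; rewrite peak_opt; field.
by rewrite !gt_eqF ?powR_gt0.
Qed.

End exponent_one.

(** * The singular integral of the ramp [phi_eq1] *)

Section ramp.
Context (R : realType) (k p : R) (k0 : 0 < k) (k1 : k < 1) (p0 : 0 <= p).

Local Ltac plra := have := p0; lra.

Let k10 : 0 < 1 - k. Proof. by rewrite subr_gt0. Qed.

Let L0 : 0 < 1 + p. Proof. by rewrite ltr_wpDr. Qed.

Lemma ramp_drop (x y : R) : x <= y ->
  [/\ 0 <= phi_eq1 p x - phi_eq1 p y, phi_eq1 p x - phi_eq1 p y <= 2^-1 * (y - x) &
      phi_eq1 p x - phi_eq1 p y <= 2^-1 * (1 + p)].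
Proof.
move=> xy; rewrite /phi_eq1.
by have [x1|x1] := leP x (- p); have [x2|x2] := ltP x 1;
  have [y1|y1] := leP y (- p); have [y2|y2] := ltP y 1; split; plra.
Qed.

Lemma ramp_lipschitz (x y : R) : `|phi_eq1 p x - phi_eq1 p y| <= 2^-1 * `|x - y|.
Proof.
wlog xy : x y / x <= y.
  by move=> h; have [/h//|/ltW/h] := leP x y; rewrite distrC [X in _ * X]distrC.
have [h1 h2 _] := ramp_drop xy.
by rewrite ger0_norm// distrC ger0_norm ?subr_ge0.
Qed.

Lemma ramp_left : phi_eq1 p (- p) = (1 + p) / 4.
Proof. by rewrite /phi_eq1 lexx. Qed.

Lemma ramp_mid (x : R) : - p <= x -> x <= 1 -> phi_eq1 p x = (1 - p - 2 * x) / 4.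
Proof.
rewrite /phi_eq1 => px x1; have [h1|h1] := leP x (- p); last have [//|h2] := ltP x 1.
  by rewrite (_ : x = - p); [ring|apply/eqP; rewrite eq_le h1 px].
by rewrite (_ : x = 1); [ring|apply/eqP; rewrite eq_le h2 x1].
Qed.

Lemma ramp_bounded (x : R) : `|phi_eq1 p x| <= (1 + p) / 4.
Proof.
rewrite ler_norml /phi_eq1; have [h1|h1] := leP x (- p); last have [h2|h2] := ltP x 1;
  by apply/andP; split; plra.
Qed.

Lemma measurable_ramp : measurable_fun setT (phi_eq1 p).
Proof.
by apply: continuous_measurable_fun; exact: lipschitz_continuous ramp_lipschitz.
Qed.

Lemma ramp_lip_bounded (x : R) : lip_bounded 2^-1 (2^-1 * (1 + p)) (phi_eq1 p) x.
Proof.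
move=> t t0; have xt : x <= x + t by rewrite lerDl ltW.
have [h1 h2 h3] := ramp_drop xt; rewrite ger0_norm//; split=> //.
by move: h2; rewrite addrAC subrr add0r.
Qed.

(** The general bound with slope 1/2 and total drop [(1 + p) / 2], cut at [1 + p], where the linear
    and the constant bounds coincide. *)
Lemma weyl_ramp_le (x : R) :
  `|weyl k (phi_eq1 p) x| <= (1 + p) `^ (1 - k) / (2 * k * (1 - k)).
Proof.
have := weyl_bound k0 k1 L0 measurable_ramp (ramp_lip_bounded x).
rewrite powRN_1B//.
move=> /le_trans; apply; rewrite le_eqVlt; apply/orP; left; apply/eqP; field.
by rewrite !gt_eqF.
Qed.

(** Seen from its upper corner, the ramp attains the linear bound up to distance [1 + p] and the
    constant one beyond, so the general bound is an equality. *)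
Lemma weyl_ramp : weyl k (phi_eq1 p) (- p) = (1 + p) `^ (1 - k) / (2 * k * (1 - k)).
Proof.
have [ih hE] := powR_head_integral k1 L0.
have [it tE] := powR_tail_integral k0 L0.
have iw := weyl_integrable k0 k1 measurable_ramp (ramp_lip_bounded (- p)).
have i1 : (@lebesgue R).-integrable `]0, 1 + p]
    (EFin \o (fun t => (phi_eq1 p (- p) - phi_eq1 p (- p + t)) / t `^ (1 + k))).
  by apply: integrableS iw => // t /=; rewrite !in_itv/= => /andP[->].
have i2 : (@lebesgue R).-integrable `]1 + p, +oo[
    (EFin \o (fun t => (phi_eq1 p (- p) - phi_eq1 p (- p + t)) / t `^ (1 + k))).
  apply: integrableS iw => // t /=; rewrite !in_itv/= !andbT; exact: lt_trans.
have [||_ E] := Rintegral_itv_split _ _ i1 i2.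
- by rewrite bnd_simp ltW.
- by [].
rewrite /weyl E.
have -> : \int[lebesgue]_(t in `]0, 1 + p])
    ((phi_eq1 p (- p) - phi_eq1 p (- p + t)) / t `^ (1 + k)) =
    2^-1 * ((1 + p) `^ (1 - k) / (1 - k)).
  rewrite -hE -RintegralZl//; apply: eq_Rintegral => t.
  rewrite inE/= in_itv/= => /andP[t0 tp].
  rewrite ramp_left ramp_mid; [|plra|plra].
  have -> : t `^ (1 + k) = t * t `^ k.
    by rewrite powRD ?(gt_eqF t0) ?implybT// powRr1// ltW.
  by rewrite powRN; field; rewrite !gt_eqF ?powR_gt0.
have -> : \int[lebesgue]_(t in `]1 + p, +oo[)
    ((phi_eq1 p (- p) - phi_eq1 p (- p + t)) / t `^ (1 + k)) =
    2^-1 * (1 + p) * ((1 + p) `^ (- k) / k).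
  rewrite -tE -RintegralZl//; apply: eq_Rintegral => t.
  rewrite inE/= in_itv/= andbT => tp.
  have h1 : (- p + t <= - p) = false by apply/negbTE; rewrite -ltNge; plra.
  have h2 : (- p + t < 1) = false by apply/negbTE; rewrite -leNgt; plra.
  by rewrite ramp_left /phi_eq1 h1 h2 powRN; field; rewrite !gt_eqF ?powR_gt0//; plra.
rewrite powRN_1B//.
by field; rewrite !gt_eqF.
Qed.

End ramp.

(** * Smoothing of the ramp inside the class for s = 1 *)

Lemma ltr_near (R : realType) (a t : R) : t != a ->
  \forall u \near t, (a < u) = (a < t) /\ (u <= a) = (t <= a).
Proof.
move=> ta; have [lt|gt|e] := ltgtP t a; last by rewrite e eqxx in ta.
  by apply: filterS (lt_nbhsl lt) => u ua; rewrite (ltW ua) ltNge (ltW ua).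
by apply: filterS (lt_nbhsr gt) => u ua; rewrite ua leNgt ua.
Qed.

Section smooth_ramp.
Context (R : realType) (p e : R) (p0 : 0 <= p) (e0 : 0 < e) (ep : 3 * e < 1 + p).

Local Ltac plra := have := p0; have := e0; have := ep; lra.

(* The second derivative of a smoothing of the ramp; its L1 norm is 1. *)
Definition bumps (t : R) : R :=
  if (- p < t) && (t <= - p + e) then - (2 * e)^-1
  else if (1 - 2 * e < t) && (t <= 1 - e) then (2 * e)^-1 else 0.

Let h := (2 * e)^-1.

Let h0 : 0 < h. Proof. by rewrite invr_gt0 mulr_gt0. Qed.

Let he : h * e = 2^-1. Proof. by rewrite /h; field; rewrite gt_eqF. Qed.

Lemma measurable_bumps : measurable_fun setT bumps.
Proof.
apply: measurable_fun_ifT => //.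
  by apply: measurable_and; [exact: measurable_fun_ltr|exact: measurable_fun_ler].
apply: measurable_fun_ifT => //.
by apply: measurable_and; [exact: measurable_fun_ltr|exact: measurable_fun_ler].
Qed.

Lemma bumps_le (t : R) : `|bumps t| <= h.
Proof.
rewrite /bumps -/h; case: ifP => _; first by rewrite normrN ger0_norm// ltW.
by case: ifP => _; rewrite ?normr0 ?(ltW h0)// ger0_norm// ltW.
Qed.

Lemma bumps_left (t : R) : t <= - p -> bumps t = 0.
Proof.
move=> tp; rewrite /bumps ltNge tp/=.
have -> // : (1 - 2 * e < t) = false by apply/negbTE; rewrite -leNgt; plra.
Qed.

(** The second bump ends at [1 - e] rather than at 1 because [descent] requires the density to
    vanish at 1 itself, and the bumps are closed on the right. *)
Lemma bumps_right (t : R) : 1 - e < t -> bumps t = 0.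
Proof.
move=> t1; rewrite /bumps [t <= 1 - e]leNgt t1 andbF.
have -> : (t <= - p + e) = false by apply/negbTE; rewrite -ltNge; plra.
by rewrite andbF.
Qed.

Lemma bumps_first (t : R) : - p < t -> t <= - p + e -> bumps t = - h.
Proof. by move=> t1 t2; rewrite /bumps t1 t2. Qed.

Lemma bumps_mid (t : R) : - p + e < t -> t <= 1 - 2 * e -> bumps t = 0.
Proof.
by move=> t1 t2; rewrite /bumps [t <= - p + e]leNgt t1 andbF ltNge t2.
Qed.

Lemma bumps_second (t : R) : 1 - 2 * e < t -> t <= 1 - e -> bumps t = h.
Proof.
move=> t1 t2; rewrite /bumps t1 t2/=.
have -> : (t <= - p + e) = false by apply/negbTE; rewrite -ltNge; plra.
by rewrite andbF.
Qed.

Lemma bumps_le0 (t : R) : t <= 1 - 2 * e -> bumps t <= 0.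
Proof.
move=> t1; have [tp|pt] := leP t (- p); first by rewrite bumps_left.
have [tp'|pt'] := leP t (- p + e); last by rewrite bumps_mid.
by rewrite bumps_first// oppr_le0 ltW.
Qed.

Lemma bumps_ge0 (t : R) : - p + e < t -> 0 <= bumps t.
Proof.
move=> t1; have [te|te] := leP t (1 - 2 * e); first by rewrite bumps_mid.
have [te'|te'] := leP t (1 - e); last by rewrite bumps_right.
by rewrite bumps_second// ltW.
Qed.

Lemma bumps_continuous (t : R) : t \notin [:: - p; - p + e; 1 - 2 * e; 1 - e] ->
  {for t, continuous bumps}.
Proof.
rewrite !inE !negb_or => /and4P[t1 t2 t3 t4].
have near0 : \forall u \near t, cst (bumps t) u = bumps u.
  near=> u; rewrite /bumps /cst.
  have [-> _] : (- p < u) = (- p < t) /\ (u <= - p) = (t <= - p).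
    by near: u; exact: ltr_near.
  have [_ ->] : (- p + e < u) = (- p + e < t) /\ (u <= - p + e) = (t <= - p + e).
    by near: u; exact: ltr_near.
  have [-> _] : (1 - 2 * e < u) = (1 - 2 * e < t) /\ (u <= 1 - 2 * e) = (t <= 1 - 2 * e).
    by near: u; exact: ltr_near.
  have [_ ->] : (1 - e < u) = (1 - e < t) /\ (u <= 1 - e) = (t <= 1 - e).
    by near: u; exact: ltr_near.
  by [].
rewrite /prop_for /continuous_at.
by apply: cvg_trans (near_eq_cvg near0) _; exact: cvg_cst.
Unshelve. all: by end_near. Qed.

Let V x := \int[lebesgue]_(t in `]- p, x]) bumps t.

Let VB (x y : R) : x <= y -> V y - V x = \int[lebesgue]_(t in `]x, y]) bumps t.
Proof. exact: (integral_density measurable_bumps bumps_le bumps_left). Qed.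

Let Vconst (c x y : R) : x <= y -> (forall t, x < t -> t <= y -> bumps t = c) ->
  V y - V x = c * (y - x).
Proof. by move=> xy Tc; rewrite VB//; exact: Rintegral_oc_const. Qed.

Let iT (x y : R) : (@lebesgue R).-integrable `]x, y] (EFin \o bumps).
Proof. exact: (bounded_integrable_oc measurable_bumps (fun t _ _ => bumps_le t)).1. Qed.

Let Vle (x y : R) : x <= y -> (forall t, x < t -> t <= y -> bumps t <= 0) -> V y <= V x.
Proof.
move=> xy T0; rewrite -subr_le0 VB//.
rewrite -[leRHS](mul0r (y - x)) -Rintegral_cst_oc//.
apply: le_Rintegral => //; first exact: integrable_cst_oc.
by move=> t /=; rewrite in_itv/= => /andP[]; exact: T0.
Qed.

Let Vge (x y : R) : x <= y -> (forall t, x < t -> t <= y -> 0 <= bumps t) -> V x <= V y.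
Proof.
move=> xy T0; rewrite -subr_ge0 VB//; apply: Rintegral_ge0 => t /=.
by rewrite in_itv/= => /andP[]; exact: T0.
Qed.

Let Vleft (x : R) : x <= - p -> V x = 0.
Proof. exact: Rintegral_oc_empty. Qed.

(** Each bump has area 1/2, so between the bumps the slope is exactly that of the ramp. *)
Lemma bumps_integral_mid (x : R) : - p + e <= x -> x <= 1 - 2 * e -> V x = - 2^-1.
Proof.
move=> x1 x2.
have E1 : V (- p + e) - V (- p) = - h * (- p + e - (- p)).
  by apply: Vconst => [|t]; [plra|exact: bumps_first].
have E2 : V x - V (- p + e) = 0 * (x - (- p + e)).
  by apply: Vconst => // t t1 t2; apply: bumps_mid => //; exact: le_trans x2.
move: E1 E2; rewrite (Vleft (lexx (- p))) subr0 mul0r => E1 /eqP; rewrite subr_eq0 => /eqP ->.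
by rewrite E1 -he; ring.
Qed.

Lemma bumps_integral_right (x : R) : 1 - e <= x -> V x = 0.
Proof.
move=> x1.
have E1 : V (1 - e) - V (1 - 2 * e) = h * (1 - e - (1 - 2 * e)).
  by apply: Vconst => [|t]; [plra|exact: bumps_second].
have E2 : V x - V (1 - e) = 0 * (x - (1 - e)).
  by apply: Vconst => // t t1 _; exact: bumps_right.
have E3 : V (1 - 2 * e) = - 2^-1 by apply: bumps_integral_mid; plra.
move: E1 E2; rewrite E3 mul0r => E1 /eqP; rewrite subr_eq0 => /eqP ->.
have : h * (1 - e - (1 - 2 * e)) = 2^-1 by rewrite -he; ring.
by move: E1; lra.
Qed.

Lemma bumps_integral_le0 (x : R) : V x <= 0.
Proof.
have [x1|/ltW x1] := leP x (1 - 2 * e).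
  have [xp|/ltW px] := leP x (- p); first by rewrite Vleft.
  rewrite -(Vleft (lexx (- p))); apply: Vle => // t _ tx.
  by apply: bumps_le0; exact: le_trans x1.
have [xe|/ltW xe] := leP x (1 - e); last by rewrite bumps_integral_right.
rewrite -(bumps_integral_right (lexx (1 - e))); apply: Vge => // t xt _.
by apply: bumps_ge0; plra.
Qed.

Lemma bumps_integral_ge (x : R) : - 2^-1 <= V x.
Proof.
have E3 : V (- p + e) = - 2^-1 by apply: bumps_integral_mid; plra.
rewrite -E3; have [xp|/ltW px] := leP x (- p + e).
  by apply: Vle => // t _ te; apply: bumps_le0; plra.
by apply: Vge => // t te _; exact: bumps_ge0.
Qed.

Definition smooth_ramp : R -> R := descent bumps (- p) 1.

Let br (t : R) : 1 <= t -> bumps t = 0.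
Proof. by move=> t1; apply: bumps_right; plra. Qed.

Let V1 : \int[lebesgue]_(t in `]- p, 1]) bumps t = 0.
Proof. by apply: bumps_integral_right; plra. Qed.

Lemma smooth_ramp_lipschitz (x y : R) :
  `|smooth_ramp x - smooth_ramp y| <= 2^-1 * `|x - y|.
Proof.
apply: (descent_lipschitz 1 measurable_bumps bumps_le bumps_left) => //.
- exact: bumps_integral_le0.
- exact: bumps_integral_ge.
Qed.

Lemma smooth_ramp_bounded (x : R) : `|smooth_ramp x| <= smooth_ramp (- p).
Proof.
rewrite [leRHS](descent_left bumps 1 (lexx (- p))).
apply: (descent_bounded measurable_bumps bumps_le bumps_left br V1).
exact: bumps_integral_le0.
Qed.

Lemma smooth_ramp_right (x : R) : 1 <= x -> smooth_ramp x = - smooth_ramp (- p).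
Proof.
move=> x1; rewrite [in RHS]/smooth_ramp (descent_left bumps 1 (lexx (- p))).
exact: (descent_right measurable_bumps bumps_le bumps_left br V1).
Qed.

(** The total drop is twice the height: it is at most 1/2 times [1 + p], and at least 1/2 times the
    length [1 + p - 3 * e] between the bumps. *)
Lemma smooth_ramp_height :
  (1 + p) / 4 - e <= smooth_ramp (- p) /\ smooth_ramp (- p) <= (1 + p) / 4.
Proof.
have r1 : smooth_ramp 1 = - smooth_ramp (- p) by exact: smooth_ramp_right.
split; last first.
  have := le_trans (ler_norm _) (smooth_ramp_lipschitz (- p) 1).
  by rewrite r1 distrC ger0_norm; plra.
have [dF cV _ _] := descent_ac_derivatives 1 measurable_bumps bumps_le bumps_left.
have [z] : exists2 z : R, z \in `[- p + e, 1 - 2 * e] &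
    smooth_ramp (1 - 2 * e) - smooth_ramp (- p + e) = V z * (1 - 2 * e - (- p + e)).
  apply: MVT_segment => //; first by plra.
  by apply: continuous_subspaceT => z; exact: is_derive_continuous (dF z).
rewrite in_itv/= => /andP[z1 z2]; rewrite bumps_integral_mid// => E.
have m1 : smooth_ramp (- p + e) <= smooth_ramp (- p).
  by apply: (descent_nonincreasing 1 measurable_bumps bumps_le bumps_left
    bumps_integral_le0); plra.
have m2 : smooth_ramp 1 <= smooth_ramp (1 - 2 * e).
  by apply: (descent_nonincreasing 1 measurable_bumps bumps_le bumps_left
    bumps_integral_le0); plra.
by move: E m1 m2; rewrite r1; plra.
Qed.

(** The slope bound 1/2 from [- p] and from 1 confines the smoothed ramp between two lines of slope
    -1/2, parallel to the ramp and within [e] of it by the estimate of the height. *)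
Lemma smooth_ramp_close (x : R) : `|phi_eq1 p x - smooth_ramp x| <= e.
Proof.
have [c1 c2] := smooth_ramp_height.
have [xp|px] := leP x (- p).
  rewrite /smooth_ramp (descent_left bumps 1 xp) -(descent_left bumps 1 (lexx (- p))).
  by rewrite /phi_eq1 xp -/smooth_ramp ger0_norm; plra.
have [x1|/ltW x1] := leP 1 x.
  rewrite smooth_ramp_right// /phi_eq1 [x <= _]leNgt px [x < 1]ltNge x1/=.
  by rewrite ler0_norm; plra.
rewrite ramp_mid ?(ltW px)// ler_norml.
have l1 := le_trans (ler_norm _) (smooth_ramp_lipschitz (- p) x).
have l2 := le_trans (ler_norm _) (smooth_ramp_lipschitz x 1).
rewrite (smooth_ramp_right (lexx 1)) in l2.
have a1 : `|- p - x| = x + p by rewrite ler0_norm; plra.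
have a2 : `|x - 1| = 1 - x by rewrite ler0_norm; plra.
by rewrite a1 in l1; rewrite a2 in l2; apply/andP; split; plra.
Qed.

Lemma Ls_norm_bumps : Ls_norm 1 bumps = 1%E.
Proof.
have mb := measurable_bumps.
have ma : measurable_fun setT (fun t => `|bumps t|) by exact: measurableT_comp.
have ia (x y : R) : (@lebesgue R).-integrable `]x, y] (EFin \o (fun t => `|bumps t|)).
  apply: (bounded_integrable_oc ma (K := h) _).1 => t _ _.
  by rewrite normr_id bumps_le.
rewrite Ls_norm_EFin invr1 poweRe1; last exact: integral_ge0.
have [b1 b2] : (BRight (- p) <= BRight (- p + e) :> itv_bound R)%O /\
    (BRight (- p + e) <= BRight (1 - 2 * e) :> itv_bound R)%O.
  by rewrite !bnd_simp; split; plra.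
have b3 : (BRight (1 - 2 * e) <= BRight (1 - e) :> itv_bound R)%O.
  by rewrite bnd_simp; plra.
have [i1 E1] := Rintegral_itv_split b1 b2 (ia _ _) (ia _ _).
have [i2 E2] := Rintegral_itv_split (le_trans b1 b2) b3 (ia _ _) (ia _ _).
transitivity ((\int[lebesgue]_(t in `]- p, 1 - e]) `|bumps t|)%:E).
  transitivity (\int[lebesgue]_t `|bumps t|%:E)%E.
    by apply: eq_integral => t _; rewrite powRr1.
  apply: (integral_oc_support ia) => t tp; first by rewrite bumps_left// normr0.
  by rewrite bumps_right// normr0.
rewrite E2 E1 (Rintegral_oc_const (c := h)) => [|//|t t1 t2]; last first.
  by rewrite bumps_first// normrN gtr0_norm.
rewrite Rintegral_oc_eq0 => [|t t1 t2]; last by rewrite bumps_mid// normr0.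
rewrite (Rintegral_oc_const (c := h)) => [|//|t t1 t2]; last first.
  by rewrite bumps_second// gtr0_norm.
by congr EFin; rewrite /h; field; rewrite gt_eqF.
Qed.

Lemma smooth_ramp_L2infty : L2infty 1 smooth_ramp.
Proof.
apply: (descent_L2infty measurable_bumps bumps_le bumps_left br bumps_continuous V1) => //.
  exact: bumps_integral_le0.
by rewrite Ls_norm_bumps ltry.
Qed.

Lemma Ls_norm_smooth_ramp : Ls_norm 1 smooth_ramp^`(2)%classic = 1%E.
Proof.
by rewrite (Ls_norm_descent 1 measurable_bumps bumps_le bumps_left bumps_continuous)//
  Ls_norm_bumps.
Qed.

End smooth_ramp.

(** * The inequality and its sharpness for s = 1 *)

Section exponent_one_sharp.
Context (R : realType) (k : R) (n : nat).
Context (k0 : 0 < k) (k1 : k < 1) (kn : k < n%:R).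

Let p := p_opt k 1.
Let W := (1 + p) `^ (1 - k) / (2 * k * (1 - k)).

Let k10 : 0 < 1 - k. Proof. by rewrite subr_gt0. Qed.

Let p0 : 0 <= p. Proof. by have [/andP[]] := p_opt_eq1 k0 k1. Qed.

Let L0 : 0 < 1 + p. Proof. by rewrite ltr_wpDr. Qed.

Let N0 : 0 < (1 + p) / 4. Proof. by rewrite divr_gt0. Qed.

(** The difference from the ramp is 1-Lipschitz and bounded by [e]; cutting its singular integral at
    [e] gives an error of order [e^(1 - k)]. *)
Lemma weyl_smooth_ramp (e : R) : 0 < e -> 3 * e < 1 + p ->
  W <= `|weyl k (smooth_ramp p e) (- p)| + ((1 - k)^-1 + 2 / k) * e `^ (1 - k).
Proof.
move=> e0 ep; pose g t := phi_eq1 p t - smooth_ramp p e t.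
have gK x y : `|g x - g y| <= 1 * `|x - y|.
  have -> : g x - g y = (phi_eq1 p x - phi_eq1 p y) -
      (smooth_ramp p e x - smooth_ramp p e y) by rewrite /g; ring.
  apply: le_trans (ler_normB _ _) _.
  have := ramp_lipschitz p0 x y; have := smooth_ramp_lipschitz p0 e0 ep x y; lra.
have gM t : `|g t| <= e by exact: smooth_ramp_close.
have mg : measurable_fun setT g.
  by apply: continuous_measurable_fun; exact: lipschitz_continuous gK.
have mf : measurable_fun setT (smooth_ramp p e).
  apply: continuous_measurable_fun.
  exact: lipschitz_continuous (smooth_ramp_lipschitz p0 e0 ep).
have lf := lipschitz_lip_bounded (- p) (smooth_ramp_lipschitz p0 e0 ep)
  (smooth_ramp_bounded p0 e0 ep).
have := weyl_bound k0 k1 e0 mg (lipschitz_lip_bounded (- p) gK gM).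
rewrite (weylB k0 k1 (measurable_ramp p0) (ramp_lip_bounded p0 (- p)) mf lf).
rewrite weyl_ramp// -/W.
have -> : 1 * (e `^ (1 - k) / (1 - k)) + 2 * e * (e `^ (- k) / k) =
    ((1 - k)^-1 + 2 / k) * e `^ (1 - k).
  by rewrite powRN_1B//; field; rewrite !gt_eqF.
move=> h; have := ler_norm (W - weyl k (smooth_ramp p e) (- p)).
have := ler_norm (weyl k (smooth_ramp p e) (- p)); lra.
Qed.

Lemma sharp_constant_eq1 (c : R) :
  (forall (f : R -> R) (x L M : R), measurable_fun setT f ->
    lip_bounded L M f x -> marchaud k n f x = c * weyl k f x) ->
  sharp_constant k n 1 = `|c| * W / ((1 + p) / 4) `^ (1 - k).
Proof.
move=> mw; have PhiE : Phi k 1 = phi_eq1 p by rewrite /Phi /phi_opt /phi eqxx.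
rewrite /sharp_constant PhiE lambda1.
have mE x : marchaud k n (phi_eq1 p) x = c * weyl k (phi_eq1 p) x.
  exact: mw (measurable_ramp p0) (ramp_lip_bounded p0 x).
have zW : `|weyl k (phi_eq1 p) (- p)| = W.
  rewrite weyl_ramp// ger0_norm// divr_ge0 ?powR_ge0// !mulr_ge0//; exact: ltW.
rewrite (Ls_norm_marchaud k0 k1 (ramp_lipschitz p0) (ramp_bounded p0) mE
  (weyl_ramp_le k0 k1 p0) zW).
have cr := lipschitz_continuous (ramp_lipschitz p0).
have -> // : Ls_norm +oo%E (phi_eq1 p) = ((1 + p) / 4)%:E.
apply: (@Ls_norm_pinfty_max _ _ _ (- p)); [exact: cr|exact: ramp_bounded|].
by rewrite ramp_left gtr0_norm.
Qed.

(** The ramp itself is outside the class, so sharpness is tested on [smooth_ramp], and the error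
    vanishes with [e]. *)
Lemma corollary10_eq1 :
  (forall f : R -> R, L2infty 1 f ->
     kolmogorov_inequality k n 1 (sharp_constant k n 1) f) /\
  (forall C : R,
     (forall f : R -> R, L2infty 1 f -> kolmogorov_inequality k n 1 C f) ->
     sharp_constant k n 1 <= C).
Proof.
have [c mw] := marchaud_weyl k0 k1 kn.
have sE := sharp_constant_eq1 mw.
have N1 : 0 < ((1 + p) / 4) `^ (1 - k) by rewrite powR_gt0.
split=> [f Lf|C HC].
  (* The length [1 + p] of the ramp cancels in the quotient, which leaves the constant of
     [weyl_bound_eq1]. *)
  have -> : sharp_constant k n 1 = `|c| * (4 `^ (1 - k) / (2 * k * (1 - k))).
    rewrite sE /W quotient_powR ?(ltW L0)//; field.
    by rewrite !gt_eqF ?powR_gt0.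
  apply: (kolmogorov_of_weyl_bound mw Lf) => x; exact: weyl_bound_eq1.
(* The condition on [e] keeps the height of the smoothed ramp positive and its two bumps apart. *)
have bound (e : R) : 0 < e -> 8 * e <= 1 + p ->
    `|c| * W <= C * ((1 + p) / 4) `^ (1 - k) +
      `|c| * (((1 - k)^-1 + 2 / k) * e `^ (1 - k)).
  move=> e0 e8; have ep : 3 * e < 1 + p by lra.
  have Lf := smooth_ramp_L2infty p0 e0 ep.
  have fK := smooth_ramp_lipschitz p0 e0 ep.
  have fM := smooth_ramp_bounded p0 e0 ep.
  have [c1 c2] := smooth_ramp_height p0 e0 ep.
  have f0 : 0 < smooth_ramp p e (- p) by lra.
  have fy : Ls_norm +oo%E (smooth_ramp p e) = (smooth_ramp p e (- p))%:E.
    have cf := lipschitz_continuous fK.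
    by apply: (@Ls_norm_pinfty_max _ _ _ (- p)); [exact: cf|exact: fM|exact: gtr0_norm].
  have mE x : marchaud k n (smooth_ramp p e) x = c * weyl k (smooth_ramp p e) x.
    exact: marchaud_L2infty Lf.
  have cm : {for (- p), continuous (marchaud k n (smooth_ramp p e))}.
    have -> : marchaud k n (smooth_ramp p e) = (fun x => c * weyl k (smooth_ramp p e) x).
      exact/funext.
    by apply: cvgM; [exact: cvg_cst|exact: (weyl_continuous k0 k1 fK fM)].
  have := le_trans (Ls_norm_pinfty_ge cm) (HC _ Lf).
  rewrite fy Ls_norm_smooth_ramp// lambda1 lee_fin /= powR1 mulr1 mE normrM => le.
  have fk0 : 0 < smooth_ramp p e (- p) `^ (1 - k) by rewrite powR_gt0.
  (* The sign of [C] allows the height to be replaced by its upper bound [(1 + p) / 4]. *)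
  have C0 : 0 <= C.
    by rewrite -(pmulr_lge0 _ fk0); apply: le_trans le; rewrite mulr_ge0.
  have C1 : C * smooth_ramp p e (- p) `^ (1 - k) <= C * ((1 + p) / 4) `^ (1 - k).
    by rewrite ler_wpM2l//; apply: ge0_ler_powR; rewrite ?nnegrE ?(ltW f0) ?(ltW N0) ?(ltW k10).
  have := ler_wpM2l (normr_ge0 c) (weyl_smooth_ramp e0 ep).
  by rewrite mulrDr => /le_trans; apply; rewrite lerD2r; exact: le_trans C1.
rewrite sE ler_pdivrMr// leNgt; apply/negP => lt.
set D := (1 - k)^-1 + 2 / k in bound.
have D0 : 0 <= D by rewrite addr_ge0 ?divr_ge0 ?invr_ge0 ?(ltW k10) ?(ltW k0).
pose d := `|c| * W - C * ((1 + p) / 4) `^ (1 - k).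
have d0 : 0 < d by rewrite subr_gt0.
have cD : 0 < `|c| * D + 1 by rewrite ltr_wpDl// mulr_ge0.
(* The second entry makes the error [|c| * D * e^(1 - k)] smaller than the gap [d] supposed between
   the two sides; the added 1 keeps the denominator positive when [c = 0]. *)
pose e := Num.min ((1 + p) / 8) ((d / (`|c| * D + 1)) `^ (1 - k)^-1).
have e0 : 0 < e by rewrite lt_min divr_gt0//= powR_gt0// divr_gt0.
have e8 : 8 * e <= 1 + p.
  by rewrite -ler_pdivlMl// mulrC ge_min lexx.
have ek : e `^ (1 - k) <= d / (`|c| * D + 1).
  have -> : d / (`|c| * D + 1) = ((d / (`|c| * D + 1)) `^ (1 - k)^-1) `^ (1 - k).
    by rewrite -powRrM mulVf ?gt_eqF// powRr1// divr_ge0// ltW.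
  apply: ge0_ler_powR; rewrite ?nnegrE ?powR_ge0 ?(ltW e0) ?(ltW k10)//.
  by rewrite ge_min lexx orbT.
have := bound e e0 e8; rewrite leNgt => /negP; apply.
rewrite -ltrBrDl -/d mulrA.
apply: le_lt_trans (ler_wpM2l (mulr_ge0 (normr_ge0 c) D0) ek) _.
rewrite mulrA ltr_pdivrMr// [ltLHS]mulrC ltr_pM2l// ltrDl//.
Qed.

End exponent_one_sharp.

Theorem corollary10 (R : realType) (s : \bar R) (k : R) (n : nat)
    (hs : (1 <= s)%E) (hk0 : 0 < k) (hk1 : k < 1) (hn : k < n%:R) :
  (forall f : R -> R, L2infty s f ->
     kolmogorov_inequality k n s (sharp_constant k n s) f) /\
  (forall C : R,
     (forall f : R -> R, L2infty s f -> kolmogorov_inequality k n s C f) ->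
     sharp_constant k n s <= C).
Proof.
move: hs; rewrite le_eqVlt => /predU1P[<-|s1]; first exact: corollary10_eq1.
exact: corollary10_gt1.
Qed.
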